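(* Let $P$ be an LCM monoid, let $\mathcal{S}_P$ be its associated inverse semigroup of classes $[p,q,r]$ together with $0$, and let $\mathcal{G}_u(\mathcal{S}_P)$ be the universal groupoid of $\mathcal{S}_P$. Then $$C^*_{\mathrm{ts}}(P)\cong C^*_u(\mathcal{S}_P)\cong C^*(\mathcal{G}_u(\mathcal{S}_P)).$$
   Context: An LCM monoid is a cancellative (left and right) monoid $P$ such that for all $p,q\in P$: $pP\cap qP$ is either empty or equal to $rP$ for some $r\in P$, and $Pp\cap Pq$ is either empty or equal to $Pr$ for some $r\in P$. $U(P)$ denotes the group of invertible elements of $P$. The algebra $C^*_{\mathrm{ts}}(P)$. Let $\Delta=\{(bx,x): b,x\in P\}\subseteq P\times P$. For $Y\subseteq\Delta$ and $p\in P$ put $Y_p=\{(bpx,px): b,x\in P,\ (bpx,x)\in Y\}$ and $Y^p=\{(bpx,x): b,x\in P,\ (bpx,px)\in Y\}$. Let $\mathcal{J}(P)$ be the smallest collection of subsets of $\Delta$ which contains $\Delta$ and $\emptyset$, is closed under finite intersections, and contains $Y_p$ and $Y^p$ whenever $Y\in\mathcal{J}(P)$ and $p\in P$. $C^*_{\mathrm{ts}}(P)$ is the universal unital C*-algebra generated by partial isometries $\{S_p: p\in P\}$ and projections $\{f_Y: Y\in\mathcal{J}(P)\}$ such that (i) $S_pS_q=S_{pq}$; (ii) $f_Yf_Z=f_{Y\cap Z}$; (iii) $f_\Delta=1$, $f_\emptyset=0$; (iv) $S_pf_YS_p^*=f_{Y_p}$; (v) $S_p^*f_YS_p=f_{Y^p}$,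 for all $p,q\in P$ and $Y,Z\in\mathcal{J}(P)$. The inverse semigroup $\mathcal{S}_P$. On $P\times P\times P$ put $(p,q,r)\sim(a,b,c)$ iff there exist $u,v\in U(P)$ with $p=au$, $q=vbu$, $r=vc$; let $[p,q,r]$ denote the class. Then $\mathcal{S}_P=\{[p,q,r]: p,q,r\in P,\ q\in rP\cap Pp\}\cup\{0\}$ is an inverse semigroup with zero $0$, with $[p,q,r]^*=[r_1,q,p_1]$ where $q=rr_1=p_1p$, and product $[p,q,r][a,b,c]=[pq_1,\,r_1raa_1,\,b_1c]$ if $raP\cap qP=kP$ with $raa_1=qq_1=k$ and $Pra\cap Pb=Pl$ with $r_1ra=b_1b=l$ for some $k,l,a_1,q_1,r_1,b_1\in P$, and $[p,q,r][a,b,c]=0$ if $raP\cap qP$ or $Pra\cap Pb$ is empty. For an inverse semigroup $S$ with zero and idempotent semilattice $E$: a representation of $S$ in a C*-algebra $A$ is a map $\pi:S\to A$ with $\pi(st)=\pi(s)\pi(t)$, $\pi(s^* )=\pi(s)^*$, $\pi(0)=0$; $C^*_u(S)$ is the universal C*-algebra for representations of $S$. A filter in $E$ is a nonempty proper subset that is upwards closed and closed under products; the set $\widehat E_0$ of filters carries the subspace topology from $\{0,1\}^E$. $S$ acts on $\widehat E_0$ by $D_e=\{\xi\in\widehat E_0: e\in\xi\}$ and $\alpha_s:D_{s^*s}\to D_{ss^*}$, $\alpha_s(\xi)=\{f\in E: f\geqslant ses^*\text{ for some }e\in\xi\}$. The universal groupoid $\mathcal{G}_u(S)$ is the transformation groupoid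 of this action: classes $[s,x]$ with $s\in S$, $x\in D_{s^*s}$, where $[s,x]=[t,y]$ iff $x=y$ and there is $e\in E$ with $x\in D_e$ and $se=te$; $d[s,x]=x$, $r[s,x]=\alpha_s(x)$, $[s,x]^{-1}=[s^*,\alpha_s(x)]$, $[t,\alpha_s(x)][s,x]=[ts,x]$; with the étale topology generated by the sets $\Theta(s,U)=\{[s,x]: x\in U\}$, $U\subseteq D_{s^*s}$ open. $C^*(\mathcal{G})$ is the full groupoid C*-algebra. *)

(* Defs.v *)
From HB Require Import structures.
From mathcomp Require Import all_boot all_order all_algebra.
From mathcomp Require Import complex.
From mathcomp Require Import all_classical all_reals all_analysis.

Set Implicit Arguments.
Unset Strict Implicit.
Unset Printing Implicit Defensive.

Import Order.TTheory GRing.Theory Num.Theory numFieldNormedType.Exports.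
Local Open Scope classical_set_scope.
Local Open Scope quotient_scope.
Local Open Scope ring_scope.

(** * C*-algebras *)

(* The complex numbers over [R], packed so that the norm and the topology
   of the field are inferred. *)
Definition CC (R : realType) : numClosedFieldType := R[i].

(* C*-algebras need not have a unit; the zero algebra is one of them. *)
HB.mixin Record isCstarAlgebra (R : realType) A
    of CompleteNormedModule (CC R) A := {
  cmul : A -> A -> A;
  cstar : A -> A;
  cmulA : associative cmul;
  cmulDl : left_distributive cmul +%R;
  cmulDr : right_distributive cmul +%R;
  cmulZl : forall (k : CC R) (a b : A), cmul (k *: a) b = k *: cmul a b;
  cmulZr : forall (k : CC R) (a b : A), cmul a (k *: b) = k *: cmul a b;
  cstarK : involutive cstar;
  cstarD : {morph cstar : a b / a + b};
  cstarZ : forall (k : CC R) (a : A), cstar (k *: a) = k^* *: cstar a;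
  cstarM : forall a b : A, cstar (cmul a b) = cmul (cstar b) (cstar a);
  cmul_norm : forall a b : A, `|cmul a b| <= `|a| * `|b|;
  cstar_norm : forall a : A, `|cmul (cstar a) a| = `|a| ^+ 2
}.

#[short(type="cstarType")]
HB.structure Definition CstarAlgebra (R : realType) :=
  {A of isCstarAlgebra R A & CompleteNormedModule (CC R) A}.

Declare Scope cstar_scope.
Delimit Scope cstar_scope with cst.
Notation "a ** b" := (cmul a b)
  (at level 40, left associativity) : cstar_scope.
Notation "a ^†" := (cstar a)
  (at level 1, format "a ^†") : cstar_scope.
Local Open Scope cstar_scope.

Section CstarTheory.
Variable R : realType.

Definition star_hom (A B : cstarType R) (phi : A -> B) : Prop :=
  [/\ linear phi, forall a b, phi (a ** b) = phi a ** phi b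
    & forall a, phi (a^†) = (phi a)^†].

Definition cstar_iso (A B : cstarType R) : Prop :=
  exists phi : A -> B, star_hom phi /\ bijective phi.

Definition closed_star_subalgebra (A : cstarType R) (D : set A) : Prop :=
  [/\ closed D, D 0, forall (k : CC R) a b, D a -> D b -> D (k *: a + b),
      forall a b, D a -> D b -> D (a ** b) & forall a, D a -> D (a^†)].

Definition generates (A : cstarType R) (X : set A) : Prop :=
  smallest (@closed_star_subalgebra A) X = setT.

Definition projection (A : cstarType R) (e : A) : Prop :=
  e ** e = e /\ e^† = e.

Definition partial_isometry (A : cstarType R) (s : A) : Prop :=
  s ** s^† ** s = s.

Definition is_one (A : cstarType R) (e : A) : Prop :=
  forall a, e ** a = a /\ a ** e = a.

End CstarTheory.

Local Open Scope group_scope.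

(** * LCM monoids *)

Definition rideal (P : magmaType) (p : P) : set P := range (fun x => p * x).
Definition lideal (P : magmaType) (p : P) : set P := range (fun x => x * p).

HB.mixin Record isLCM P of Monoid P := {
  lcm_mulgI : forall p x y : P, p * x = p * y -> x = y;
  lcm_mulIg : forall p x y : P, x * p = y * p -> x = y;
  lcm_rideal : forall p q : P, rideal p `&` rideal q = set0 \/
    exists r : P, rideal p `&` rideal q = rideal r;
  lcm_lideal : forall p q : P, lideal p `&` lideal q = set0 \/
    exists r : P, lideal p `&` lideal q = lideal r
}.

#[short(type="lcmMonoidType")]
HB.structure Definition LCMMonoid := {P of Monoid P & isLCM P}.

Definition invertible (P : monoidType) (u : P) : Prop :=
  exists v, u * v = 1 /\ v * u = 1.

(** * The algebra of a monoid on two-sided translates *)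

Section TwoSided.
Variable P : monoidType.

Definition Delta : set (P * P) := [set bx | exists b x : P, bx = (b * x, x)].

Definition lower (Y : set (P * P)) (p : P) : set (P * P) :=
  [set z | exists b x : P, z = (b * p * x, p * x) /\ Y (b * p * x, x)].

Definition upper (Y : set (P * P)) (p : P) : set (P * P) :=
  [set z | exists b x : P, z = (b * p * x, x) /\ Y (b * p * x, p * x)].

Inductive JP : set (P * P) -> Prop :=
| JP_Delta : JP Delta
| JP_empty : JP set0
| JP_inter Y Z : JP Y -> JP Z -> JP (Y `&` Z)
| JP_lower Y p : JP Y -> JP (lower Y p)
| JP_upper Y p : JP Y -> JP (upper Y p).

Section Relations.
Variable R : realType.

(* [f Y] is meaningful only for [Y] in [JP]; [ts_f_Delta] forces [A]
   to be unital. *)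
Record ts_family (A : cstarType R) (S : P -> A) (f : set (P * P) -> A) :
    Prop := {
  ts_S_piso : forall p, partial_isometry (S p);
  ts_f_proj : forall Y, JP Y -> projection (f Y);
  ts_S_mul : forall p q, S p ** S q = S (p * q);
  ts_f_mul : forall Y Z, JP Y -> JP Z -> f Y ** f Z = f (Y `&` Z);
  ts_f_Delta : is_one (f Delta);
  ts_f_empty : f set0 = 0%R;
  ts_f_lower : forall p Y, JP Y -> S p ** f Y ** (S p)^† = f (lower Y p);
  ts_f_upper : forall p Y, JP Y -> (S p)^† ** f Y ** S p = f (upper Y p)
}.

(* A morphism as in the last clause is unital because it maps [f Delta] to
   [f' Delta]; it is unique because the algebra is generated. *)
Definition is_Cstar_ts (A : cstarType R) : Prop :=
  exists (S : P -> A) (f : set (P * P) -> A),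
  [/\ ts_family S f,
      generates (range S `|` f @` [set Y | JP Y])
    & forall (B : cstarType R) (S' : P -> B) (f' : set (P * P) -> B),
        ts_family S' f' ->
        exists phi : A -> B, [/\ star_hom phi, forall p, phi (S p) = S' p
          & forall Y, JP Y -> phi (f Y) = f' Y]].

End Relations.
End TwoSided.

(** * Inverse semigroups with zero *)

HB.mixin Record isInverseSemigroup0 S of Semigroup S := {
  sinv : S -> S;
  szero : S;
  mul_sinvK : forall s : S, s * sinv s * s = s;
  sinv_mulK : forall s : S, sinv s * s * sinv s = sinv s;
  sinv_uniq : forall s t : S, s * t * s = s -> t * s * t = t -> t = sinv s;
  mul_szerol : forall s : S, szero * s = szero;
  mul_szeror : forall s : S, s * szero = szero
}.

#[short(type="invSemigroup0Type")]
HB.structure Definition InverseSemigroup0 :=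
  {S of Semigroup S & isInverseSemigroup0 S}.

Section Representations.
Variables (R : realType) (S : invSemigroup0Type).

Definition isg_rep (A : cstarType R) (pi : S -> A) : Prop :=
  [/\ forall s t, pi (s * t) = pi s ** pi t, forall s, pi (sinv s) = (pi s)^†
    & pi szero = 0%R].

Definition is_Cstar_u (A : cstarType R) : Prop :=
  exists pi : S -> A,
  [/\ isg_rep pi, generates (range pi)
    & forall (B : cstarType R) (rho : S -> B), isg_rep rho ->
        exists phi : A -> B, star_hom phi /\ forall s, phi (pi s) = rho s].

End Representations.

Section InverseSemigroupTheory.
Variable S : invSemigroup0Type.
Implicit Types s t u e f : S.

Definition idem : set S := [set e | e * e = e].

Lemma sinvK s : sinv (sinv s) = s.
Proof. by apply/esym/sinv_uniq; [exact: sinv_mulK|exact: mul_sinvK]. Qed.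

Lemma sinv_idem e : idem e -> sinv e = e.
Proof. by move=> /= ee; apply/esym/sinv_uniq; rewrite !ee. Qed.

Lemma idemM e f : idem e -> idem f -> idem (e * f).
Proof.
move=> /= ee ff; set x := sinv (e * f).
have xE : x = f * x * e.
  apply/esym/sinv_uniq.
    have -> : e * f * (f * x * e) * (e * f)
            = e * (f * f) * x * (e * e) * f by rewrite !mulgA.
    by rewrite ee ff -[RHS]mul_sinvK -/x !mulgA.
  have -> : f * x * e * (e * f) * (f * x * e)
          = f * (x * ((e * e) * (f * f)) * x) * e by rewrite !mulgA.
  by rewrite ee ff sinv_mulK.
have xx : x * x = x.
  rewrite [in LHS]xE -[RHS]/x [RHS]xE.
  have -> : f * x * e * (f * x * e) = f * (x * (e * f) * x) * e.
    by rewrite !mulgA.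
  by rewrite sinv_mulK.
have -> : e * f = x.
  by rewrite -[LHS]sinvK -/x; exact: sinv_idem.
exact: xx.
Qed.

Lemma idemC e f : idem e -> idem f -> e * f = f * e.
Proof.
move=> ie ife; have := idemM ie ife; have := idemM ife ie.
move: (ie) (ife) => /= ee ff hfe hef.
rewrite -[LHS](sinv_idem hef); apply/esym/sinv_uniq.
  have -> : e * f * (f * e) * (e * f) = e * (f * f) * (e * e) * f.
    by rewrite !mulgA.
  by rewrite ee ff -[RHS]hef !mulgA.
have -> : f * e * (e * f) * (f * e) = f * (e * e) * (f * f) * e.
  by rewrite !mulgA.
by rewrite ee ff -[RHS]hfe !mulgA.
Qed.

Lemma idem_dom s : idem (sinv s * s).
Proof. by rewrite /idem /= !mulgA sinv_mulK. Qed.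

Lemma idem_cod s : idem (s * sinv s).
Proof. by rewrite /idem /= !mulgA mul_sinvK. Qed.

Lemma sinvM s t : sinv (s * t) = sinv t * sinv s.
Proof.
have c := idemC (idem_cod t) (idem_dom s).
apply/esym/sinv_uniq.
  have -> : s * t * (sinv t * sinv s) * (s * t)
          = s * ((t * sinv t) * (sinv s * s)) * t by rewrite !mulgA.
  rewrite c; have -> : s * (sinv s * s * (t * sinv t)) * t
          = (s * sinv s * s) * (t * sinv t * t) by rewrite !mulgA.
  by rewrite !mul_sinvK.
have -> : sinv t * sinv s * (s * t) * (sinv t * sinv s)
        = sinv t * ((sinv s * s) * (t * sinv t)) * sinv s by rewrite !mulgA.
rewrite -c; have -> : sinv t * (t * sinv t * (sinv s * s)) * sinv s
        = (sinv t * t * sinv t) * (sinv s * s * sinv s) by rewrite !mulgA.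
by rewrite !sinv_mulK.
Qed.

Lemma idem_conj s e : idem e -> idem (s * e * sinv s).
Proof.
move=> ie; rewrite /idem /=.
have -> : s * e * sinv s * (s * e * sinv s)
        = s * (e * (sinv s * s)) * (e * sinv s) by rewrite !mulgA.
rewrite (idemC ie (idem_dom s)) !mulgA mul_sinvK.
by rewrite -(mulgA s e e) ie.
Qed.

Lemma conjM_idem s e f : idem e -> idem f ->
  s * (e * f) * sinv s = (s * e * sinv s) * (s * f * sinv s).
Proof.
move=> ie jf.
have -> : s * e * sinv s * (s * f * sinv s)
   = s * (e * (sinv s * s)) * f * sinv s by rewrite !mulgA.
by rewrite (idemC ie (idem_dom s)) !mulgA mul_sinvK.
Qed.

End InverseSemigroupTheory.

(** * The universal groupoid of an inverse semigroup *)

Section Spectrum.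
Variable S : invSemigroup0Type.

Definition idemType : Type := set_type (@idem S).
HB.instance Definition _ := Choice.on idemType.

Definition idem_le (e f : S) : Prop := e * f = e.

Definition is_filter (x : {ptws idemType -> bool}) : Prop :=
  [/\ exists e, x e, exists e, ~~ x e,
      forall e f, x e -> idem_le (val e) (val f) -> x f
    & forall e f g, x e -> x f -> val g = val e * val f -> x g].

(* [set_type] carries the topology induced by the topology of pointwise
   convergence. *)
Definition filt : Type := set_type [set x | is_filter x].
HB.instance Definition _ := Topological.on filt.
HB.instance Definition _ := SubType.on filt.

Definition contains (x : filt) (e : idemType) : bool :=
  (\val x : {ptws idemType -> bool}) e.

Definition idem_of (e : S) (ie : idem e) : idemType :=
  exist _ e (mem_set ie).

Definition dom_idem (s : S) : idemType := idem_of (idem_dom s).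
Definition cod_idem (s : S) : idemType := idem_of (idem_cod s).

Definition alpha_fun (s : S) (x : filt) : {ptws idemType -> bool} :=
  fun f => `[< exists e, contains x e /\
                         idem_le (s * \val e * sinv s) (\val f) >].

(* Meaningful only if [x] contains [dom_idem s], see [contains_alpha]. *)
Definition alpha (s : S) (x : filt) : filt := insubd x (alpha_fun s x).

Lemma filtP (x y : filt) : (forall e, contains x e = contains y e) -> x = y.
Proof. by move=> xy; apply: val_inj; apply/funext => e; exact: xy. Qed.

Lemma filtW (x : filt) : is_filter (\val x).
Proof. exact: (set_mem (valP x)). Qed.

Lemma idem_val (e : idemType) : idem (\val e).
Proof. exact: (set_mem (valP e)). Qed.

Lemma contains_le (x : filt) (e f : idemType) :
  contains x e -> idem_le (\val e) (\val f) -> contains x f.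
Proof. by case: (filtW x) => _ _ + _; apply. Qed.

Lemma contains_mul (x : filt) (e f : idemType) : contains x e ->
  contains x f -> contains x (idem_of (idemM (idem_val e) (idem_val f))).
Proof. by move=> xe xf; case: (filtW x) => _ _ _ /(_ e f); apply. Qed.

Lemma not_contains0 (x : filt) (e : idemType) :
  contains x e -> \val e <> szero.
Proof.
move=> xe e0; case: (filtW x) => _ [f nxf] up _; move/negP: nxf; apply.
by apply: up xe _; rewrite e0 /idem_le mul_szerol.
Qed.

Lemma alpha_filter (s : S) (x : filt) :
  contains x (dom_idem s) -> is_filter (alpha_fun s x).
Proof.
move=> xs; split.
- exists (cod_idem s); apply/asboolP; exists (dom_idem s); split=> //=.
  by rewrite /idem_le !mulgA !mul_sinvK.
- exists (idem_of (mul_szerol szero : idem (szero : S))).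
  apply/negP => /asboolP [e [xe]]; rewrite /idem_le /= mul_szeror => h.
  have xse := contains_mul (contains_mul xs xe) xs.
  apply: (not_contains0 xse) => /=.
  have -> : sinv s * s * \val e * (sinv s * s)
          = sinv s * (s * \val e * sinv s) * s by rewrite !mulgA.
  by rewrite -h mul_szeror mul_szerol.
- move=> e f /asboolP [e' [xe' le]] ef; apply/asboolP; exists e'; split=> //.
  by rewrite /idem_le -le -mulgA ef.
- move=> e f g /asboolP [e' [xe' le]] /asboolP [f' [xf' lf]] gE.
  apply/asboolP; exists (idem_of (idemM (idem_val e') (idem_val f'))).
  split; first exact: contains_mul.
  rewrite /= (conjM_idem s (idem_val e') (idem_val f')) /idem_le gE.
  have be := idemC (idem_conj s (idem_val f')) (idem_val e).
  set a' := s * _ * _ in le *; set b := s * _ * _ in lf be *.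
  have -> : a' * b * (\val e * \val f) = a' * (b * \val e) * \val f.
    by rewrite !mulgA.
  by rewrite be mulgA le -mulgA lf.
Qed.

Lemma contains_alpha (s : S) (x : filt) (f : idemType) :
  contains x (dom_idem s) ->
  contains (alpha s x) f <->
  exists e, contains x e /\ idem_le (s * \val e * sinv s) (\val f).
Proof.
move=> xs; rewrite /contains /alpha val_insubd mem_set; last first.
  exact: alpha_filter.
by split=> [/asboolP|?]; [|apply/asboolP].
Qed.

Lemma cod_alpha (s : S) (x : filt) :
  contains x (dom_idem s) -> contains (alpha s x) (cod_idem s).
Proof.
move=> xs; apply/(contains_alpha _ xs); exists (dom_idem s); split=> //=.
by rewrite /idem_le !mulgA !mul_sinvK.
Qed.

(** Germs *)

Definition pregerm : Type :=
  set_type [set sx : S * filt | contains sx.2 (dom_idem sx.1)].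
HB.instance Definition _ := Choice.on pregerm.
HB.instance Definition _ := SubType.on pregerm.

Definition germ_eq (a b : pregerm) : Prop :=
  (\val a).2 = (\val b).2 /\
  exists e : idemType, contains (\val a).2 e /\
    (\val a).1 * \val e = (\val b).1 * \val e.

Lemma germ_eq_equiv : equiv_class_of (fun a b => `[< germ_eq a b >]).
Proof.
split.
- move=> [[s x] sx]; apply/asboolP; split=> //.
  by exists (dom_idem s); split=> //; exact: (set_mem sx).
- move=> a b; apply/asboolP/asboolP => -[xy [e [xe E]]]; split=> //;
    exists e; split=> //; by rewrite ?xy // -xy.
- move=> b a c /asboolP [ab [e [ae E]]] /asboolP [bc [f [bf F]]].
  apply/asboolP; split; first by rewrite ab.
  exists (idem_of (idemM (idem_val e) (idem_val f))); split.
    by apply: contains_mul => //; rewrite ab.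
  rewrite /= mulgA E -mulgA (idemC (idem_val e) (idem_val f)).
  by rewrite mulgA F -mulgA.
Qed.

Canonical germ_eq_rel := EquivRelPack germ_eq_equiv.

Definition germ : Type := {eq_quot germ_eq_rel}.
HB.instance Definition _ := Choice.on germ.

Definition germ_of (s : S) (x : filt) (sx : contains x (dom_idem s)) : germ :=
  \pi_(germ) (exist _ (s, x) (mem_set sx) : pregerm).

Definition Theta (s : S) (U : set filt) : set germ :=
  [set g | exists x (sx : contains x (dom_idem s)), U x /\ g = germ_of sx].

Definition Thetas : set (set germ) :=
  [set W | exists s U, [/\ open U, U `<=` [set x | contains x (dom_idem s)]
                         & W = Theta s U]].

HB.instance Definition _ :=
  @isSubBaseTopological.Build germ (set germ) Thetas id.

(* The class of [(s, x)] if [x] contains [dom_idem s], and [g] otherwise. *)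
Definition germ_def (g : germ) (s : S) (x : filt) : germ :=
  \pi_(germ) (insubd (repr g) (s, x) : pregerm).

Definition germ_dom (g : germ) : filt := (\val (repr g)).2.
Definition germ_cod (g : germ) : filt :=
  alpha (\val (repr g)).1 (germ_dom g).
Definition germ_inv (g : germ) : germ :=
  germ_def g (sinv (\val (repr g)).1) (germ_cod g).
Definition germ_mul (g h : germ) : germ :=
  germ_def h ((\val (repr g)).1 * (\val (repr h)).1) (germ_dom h).

Lemma germP (g : germ) : exists s x (sx : contains x (dom_idem s)),
  g = germ_of sx.
Proof.
exists (\val (repr g)).1, (\val (repr g)).2, (set_mem (valP (repr g))).
rewrite -[LHS]reprK; congr (\pi_(germ) _); apply: val_inj => /=.
by case: (\val _).
Qed.

Lemma germ_of_eq s x (sx : contains x (dom_idem s)) t y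
    (ty : contains y (dom_idem t)) :
  germ_of sx = germ_of ty <->
  x = y /\ exists e : idemType, contains x e /\ s * \val e = t * \val e.
Proof.
by split=> [/eqmodP/asboolP//|h]; apply/eqmodP/asboolP.
Qed.

Lemma germ_defE g s x (sx : contains x (dom_idem s)) :
  germ_def g s x = germ_of sx.
Proof.
congr (\pi_(germ) _); apply: val_inj; rewrite val_insubd mem_set //.
Qed.

Lemma repr_germ_of s x (sx : contains x (dom_idem s)) :
  (\val (repr (germ_of sx))).2 = x /\ exists e : idemType, contains x e /\
    (\val (repr (germ_of sx))).1 * \val e = s * \val e.
Proof.
have : \pi_(germ) (repr (germ_of sx)) = germ_of sx by exact: reprK.
by move/eqmodP/asboolP => /= [-> [e [xe E]]]; split=> //; exists e.
Qed.

Lemma repr_germ (g : germ) :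
  contains (\val (repr g)).2 (dom_idem (\val (repr g)).1).
Proof. exact: (set_mem (valP (repr g))). Qed.

Lemma alpha_eq s t x (e : idemType) : contains x (dom_idem s) ->
  contains x (dom_idem t) -> contains x e ->
  s * \val e = t * \val e -> alpha s x = alpha t x.
Proof.
move=> + + xe; have main u v : contains x (dom_idem u) ->
    contains x (dom_idem v) -> u * \val e = v * \val e ->
    forall f, contains (alpha u x) f -> contains (alpha v x) f.
  move=> xu xv uv f /(contains_alpha _ xu) [e' [xe' le]].
  apply/(contains_alpha _ xv).
  exists (idem_of (idemM (idem_val e) (idem_val e'))); split.
    exact: contains_mul.
  have vE : v * (\val e * \val e') * sinv v
          = u * (\val e * \val e') * sinv u.
    have -> : \val e * \val e' = \val e * \val e' * \val e.
      by rewrite -mulgA (idemC (idem_val e') (idem_val e)) mulgA idem_val.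
    have E w : w * (\val e * \val e' * \val e) * sinv w
        = w * \val e * \val e' * sinv (w * \val e).
      by rewrite sinvM (sinv_idem (idem_val e)) !mulgA.
    by rewrite !E uv.
  rewrite /= vE /idem_le (conjM_idem u (idem_val e) (idem_val e')).
  by rewrite -mulgA le.
move=> xs xt st; apply: filtP => f; apply/idP/idP; exact: main.
Qed.

Lemma alpha_comp_dom s t x : contains x (dom_idem s) ->
  contains (alpha s x) (dom_idem t) -> contains x (dom_idem (t * s)).
Proof.
move=> xs /(contains_alpha _ xs) [e [xe le]].
apply: (contains_le (contains_mul xs xe)); move: le; rewrite /idem_le /= => le.
rewrite sinvM.
have -> : sinv s * s * \val e * (sinv s * sinv t * (t * s))
        = sinv s * (s * \val e * sinv s * (sinv t * t)) * s by rewrite !mulgA.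
rewrite le.
have -> : sinv s * (s * \val e * sinv s) * s
        = sinv s * s * (\val e * (sinv s * s)) by rewrite !mulgA.
by rewrite (idemC (idem_val e) (idem_dom s)) !mulgA sinv_mulK.
Qed.

Lemma alpha_comp s t x : contains x (dom_idem s) ->
  contains (alpha s x) (dom_idem t) -> alpha (t * s) x = alpha t (alpha s x).
Proof.
move=> xs xt; have xts := alpha_comp_dom xs xt.
have E e : t * s * e * sinv (t * s) = t * (s * e * sinv s) * sinv t.
  by rewrite sinvM !mulgA.
apply: filtP => f; apply/idP/idP.
  move=> /(contains_alpha _ xts) [e [xe le]]; apply/(contains_alpha _ xt).
  exists (idem_of (idem_conj s (idem_val e))); split; last by rewrite /= -E.
  apply/(contains_alpha _ xs); exists e; split=> //=.
  exact: idem_conj (idem_val e).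
move=> /(contains_alpha _ xt) [g [xg le]]; apply/(contains_alpha _ xts).
move: xg => /(contains_alpha _ xs) [e [xe le']]; exists e; split=> //.
rewrite E -le' /idem_le.
rewrite (conjM_idem t (idem_conj s (idem_val e)) (idem_val g)).
by rewrite -mulgA le.
Qed.

Lemma alpha_idem (e : idemType) x : contains x e -> alpha (\val e) x = x.
Proof.
move=> xe; have xd : contains x (dom_idem (\val e)).
  apply: contains_le xe _; rewrite /idem_le /= (sinv_idem (idem_val e)).
  by rewrite !idem_val.
apply: filtP => f; apply/idP/idP.
  move=> /(contains_alpha _ xd) [g [xg le]].
  apply: contains_le (contains_mul (contains_mul xe xg) xe) _.
  by move: le; rewrite (sinv_idem (idem_val e)).
move=> xf; apply/(contains_alpha _ xd); exists f; split=> //.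
rewrite (sinv_idem (idem_val e)) /idem_le.
have efe : \val e * \val f * \val e = \val e * \val f.
  by rewrite -mulgA (idemC (idem_val f) (idem_val e)) mulgA idem_val.
by rewrite efe -mulgA idem_val.
Qed.

Lemma dom_alpha_sinv s x : contains x (dom_idem s) ->
  contains (alpha s x) (dom_idem (sinv s)).
Proof.
move=> xs; apply: contains_le (cod_alpha xs) _.
by rewrite /idem_le /= sinvK; exact: idem_cod.
Qed.

Lemma alpha_sinv s x : contains x (dom_idem s) ->
  alpha (sinv s) (alpha s x) = x.
Proof.
move=> xs; rewrite -alpha_comp //; last exact: dom_alpha_sinv.
exact: (@alpha_idem (dom_idem s)).
Qed.

Lemma germ_dom_of s x (sx : contains x (dom_idem s)) :
  germ_dom (germ_of sx) = x.
Proof. by case: (repr_germ_of sx). Qed.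

Lemma germ_cod_of s x (sx : contains x (dom_idem s)) :
  germ_cod (germ_of sx) = alpha s x.
Proof.
rewrite /germ_cod germ_dom_of; case: (repr_germ_of sx) => E [e [xe F]].
by apply: (alpha_eq _ _ xe F) => //; rewrite -[X in contains X]E repr_germ.
Qed.

Lemma germ_inv_of s x (sx : contains x (dom_idem s)) :
  germ_inv (germ_of sx) = germ_of (dom_alpha_sinv sx).
Proof.
rewrite /germ_inv germ_cod_of; case: (repr_germ_of sx) => E [e [xe F]].
set r := (\val (repr (germ_of sx))).1 in F *.
have xr : contains x (dom_idem r) by rewrite -[X in contains X]E repr_germ.
have axr : alpha r x = alpha s x by exact: (alpha_eq _ _ xe F).
have sr : contains (alpha s x) (dom_idem (sinv r)).
  by rewrite -axr; exact: dom_alpha_sinv.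
rewrite (germ_defE _ sr); apply/germ_of_eq; split=> //.
exists (idem_of (idem_conj s (idem_val e))); split.
  apply/(contains_alpha _ sx); exists e; split=> //=.
  exact: idem_conj (idem_val e).
have main u : sinv u * (u * \val e * sinv u) = sinv (u * \val e).
  rewrite sinvM (sinv_idem (idem_val e)).
  have -> : sinv u * (u * \val e * sinv u)
          = sinv u * u * \val e * sinv u by rewrite !mulgA.
  by rewrite (idemC (idem_dom u) (idem_val e)) -mulgA sinv_mulK.
have E2 : s * \val e * sinv s = r * \val e * sinv r.
  have E3 w : w * \val e * sinv w = w * \val e * sinv (w * \val e).
    by rewrite sinvM (sinv_idem (idem_val e)) !mulgA -(mulgA w _ (\val e)) idem_val.
  by rewrite !E3 F.
by rewrite /= {1}E2 !main F.
Qed.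

Lemma germ_mul_of s x (sx : contains x (dom_idem s)) t
    (tsx : contains (alpha s x) (dom_idem t)) :
  germ_mul (germ_of tsx) (germ_of sx) = germ_of (alpha_comp_dom sx tsx).
Proof.
rewrite /germ_mul germ_dom_of.
case: (repr_germ_of sx) (repr_germ_of tsx) => E [e [xe F]] [E' [e' [xe' F']]].
set r := (\val (repr (germ_of sx))).1 in F *.
set q := (\val (repr (germ_of tsx))).1 in F' *.
have xr : contains x (dom_idem r) by rewrite -[X in contains X]E repr_germ.
have axr : alpha r x = alpha s x by exact: (alpha_eq _ _ xe F).
have xq : contains (alpha r x) (dom_idem q).
  by rewrite axr -[X in contains X]E' repr_germ.
rewrite (germ_defE _ (alpha_comp_dom xr xq)); apply/germ_of_eq; split=> //.
move: xe' => /(contains_alpha _ sx) [f [xf le]].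
exists (idem_of (idemM (idem_val f) (idem_val e))).
split; first exact: contains_mul.
have sf : \val e' * (s * \val f) = s * \val f.
  have E3 : s * \val f = s * \val f * sinv s * s.
    have -> : s * \val f * sinv s * s = s * (\val f * (sinv s * s)).
      by rewrite !mulgA.
    by rewrite (idemC (idem_val f) (idem_dom s)) !mulgA mul_sinvK.
  rewrite E3 mulgA (idemC (idem_val e') (idem_conj s (idem_val f))).
  by rewrite le.
rewrite /= (idemC (idem_val f) (idem_val e)) -!mulgA (mulgA r) F -mulgA.
rewrite (idemC (idem_val e) (idem_val f)) (mulgA s) -sf.
by rewrite !mulgA F'.
Qed.

Lemma germ_of_congr s x (sx : contains x (dom_idem s)) t y
    (ty : contains y (dom_idem t)) : s = t -> x = y -> germ_of sx = germ_of ty.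
Proof.
move=> st xy; apply/germ_of_eq; split=> //.
by exists (dom_idem s); split=> //; rewrite st.
Qed.

Lemma germ_composable (g h : germ) : germ_dom g = germ_cod h ->
  exists s x (sx : contains x (dom_idem s)) t
    (tsx : contains (alpha s x) (dom_idem t)),
    h = germ_of sx /\ g = germ_of tsx.
Proof.
have [s [x [sx ->]]] := germP h; have [t [y [ty ->]]] := germP g.
rewrite germ_dom_of germ_cod_of => yE; move: ty; rewrite yE => ty.
by exists s, x, sx, t, ty.
Qed.

Lemma germ_dom_inv g : germ_dom (germ_inv g) = germ_cod g.
Proof.
by have [s [x [sx ->]]] := germP g; rewrite germ_inv_of germ_dom_of germ_cod_of.
Qed.

Lemma germ_cod_inv g : germ_cod (germ_inv g) = germ_dom g.
Proof.
have [s [x [sx ->]]] := germP g.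
by rewrite germ_inv_of germ_cod_of germ_dom_of alpha_sinv.
Qed.

Lemma germ_invK g : germ_inv (germ_inv g) = g.
Proof.
have [s [x [sx ->]]] := germP g; rewrite !germ_inv_of.
by apply: germ_of_congr; [exact: sinvK|exact: alpha_sinv].
Qed.

Lemma germ_dom_mul g h :
  germ_dom g = germ_cod h -> germ_dom (germ_mul g h) = germ_dom h.
Proof.
by move=> /germ_composable [s [x [sx [t [tx [-> ->]]]]]];
  rewrite germ_mul_of !germ_dom_of.
Qed.

Lemma germ_cod_mul g h :
  germ_dom g = germ_cod h -> germ_cod (germ_mul g h) = germ_cod g.
Proof.
by move=> /germ_composable [s [x [sx [t [tx [-> ->]]]]]];
  rewrite germ_mul_of !germ_cod_of alpha_comp.
Qed.

Lemma germ_mulA g h k : germ_dom g = germ_cod h -> germ_dom h = germ_cod k ->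
  germ_mul g (germ_mul h k) = germ_mul (germ_mul g h) k.
Proof.
move=> gh hk; move: (hk) => /germ_composable [s [x [sx [t [tx [kE hE]]]]]].
have [u [z [uz gE]]] := germP g.
have zE : z = alpha t (alpha s x).
  by move: gh; rewrite gE hE germ_dom_of germ_cod_of.
move: uz gE; rewrite zE => uz gE.
have uz' : contains (alpha (t * s) x) (dom_idem u) by rewrite alpha_comp.
have gE' : g = germ_of uz'.
  by rewrite gE; apply: germ_of_congr => //; rewrite alpha_comp.
rewrite {2}gE hE germ_mul_of kE !germ_mul_of gE' germ_mul_of.
by apply: germ_of_congr => //; exact: mulgA.
Qed.

Lemma germ_mulKl g h : germ_dom g = germ_cod h ->
  germ_mul (germ_inv g) (germ_mul g h) = h.
Proof.
move=> /germ_composable [s [x [sx [t [tx [-> ->]]]]]].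
have ix : contains (alpha (t * s) x) (dom_idem (sinv t)).
  by rewrite alpha_comp //; exact: dom_alpha_sinv.
have -> : germ_inv (germ_of tx) = germ_of ix.
  by rewrite germ_inv_of; apply: germ_of_congr => //; rewrite alpha_comp.
rewrite !germ_mul_of; apply/germ_of_eq; split=> //.
exists (dom_idem (t * s)); split; first exact: alpha_comp_dom.
rewrite /= sinvM.
have -> : sinv t * (t * s) * (sinv s * sinv t * (t * s))
        = sinv t * t * (s * sinv s) * (sinv t * t) * s by rewrite !mulgA.
rewrite (idemC (idem_dom t) (idem_cod s)) -(mulgA (s * sinv s)) idem_dom.
by rewrite !mulgA.
Qed.

Lemma germ_mulKr g h : germ_dom g = germ_cod h ->
  germ_mul (germ_mul g h) (germ_inv h) = g.
Proof.
move=> /germ_composable [s [x [sx [t [tx [-> ->]]]]]].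
have ix : contains (alpha (sinv s) (alpha s x)) (dom_idem (t * s)).
  by rewrite alpha_sinv //; exact: alpha_comp_dom.
have -> : germ_mul (germ_of tx) (germ_of sx) = germ_of ix.
  by rewrite germ_mul_of; apply: germ_of_congr => //; rewrite alpha_sinv.
rewrite germ_inv_of germ_mul_of; apply/germ_of_eq; split=> //.
exists (cod_idem s); split; first exact: cod_alpha.
by rewrite /= !mulgA -!(mulgA _ s (sinv s)) -(mulgA t) idem_cod.
Qed.

Lemma germ_dom_surj (x : filt) : exists g, germ_dom g = x.
Proof.
have [[e xe] _ _ _] := filtW x.
have xd : contains x (dom_idem (\val e)).
  apply: contains_le (xe : contains x e) _.
  by rewrite /idem_le /= (sinv_idem (idem_val e)) !idem_val.
by exists (germ_of xd); exact: germ_dom_of.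
Qed.

End Spectrum.

(* A groupoid whose set of arrows is a topological space; [gmul g h] is
   meaningful only if [gdom g = gcod h]. *)
Record groupoid := Groupoid {
  arrow :> topologicalType;
  gobj : Type;
  gdom : arrow -> gobj;
  gcod : arrow -> gobj;
  ginv : arrow -> arrow;
  gmul : arrow -> arrow -> arrow;
  gdom_surj : forall x, exists g, gdom g = x;
  gdom_inv : forall g, gdom (ginv g) = gcod g;
  gcod_inv : forall g, gcod (ginv g) = gdom g;
  ginvK : involutive ginv;
  gdom_mul : forall g h, gdom g = gcod h -> gdom (gmul g h) = gdom h;
  gcod_mul : forall g h, gdom g = gcod h -> gcod (gmul g h) = gcod g;
  gmulA : forall g h k, gdom g = gcod h -> gdom h = gcod k ->
    gmul g (gmul h k) = gmul (gmul g h) k;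
  gmulKl : forall g h, gdom g = gcod h -> gmul (ginv g) (gmul g h) = h;
  gmulKr : forall g h, gdom g = gcod h -> gmul (gmul g h) (ginv h) = g
}.

Definition universal_groupoid (S : invSemigroup0Type) : groupoid :=
  @Groupoid (germ S) (filt S) (@germ_dom S) (@germ_cod S) (@germ_inv S)
    (@germ_mul S) (@germ_dom_surj S) (@germ_dom_inv S) (@germ_cod_inv S)
    (@germ_invK S) (@germ_dom_mul S) (@germ_cod_mul S) (@germ_mulA S)
    (@germ_mulKl S) (@germ_mulKr S).

(** * The full C*-algebra of an étale groupoid *)

Section GroupoidCstar.
Local Open Scope ring_scope.
Variables (R : realType) (G : groupoid).

(* Functions vanishing outside an open Hausdorff set [V] whose restriction
   to [V] is continuous with compact support. *)
Definition cc_on (V : set G) : set (G -> CC R) :=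
  [set f | {in V, continuous f} /\
    exists K, [/\ compact K, K `<=` V & forall g, ~ K g -> f g = 0]].

(* [G] need not be Hausdorff, hence the linear span of the functions above;
   its elements need not be continuous on [G]. *)
Definition Cc : set (G -> CC R) :=
  [set f | exists (n : nat) (F : 'I_n -> G -> CC R),
    (forall i, exists V : set G,
       [/\ open V, hausdorff_space V & cc_on V (F i)]) /\
    f = (fun g => \sum_(i < n) F i g)].

(* Over the fibre of [g] the sum has finitely many non-zero terms when [f]
   is in [Cc]. *)
Definition conv (f h : G -> CC R) : G -> CC R :=
  fun g => \sum_(a \in [set a | gcod a = gcod g]) f a * h (gmul (ginv a) g).

Definition finvol (f : G -> CC R) : G -> CC R := fun g => (f (ginv g))^*.

Definition Cc_rep (A : cstarType R) (pi : (G -> CC R) -> A) : Prop :=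
  [/\ forall (k : CC R) f h, Cc f -> Cc h ->
        pi (fun g => k * f g + h g) = k *: pi f + pi h,
      forall f h, Cc f -> Cc h -> pi (conv f h) = (pi f ** pi h)%cst
    & forall f, Cc f -> pi (finvol f) = ((pi f)^†)%cst].

(* The completion of [Cc] for the greatest of the seminorms [`|pi f|], where
   [pi] ranges over the representations of [Cc] in C*-algebras: [iota] is one
   of them, so [`|iota f|] is the supremum of the [`|pi f|]. *)
Definition is_Cstar_groupoid (A : cstarType R) : Prop :=
  exists iota : (G -> CC R) -> A,
  [/\ Cc_rep iota, closure (iota @` Cc) = setT
    & forall (B : cstarType R) (pi : (G -> CC R) -> B), Cc_rep pi ->
        forall f, Cc f -> `|pi f| <= `|iota f|].

End GroupoidCstar.

(** * The inverse semigroup of an LCM monoid *)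

Section Triples.
Variable P : lcmMonoidType.
Implicit Types p q r a b c k l x y z u v w : P.

Definition triple_eq (s t : P * P * P) : Prop :=
  let: (p, q, r) := s in let: (a, b, c) := t in
  exists u v, [/\ invertible u, invertible v, p = a * u, q = v * b * u
                & r = v * c].

Lemma triple_eq_equiv : equiv_class_of (fun s t => `[< triple_eq s t >]).
Proof.
have sym s t : triple_eq s t -> triple_eq t s.
  case: s t => [[p q] r] [[a b] c] [u [v [[u' [uu' u'u]] [v' [vv' v'v]]]]].
  move=> -> -> ->; exists u', v'; split.
  - by exists u.
  - by exists v.
  - by rewrite -mulgA uu' mulg1.
  - by rewrite !mulgA v'v mul1g -mulgA uu' mulg1.
  - by rewrite mulgA v'v mul1g.
split.
- move=> [[p q] r]; apply/asboolP; exists 1, 1; split; rewrite ?mulg1 ?mul1g //.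
  1,2: by exists 1; rewrite mulg1.
- by move=> s t; apply/asboolP/asboolP; exact: sym.
- move=> [[a b] c] [[p q] r] [[p' q'] r'] /asboolP /= + /asboolP /=.
  move=> [u [v [[u' [uu' u'u]] [v' [vv' v'v]] -> -> ->]]].
  move=> [w [z [[w' [ww' w'w]] [z' [zz' z'z]] -> -> ->]]].
  apply/asboolP; exists (w * u), (v * z); split; rewrite ?mulgA //.
  + exists (u' * w'); split.
      by rewrite mulgA -(mulgA w) uu' mulg1.
    by rewrite mulgA -(mulgA u') w'w mulg1.
  + exists (z' * v'); split.
      by rewrite mulgA -(mulgA v) zz' mulg1.
    by rewrite mulgA -(mulgA z') v'v mulg1.
Qed.

Canonical triple_eq_rel := EquivRelPack triple_eq_equiv.

Definition triple_class : Type := {eq_quot triple_eq_rel}.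
HB.instance Definition _ := Choice.on triple_class.

Definition admissible p q r : Prop := rideal r q /\ lideal p q.

Definition admissible_class : set triple_class :=
  [set X | exists p q r,
     admissible p q r /\ X = \pi_(triple_class) (p, q, r)].

(* [None] is the zero of the semigroup. *)
Definition SP : Type := option (set_type admissible_class).
HB.instance Definition _ := Choice.on SP.

(* The element [[p, q, r]]; only used for admissible triples. *)
Definition bra p q r : SP := insub (\pi_(triple_class) (p, q, r)).

Definition SP_mul_rel (s t u : SP) : Prop :=
  exists p q r a b c a1 q1 r1 b1,
  [/\ admissible p q r /\ s = bra p q r, admissible a b c /\ t = bra a b c,
      rideal (r * a) `&` rideal q = rideal (r * a * a1) /\
        r * a * a1 = q * q1,
      lideal (r * a) `&` lideal b = lideal (r1 * r * a) /\
        r1 * r * a = b1 * b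
    & u = bra (p * q1) (r1 * r * a * a1) (b1 * c)].

(* The default value covers the products with [0] and those for which one of
   the intersections is empty; see [SP_mulE] and [SP_mul0]. *)
Definition SP_mul (s t : SP) : SP := xget None (SP_mul_rel s t).

Definition SP_inv_rel (s u : SP) : Prop :=
  exists p q r p1 r1,
  [/\ q = r * r1, q = p1 * p, s = bra p q r & u = bra r1 q p1].

Definition SP_inv (s : SP) : SP := xget None (SP_inv_rel s).

(* [SP] acts faithfully by partial injections of [P], one for each [z : P]. *)
Definition SP_act (s : SP) z x x' : Prop :=
  exists p q r r1 e y, [/\ admissible p q r, s = bra p q r, q = r * r1 &
    [/\ z = e * q * y, x = r1 * y & x' = p * y]].

Lemma admissibleE p q r : admissible p q r ->
  exists r1 p1, q = r * r1 /\ q = p1 * p.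
Proof. by case=> [[r1 _ <-] [p1 _ E]]; exists r1, p1. Qed.

Lemma admissibleI p r r1 p1 : r * r1 = p1 * p -> admissible p (r * r1) r.
Proof. by move=> E; split; [exists r1|rewrite E; exists p1]. Qed.

Lemma bra_eq p q r a b c : admissible p q r -> admissible a b c ->
  bra p q r = bra a b c <-> triple_eq (p, q, r) (a, b, c).
Proof.
move=> A B; rewrite /bra; have h p' q' r' : admissible p' q' r' ->
    \pi_(triple_class) (p', q', r') \in admissible_class.
  by move=> ?; apply/mem_set; exists p', q', r'.
rewrite !insubT ?h // => *; split.
  by move=> [] /eqmodP/asboolP.
by move=> ?; congr Some; apply: val_inj => /=; apply/eqmodP/asboolP.
Qed.

Lemma bra_neq0 p q r : admissible p q r -> bra p q r <> None.
Proof.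
move=> A; rewrite /bra insubT //; by apply/mem_set; exists p, q, r.
Qed.

Lemma SPP (s : SP) : s = None \/
  exists p q r, admissible p q r /\ s = bra p q r.
Proof.
case: s => [[X]|]; last by left.
move=> hX; right; have [p [q [r [A XE]]]] := set_mem hX.
exists p, q, r; split=> //; rewrite /bra insubT.
  by apply/mem_set; exists p, q, r.
by move=> ?; congr Some; exact: val_inj.
Qed.

Lemma SP_act0 z x x' : ~ SP_act None z x x'.
Proof. by case=> ? [? [? [? [? [? [/bra_neq0 + /esym E _ _]]]]]]; apply. Qed.

Lemma SP_actE p r r1 p1 z x x' : r * r1 = p1 * p ->
  SP_act (bra p (r * r1) r) z x x' <->
  exists e y, [/\ z = e * (r * r1) * y, x = r1 * y & x' = p * y].
Proof.
move=> E; have A := admissibleI E; split; last first.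
  move=> [e [y h]]; by exists p, (r * r1), r, r1, e, y.
move=> [a [b [c [c1 [e [y [B sE bE [-> -> ->]]]]]]]].
have [u [v [hu [v' [vv' v'v]] pE qE rE]]] := (bra_eq A B).1 sE.
have cE : c1 * u = r1.
  apply: (@lcm_mulgI _ r); rewrite qE rE bE.
  by rewrite -!mulgA.
case: hu => u' [uu' u'u].
exists (e * v'), (u' * y); rewrite qE pE -cE; split.
- rewrite -!mulgA (mulgA v') v'v mul1g (mulgA u) uu' mul1g //.
- by rewrite -mulgA (mulgA u) uu' mul1g.
- by rewrite -mulgA (mulgA u) uu' mul1g.
Qed.

Lemma mul_invertible x y : x * y = 1 -> invertible x /\ invertible y.
Proof.
move=> xy; have yx : y * x = 1.
  by apply: (@lcm_mulgI _ x); rewrite mulgA xy mul1g mulg1.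
by split; [exists y|exists x].
Qed.

Lemma SP_act_inj (s t : SP) :
  (forall z x x', SP_act s z x x' <-> SP_act t z x x') -> s = t.
Proof.
have ne p q r : admissible p q r -> exists z x x', SP_act (bra p q r) z x x'.
  move=> A; have [r1 [p1 [E _]]] := admissibleE A.
  by exists (1 * q * 1), (r1 * 1), (p * 1), p, q, r, r1, 1, 1.
case: (SPP s) (SPP t) => [->|[p [q [r [A ->]]]]] [->|[a [b [c [B ->]]]]] // h.
- by have [z [x [x' /h /SP_act0]]] := ne _ _ _ B.
- by have [z [x [x' /h /SP_act0]]] := ne _ _ _ A.
apply/(bra_eq A B).
have [r1 [p1 [E E']]] := admissibleE A; have [c1 [a1 [F F']]] := admissibleE B.
move: A B h; rewrite E F => A B h.
have EE : r * r1 = p1 * p by rewrite -E.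
have FF : c * c1 = a1 * a by rewrite -F.
have /h /(SP_actE _ _ _ FF) [e [y [E1 E2 E3]]] : SP_act (bra p (r * r1) r) (r * r1) r1 p.
  by apply/(SP_actE _ _ _ EE); exists 1, 1; rewrite !mulg1 mul1g.
have /h /(SP_actE _ _ _ EE) [e' [y' [F1 F2 F3]]] : SP_act (bra a (c * c1) c) (c * c1) c1 a.
  by apply/(SP_actE _ _ _ FF); exists 1, 1; rewrite !mulg1 mul1g.
have yy : y' * y = 1.
  by apply: (@lcm_mulgI _ r1); rewrite mulgA -F2 -E2 mulg1.
have ee : e * e' = 1.
  apply: (@lcm_mulIg _ (r * r1)); rewrite mul1g [RHS]E1 F1.
  by rewrite -!mulgA yy mulg1.
exists y, e; split=> //.
- by case: (mul_invertible yy).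
- by case: (mul_invertible ee).
- by apply: (@lcm_mulIg _ r1); rewrite E1 E2 -!mulgA.
Qed.

Lemma SP_act_fun (s : SP) z x x1 x2 : SP_act s z x x1 -> SP_act s z x x2 -> x1 = x2.
Proof.
case: (SPP s) => [-> /SP_act0//|[p [q [r [A ->]]]]].
have [r1 [p1 [E E']]] := admissibleE A; move: A; rewrite E => A.
have EE : r * r1 = p1 * p by rewrite -E.
move=> /(SP_actE _ _ _ EE) [e [y [_ -> ->]]] /(SP_actE _ _ _ EE) [e' [y' [_]]].
by move/lcm_mulgI => -> ->.
Qed.

Lemma SP_act_cofun (s : SP) z x1 x2 x : SP_act s z x1 x -> SP_act s z x2 x -> x1 = x2.
Proof.
case: (SPP s) => [-> /SP_act0//|[p [q [r [A ->]]]]].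
have [r1 [p1 [E E']]] := admissibleE A; move: A; rewrite E => A.
have EE : r * r1 = p1 * p by rewrite -E.
move=> /(SP_actE _ _ _ EE) [e [y [_ -> ->]]] /(SP_actE _ _ _ EE) [e' [y' [_ ->]]].
by move/lcm_mulgI => ->.
Qed.

Lemma SP_act_inv (s : SP) z x x' : SP_act (SP_inv s) z x x' <-> SP_act s z x' x.
Proof.
rewrite /SP_inv; case: xgetP => [u -> |N].
  move=> [p [q [r [p1 [r1 [E E' -> ->]]]]]].
  have EE : r * r1 = p1 * p by rewrite -E.
  rewrite {1}E' E (SP_actE _ _ _ EE) (SP_actE _ _ _ (esym EE)).
  by rewrite EE; split=> -[e [y [-> -> ->]]]; exists e, y.
case: (SPP s) => [->|[p [q [r [A sE]]]]].
  by split=> /SP_act0.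
have [r1 [p1 [E E']]] := admissibleE A.
by case: (N (bra r1 q p1)); exists p, q, r, p1, r1.
Qed.

Lemma SP_act_mul_rel (s t u : SP) z x x' : SP_mul_rel s t u ->
  SP_act u z x x' <-> exists w, SP_act t z x w /\ SP_act s z w x'.
Proof.
move=> [p [q [r [a [b [c [a1 [q1 [r1 [b1]]]]]]]]]].
move=> [[A ->] [B ->] [I E] [J F] ->].
have [rr [pp [G G']]] := admissibleE A; have [cc [aa [H H']]] := admissibleE B.
move: A B I E J F; rewrite G H => A B I E J F.
have GG : r * rr = pp * p by rewrite -G.
have HH : c * cc = aa * a by rewrite -H.
have K : r1 * r * a * a1 = b1 * c * (cc * a1) by rewrite F !mulgA.
have L : b1 * c * (cc * a1) = r1 * pp * (p * q1).
  by rewrite -K -!mulgA (mulgA r a) E GG !mulgA.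
rewrite K (SP_actE _ _ _ L); split.
  move=> [e [y [-> -> ->]]]; exists (a * (a1 * y)); split.
    apply/(SP_actE _ _ _ HH); exists (e * b1), (a1 * y); split=> //.
    by rewrite !mulgA.
    by rewrite !mulgA.
  apply/(SP_actE _ _ _ GG); exists (e * r1), (q1 * y).
  have E2 : a * a1 = rr * q1.
    by apply: (@lcm_mulgI _ r); rewrite !mulgA E.
  split; last by rewrite mulgA.
    by rewrite -K -!mulgA (mulgA r a) (mulgA (r * a)) E !mulgA.
  by rewrite !mulgA E2.
move=> [w [/(SP_actE _ _ _ HH) [d [y [-> -> ->]]]]].
move=> /(SP_actE _ _ _ GG) [e [y' [zE wE ->]]].
have : (rideal (r * a) `&` rideal (r * rr)) (r * a * y).
  by split; [exists y|exists y' => //; rewrite -!mulgA wE].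
rewrite I => -[m _ mE].
have yE : y = a1 * m by apply: (@lcm_mulgI _ (r * a)); rewrite -mE mulgA.
have y'E : y' = q1 * m.
  apply: (@lcm_mulgI _ (r * rr)).
  by rewrite mulgA -E mE -!mulgA wE.
have dE : d * (c * cc) = e * (r * a).
  apply: (@lcm_mulIg _ y); rewrite zE -!mulgA; congr (e * (r * _)).
  by rewrite wE.
have : (lideal (r * a) `&` lideal (c * cc)) (e * (r * a)).
  by split; [exists e|exists d].
rewrite J => -[g _ gE].
have gE' : g * b1 = d.
  apply: (@lcm_mulIg _ (c * cc)); rewrite -mulgA -F dE.
  by rewrite -gE.
exists g, m; rewrite yE y'E -gE'; split; by rewrite !mulgA.
Qed.

Lemma SP_act_mul (s t : SP) z x x' :
  SP_act (SP_mul s t) z x x' <-> exists w, SP_act t z x w /\ SP_act s z w x'.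
Proof.
rewrite /SP_mul; case: xgetP => [u -> |N]; first exact: SP_act_mul_rel.
split=> [/SP_act0//|[w []]].
case: (SPP t) => [-> /SP_act0//|[a [b [c [B tE]]]]].
case: (SPP s) => [-> _ /SP_act0//|[p [q [r [A sE]]]]].
have [rr [pp [G G']]] := admissibleE A; have [cc [aa [H H']]] := admissibleE B.
move: A B; rewrite G H => A B.
have GG : r * rr = pp * p by rewrite -G.
have HH : c * cc = aa * a by rewrite -H.
rewrite sE tE G H.
move=> /(SP_actE _ _ _ HH) [d [y [-> -> ->]]] /(SP_actE _ _ _ GG) [e [y' [zE wE _]]].
have dE : d * (c * cc) = e * (r * a).
  apply: (@lcm_mulIg _ y); rewrite zE -!mulgA; congr (e * (r * _)).
  by rewrite wE.
have h1 : (rideal (r * a) `&` rideal (r * rr)) (r * a * y).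
  by split; [exists y|exists y' => //; rewrite -!mulgA wE].
have h2 : (lideal (r * a) `&` lideal (c * cc)) (e * (r * a)).
  by split; [exists e|exists d].
case: (lcm_rideal (r * a) (r * rr)) => [I0|[k I]].
  by move: h1; rewrite I0.
case: (lcm_lideal (r * a) (c * cc)) => [J0|[l J]].
  by move: h2; rewrite J0.
have [[a1 _ a1E] [q1 _ q1E]] : (rideal (r * a) `&` rideal (r * rr)) k.
  by rewrite I; exists 1; rewrite ?mulg1.
have [[r1 _ r1E] [b1 _ b1E]] : (lideal (r * a) `&` lideal (c * cc)) l.
  by rewrite J; exists 1; rewrite ?mul1g.
exfalso; apply: (N (bra (p * q1) (r1 * r * a * a1) (b1 * c))).
exists p, q, r, a, b, c, a1, q1, r1, b1; rewrite G H.
split; [by rewrite sE G|by rewrite tE H| | |by []].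
- by rewrite a1E q1E.
- by rewrite -(mulgA r1) r1E b1E.
Qed.

Lemma SP_mulA : associative SP_mul.
Proof.
move=> s t u; apply: SP_act_inj => z x x'; rewrite !SP_act_mul; split.
  move=> [w [/SP_act_mul [v [uv tw]] sw]]; exists v; split=> //.
  by apply/SP_act_mul; exists w.
move=> [v [uv /SP_act_mul [w [tw sw]]]]; exists w; split=> //.
by apply/SP_act_mul; exists v.
Qed.

HB.instance Definition _ := isSemigroup.Build SP SP_mulA.

Lemma SP_mul_invK (s : SP) : s * SP_inv s * s = s.
Proof.
apply: SP_act_inj => z x x'; split.
  move=> /SP_act_mul [w [sw /SP_act_mul [v [/SP_act_inv sv svx]]]].
  by rewrite (SP_act_cofun sv sw) in svx.
move=> sx; apply/SP_act_mul; exists x'; split=> //.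
by apply/SP_act_mul; exists x; split=> //; apply/SP_act_inv.
Qed.

Lemma SP_inv_mulK (s : SP) : SP_inv s * s * SP_inv s = SP_inv s.
Proof.
apply: SP_act_inj => z x x'; split.
  move=> /SP_act_mul [w [/SP_act_inv sw /SP_act_mul [v [sv svx]]]].
  by rewrite (SP_act_fun sv sw) in svx.
move=> /SP_act_inv sx; apply/SP_act_mul; exists x'; split; first exact/SP_act_inv.
by apply/SP_act_mul; exists x; split=> //; apply/SP_act_inv.
Qed.

Lemma SP_inv_uniq (s t : SP) : s * t * s = s -> t * s * t = t -> t = SP_inv s.
Proof.
have main s' t' z x x' :
    t' * s' * t' = t' -> SP_act t' z x x' -> SP_act s' z x' x.
  move=> E h; move: (h); rewrite -{1}E.
  move=> /SP_act_mul [a [ta /SP_act_mul [b [sb tb]]]].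
  by rewrite (SP_act_fun ta h) (SP_act_cofun tb h) in sb.
move=> E F; apply: SP_act_inj => z x x'; rewrite SP_act_inv; split; exact: main.
Qed.

Lemma SP_mul0l (s : SP) : (None : SP) * s = None.
Proof.
by apply: SP_act_inj => z x x'; split=> [/SP_act_mul [w [_ /SP_act0]]|/SP_act0].
Qed.

Lemma SP_mul0r (s : SP) : s * (None : SP) = None.
Proof.
by apply: SP_act_inj => z x x'; split=> [/SP_act_mul [w [/SP_act0]]|/SP_act0].
Qed.

HB.instance Definition _ := isInverseSemigroup0.Build SP
  SP_mul_invK SP_inv_mulK SP_inv_uniq SP_mul0l SP_mul0r.

(* The operations do not depend on the representatives. *)

Lemma SP_mulE p q r a b c k l a1 q1 r1 b1 :
  admissible p q r -> admissible a b c ->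
  rideal (r * a) `&` rideal q = rideal k -> r * a * a1 = k -> q * q1 = k ->
  lideal (r * a) `&` lideal b = lideal l -> r1 * r * a = l -> b1 * b = l ->
  bra p q r * bra a b c = bra (p * q1) (r1 * r * a * a1) (b1 * c).
Proof.
move=> A B I aE qE J rE bE; apply: SP_act_inj => z x x'; rewrite SP_act_mul.
apply: iff_sym; apply: SP_act_mul_rel.
exists p, q, r, a, b, c, a1, q1, r1, b1.
by rewrite I J aE rE qE bE.
Qed.

Lemma SP_mul0 p q r a b c : admissible p q r -> admissible a b c ->
  rideal (r * a) `&` rideal q = set0 \/ lideal (r * a) `&` lideal b = set0 ->
  bra p q r * bra a b c = szero.
Proof.
move=> A B h; apply: SP_act_inj => z x x'; split=> [|/SP_act0//].
have [rr [pp [G G']]] := admissibleE A; have [cc [aa [H H']]] := admissibleE B.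
have GG : r * rr = pp * p by rewrite -G.
have HH : c * cc = aa * a by rewrite -H.
rewrite SP_act_mul; move: h; rewrite G H => h [w []].
move=> /(SP_actE _ _ _ HH) [d [y [-> -> ->]]] /(SP_actE _ _ _ GG) [e [y' [zE wE _]]].
exfalso; case: h => h.
  have : (rideal (r * a) `&` rideal (r * rr)) (r * a * y).
    by split; [exists y|exists y' => //; rewrite -!mulgA wE].
  by rewrite h.
have : (lideal (r * a) `&` lideal (c * cc)) (e * (r * a)).
  split; first by exists e.
  exists d => //; apply: (@lcm_mulIg _ y); rewrite zE -!mulgA.
  by congr (e * (r * _)); rewrite wE.
by rewrite h.
Qed.

Lemma SP_invE p q r p1 r1 : q = r * r1 -> q = p1 * p ->
  sinv (bra p q r) = bra r1 q p1.
Proof.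
move=> E E'; apply: SP_act_inj => z x x'; rewrite SP_act_inv.
have EE : r * r1 = p1 * p by rewrite -E.
rewrite {2}E' E (SP_actE _ _ _ EE) (SP_actE _ _ _ (esym EE)).
by rewrite EE; split=> -[e [y [-> -> ->]]]; exists e, y.
Qed.

End Triples.

(* Main.v *)
(* The first isomorphism: [SP P] acts faithfully by partial injections, in which
   [S p] corresponds to [[p, p, p]] and [f Y] to the idempotent that restricts the
   identity to [Y]. Conversely [[p, r r1, r]] is sent to [S p L S r1^*], where [L]
   is the initial projection of [S (r r1)]; the LCM property computes products of
   such elements.

   The second isomorphism: evaluation at principal filters bounds the norm of a
   linear combination [\sum c_j pi(s_j)], the [s_j] lying below [n] fixed elements,
   by [n] times the supremum of the function [\sum c_j 1_(Theta s_j)] on the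
   groupoid. Hence [1_(Theta s) |-> pi s] extends to [Cc] by uniform approximation,
   and by maximality of the norm of the groupoid algebra the canonical map from
   [C*_u] is isometric.

   Both parts rest on an elementary bound for *-homomorphisms: if
   [2 k - k ^ 2 = h ^ 2] with [h], [k] self-adjoint and commuting, then
   [1 - k + i h] is formally unitary, whence [`|h| <= 1]. *)
Require Import Defs.
From HB Require Import structures.
From mathcomp Require Import all_boot all_order all_algebra.
From mathcomp Require Import complex finmap.
From mathcomp Require Import all_classical all_reals all_analysis.
From mathcomp Require Import ring.

Set Implicit Arguments.
Unset Strict Implicit.
Unset Printing Implicit Defensive.

Import Order.TTheory GRing.Theory Num.Theory numFieldNormedType.Exports.
Local Open Scope classical_set_scope.
Local Open Scope ring_scope.
Local Open Scope cstar_scope.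

(** * Boundedness of *-homomorphisms *)

(** The constants are deliberately crude: a *-homomorphism is only shown to have norm at most 2, and
    the bound for combinations carries the factor [n]. They serve continuity alone. A sharp
    inequality enters at one place, the maximality of [iota], which dominates every representation
    of [Cc], whether or not it is known to be bounded. What matters about [n] is that it depends on
    the bisections that carry a function and not on the accuracy, so all approximants of one
    function are taken below the same finite set. The groupoid need not be Hausdorff and functions
    in [Cc] may be discontinuous. Since the basic sets of filters are open and closed, a compact
    support can be cut into pieces, each a continuous function on the filter space transported along
    one bisection, without a partition of unity. Principal filters suffice because finitely many
    idempotents split the unit of the semigroup, here [[1, 1, 1]], into finitely many projections,
    each of which vanishes or has a nonzero idempotent [e] at whose principal filter to evaluate. *)

Section CstarBasics.
Variable R : realType.
Implicit Types A B : cstarType R.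

Lemma cmul0l A (a : A) : 0 ** a = 0.
Proof. by apply: (@addrI _ (0 ** a)); rewrite -cmulDl !addr0. Qed.

Lemma cmul0r A (a : A) : a ** 0 = 0.
Proof. by apply: (@addrI _ (a ** 0)); rewrite -cmulDr !addr0. Qed.

Lemma cmulNl A (a b : A) : (- a) ** b = - (a ** b).
Proof. by apply/eqP; rewrite -addr_eq0 -cmulDl addNr cmul0l. Qed.

Lemma cmulNr A (a b : A) : a ** (- b) = - (a ** b).
Proof. by apply/eqP; rewrite -addr_eq0 -cmulDr addNr cmul0r. Qed.

Lemma cmulBl A (a b c : A) : (a - b) ** c = a ** c - b ** c.
Proof. by rewrite cmulDl cmulNl. Qed.

Lemma cmulBr A (a b c : A) : c ** (a - b) = c ** a - c ** b.
Proof. by rewrite cmulDr cmulNr. Qed.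

Lemma cmul_suml A I (r : seq I) (Q : pred I) (F : I -> A) (a : A) :
  (\sum_(i <- r | Q i) F i) ** a = \sum_(i <- r | Q i) F i ** a.
Proof.
by apply: (big_morph (fun x => x ** a)) => [x y|]; rewrite ?cmul0l ?cmulDl.
Qed.

Lemma cmul_sumr A I (r : seq I) (Q : pred I) (F : I -> A) (a : A) :
  a ** (\sum_(i <- r | Q i) F i) = \sum_(i <- r | Q i) a ** F i.
Proof.
by apply: (big_morph (fun x => a ** x)) => [x y|]; rewrite ?cmul0r ?cmulDr.
Qed.

Lemma cstar0 A : (0 : A)^† = 0.
Proof. by apply: (@addrI _ (0 : A)^†); rewrite -cstarD !addr0. Qed.

Lemma cstarN A (a : A) : (- a)^† = - a^†.
Proof. by apply/eqP; rewrite -addr_eq0 -cstarD addNr cstar0. Qed.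

Lemma cstarB A (a b : A) : (a - b)^† = a^† - b^†.
Proof. by rewrite cstarD cstarN. Qed.

Lemma cstar_sum A I (r : seq I) (Q : pred I) (F : I -> A) :
  (\sum_(i <- r | Q i) F i)^† = \sum_(i <- r | Q i) (F i)^†.
Proof. by apply: (big_morph cstar) => [x y|]; rewrite ?cstar0 ?cstarD. Qed.

Lemma norm_cstar A (a : A) : `|a^†| = `|a|.
Proof.
have main (b : A) : `|b| <= `|b^†|.
  have [->|b0] := eqVneq b 0; first by rewrite normr0.
  have b1 : 0 < `|b| by rewrite normr_gt0.
  by rewrite -(ler_pM2r b1) -expr2 -cstar_norm cmul_norm.
by apply/eqP; rewrite eq_le main andbT -{2}[a]cstarK main.
Qed.

(* [u := 1 - k + i h] is formally unitary, so left multiplication by [u] and by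
   [u^*] is isometric; subtracting, [`|2 h b| <= 2 `|b|]. *)
Lemma norm_le1_unitary A (h k : A) : h^† = h -> k^† = k -> h ** k = k ** h ->
  k + k - k ** k = h ** h -> `|h| <= 1.
Proof.
move=> hh kk hk E.
have iso (s : CC R) (b : A) : s^* = - s -> s * s = - 1 ->
    `|b - k ** b + s *: (h ** b)| = `|b|.
  move=> sc ss; apply/eqP; rewrite -(@eqrXn2 _ 2) ?normr_ge0 //.
  rewrite -!cstar_norm cstarD cstarB cstarZ !cstarM kk hh sc.
  apply/eqP.
  have e1 : b^† ** k ** (h ** b) = b^† ** h ** (k ** b).
    by rewrite !cmulA -(cmulA _ k h) -hk cmulA.
  have e2 : b^† ** h ** (h ** b) = b^† ** k ** b + b^† ** k ** b
            - b^† ** k ** (k ** b).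
    by rewrite !cmulA -(cmulA _ h h) -E !(cmulBr, cmulDr, cmulBl, cmulDl) !cmulA.
  rewrite !(cmulDr, cmulDl, cmulBr, cmulBl, cmulZl, cmulZr, cmulNl, cmulNr).
  rewrite !scaleNr !(scalerDr, scalerN, scalerA) e1 ss scaleN1r e2 (cmulA b^† k b).
  rewrite !opprD !opprK !addrA.
  (* Each term is put next to its opposite; only the first, [b^† ** b], survives. *)
  rewrite (ACl (1*(2*9)*(4*10)*(3*7)*(5*11)*(6*8))).
  by rewrite /= !cmulA !(addNr, subrr, addr0).
have hb (b : A) : `|h ** b| <= `|b|.
  have i2 : 'i * 'i = - 1 :> CC R by rewrite -expr2 sqrCi.
  have := iso (- 'i) b; rewrite rmorphN /= conjCi mulrNN => /(_ erefl i2).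
  have := iso 'i b (conjCi _) i2.
  rewrite scaleNr; set x := b - k ** b; set y := 'i *: _ => e1 e2.
  have : `|y + y| <= `|b| + `|b|.
    have -> : y + y = (x + y) - (x - y).
      by rewrite opprB [RHS]addrC subrKA.
    by rewrite -{1}e1 -e2 ler_normB.
  have -> : `|y + y| = `|h ** b| + `|h ** b|.
    by rewrite -mulr2n normrMn normrZ normCi mul1r mulr2n.
  by rewrite -!mulr2n ler_pMn2r.
have [->|h0] := eqVneq h 0; first by rewrite normr0.
have h1 : 0 < `|h| by rewrite normr_gt0.
rewrite -(ler_pM2r h1) -expr2 mul1r -cstar_norm hh; exact: hb.
Qed.
End CstarBasics.

(** * Estimates and completeness *)

Section NormedTools.
Variable R : realType.

Lemma exp2V_small (e : CC R) : 0 < e -> exists n : nat, (2%:R^-1) ^+ n <= e.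
Proof.
case: e => a b; rewrite ltcE /= => /andP[/eqP -> a0].
exists (Num.bound a^-1).
have h : (2%:R^-1) ^+ Num.bound a^-1 <= a.
  rewrite exprVn -[leRHS]invrK lef_pV2 ?posrE ?invr_gt0 ?exprn_gt0 //.
  apply: le_trans (ltW (archi_boundP _)) _; first by rewrite invr_ge0 ltW.
  by rewrite -natrX ler_nat ltnW // ltn_expl.
rewrite [leLHS](_ : _ = ((2%:R^-1) ^+ Num.bound a^-1)%:C%C).
  by rewrite lecE /= eqxx.
by rewrite rmorphXn /= fmorphV /= rmorph_nat.
Qed.

(** The order of [CC R] is partial; the signs make [x] and [y] comparable. *)
Lemma ltP_eps (x y : CC R) : 0 <= x -> 0 <= y ->
  (forall e, 0 < e -> x <= y + e) -> x <= y.
Proof.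
move=> x0 y0 h; rewrite real_leNgt ?ger0_real //; apply/negP => yx.
have e0 : 0 < (x - y) / 2%:R by rewrite divr_gt0 // subr_gt0.
move: (h _ e0); rewrite -lerBlDl {1}(splitr (x - y)) gerDl.
by move=> /(lt_le_trans e0); rewrite ltxx.
Qed.

Lemma closure_normP (X : normedModType (CC R)) (E : set X) (x : X) :
  closure E x <-> forall e, 0 < e -> exists y, E y /\ `|x - y| < e.
Proof.
split=> [cE e e0|h N].
  by have [y [Ey xy]] := cE _ (nbhsx_ballx x e e0); exists y; split=> //;
    rewrite -ball_normE in xy.
move=> /nbhs_ballP [e /= e0 eN]; have [y [Ey xy]] := h _ e0.
by exists y; split=> //; apply: eN; rewrite -ball_normE.
Qed.

(** Here [Q e x] reads: [x] solves a problem up to [e]. Approximate solutions that are close to each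
    other converge, with an explicit rate. This yields the square root below, the extension of
    representations and surjectivity. *)
Lemma complete_approx (X : completeNormedModType (CC R)) (Q : CC R -> X -> Prop)
    (M : CC R) : 0 < M ->
  (forall e, 0 < e -> exists x, Q e x) ->
  (forall d e x y, 0 < d -> 0 < e -> Q d x -> Q e y -> `|x - y| <= M * (d + e)) ->
  exists b, forall e x, 0 < e -> Q e x -> `|x - b| <= M * (e *+ 3).
Proof.
move=> M0 ex uniq.
(* All tolerances up to [e] are collected, as [Q] need not be monotone in [e]. *)
pose B (e : CC R) : set X := [set x | exists d, [/\ 0 < d, d <= e & Q d x]].
pose F := filter_from [set e : CC R | 0 < e] B.
have FF : ProperFilter F.
  apply: filter_from_proper; last first.
    by move=> e /= e0; have [x Qx] := ex e e0; exists x, e.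
  apply: filter_from_filter; first by exists 1 => /=; exact: ltr01.
  move=> d e /= d0 e0.
  have [de|ed] := orP (real_leVge (gtr0_real d0) (gtr0_real e0)).
    exists d => //; move=> x [c [c0 cd Qc]]; split; exists c; split=> //.
    exact: le_trans de.
  exists e => //; move=> x [c [c0 cd Qc]]; split; exists c; split=> //.
  exact: le_trans ed.
have cF : cauchy F.
  apply: cauchy_exP => e e0.
  have e1 : 0 < e / (M *+ 4) by rewrite divr_gt0 // pmulrn_lgt0.
  have [x Qx] := ex _ e1; exists x, (e / (M *+ 4)) => //.
  move=> y [d [d0 dle Qd]]; rewrite -ball_normE /=.
  apply: le_lt_trans (uniq _ _ _ _ e1 d0 Qx Qd) _.
  have : M * (e / (M *+ 4) + d) <= M * (e / (M *+ 4) *+ 2).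
    by rewrite ler_pM2l // mulr2n lerD2l.
  move/le_lt_trans; apply.
  have -> : M * (e / (M *+ 4) *+ 2) = e / 2%:R.
    by rewrite -mulr_natr -(mulr_natr M); field; rewrite gt_eqF.
  by rewrite ltr_pdivrMr // ltr_pMr // ltr1n.
have [b Fb] : exists b : X, F --> b.
  by exists (lim F); exact: (@cauchy_cvg X F _ cF).
exists b => e x e0 Qx.
have M1 : 0 < M * e by rewrite mulr_gt0.
have [d /= d0 dB] : F (ball b (M * e)) by apply: Fb; exact: nbhsx_ballx.
(* A [c]-approximation [y] is within [M * (e + c)], hence [2 M e], of [x] and within [M e] of the
   limit: this is the factor 3. *)
have [c [c0 cd ce]] : exists c, [/\ 0 < c, c <= d & c <= e].
  have [de|ed] := orP (real_leVge (gtr0_real d0) (gtr0_real e0)).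
    by exists d.
  by exists e.
have [y Qy] := ex _ c0.
have : ball b (M * e) y by apply: dB; exists c.
rewrite -ball_normE /= => yb; rewrite -(subrK y x) -addrA.
apply: le_trans (ler_normD _ _) _; rewrite mulrSr mulrDr lerD //.
  by apply: le_trans (uniq _ _ _ _ e0 c0 Qx Qy) _; rewrite ler_pM2l // mulr2n lerD2l.
by rewrite distrC ltW.
Qed.

End NormedTools.

(** * Continuity of *-homomorphisms and agreement on generators *)

Section StarHoms.
Variable R : realType.
Implicit Types A B : cstarType R.

Lemma eps_eq0 (X : normedModType (CC R)) (M : CC R) (x : X) : 0 < M ->
  (forall e, 0 < e -> `|x| <= M * e) -> x = 0.
Proof.
move=> M0 h; apply/eqP; rewrite -normr_le0; apply: ltP_eps => // e e0.
by rewrite add0r (le_trans (h _ (divr_gt0 e0 M0))) // mulrC divfK ?gt_eqF.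
Qed.

(* [k = 1 - sqrt (1 - h ^ 2)] is the fixed point of the contraction
   [k |-> (h ^ 2 + k ^ 2) / 2] of the ball of radius 1/2. *)
Lemma half_sqrt A (h : A) : h^† = h -> `|h| <= 2%:R^-1 ->
  exists k : A, [/\ k^† = k, h ** k = k ** h & k + k - k ** k = h ** h].
Proof.
move=> hh h1.
pose T (k : A) : A := (2%:R^-1 : CC R) *: (h ** h + k ** k).
pose D := [set k : A | [/\ k^† = k, h ** k = k ** h & `|k| <= 2%:R^-1]].
have i2 : 0 < 2%:R^-1 :> CC R by rewrite invr_gt0 ltr0n.
have TD k : D k -> D (T k).
  move=> [kk hk k1]; split; rewrite /T.
  - by rewrite cstarZ fmorphV rmorph_nat cstarD !cstarM hh kk.
  - by rewrite cmulZr cmulZl cmulDl cmulDr !cmulA hk -(cmulA k h) hk cmulA.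
  - rewrite normrZ (gtr0_norm i2) ler_piMr ?(ltW i2) //.
    apply: le_trans (ler_normD _ _) _.
    have sq (x : A) : `|x| <= 2%:R^-1 -> `|x ** x| <= 2%:R^-1.
      move=> x1; apply: le_trans (cmul_norm _ _) _.
      rewrite -[leRHS]mulr1 ler_pM // (le_trans x1) //.
      by rewrite invf_le1 ?ler1n // ltr0n.
    by rewrite [leRHS](splitr 1) mul1r lerD ?sq.
have TL k l : D k -> D l -> `|T k - T l| <= 2%:R^-1 * `|k - l|.
  move=> [kk hk k1] [ll hl l1].
  rewrite /T -scalerBr normrZ (gtr0_norm i2) ler_pM2l //.
  have -> : h ** h + k ** k - (h ** h + l ** l) = k ** (k - l) + (k - l) ** l.
    by rewrite opprD addrACA subrr add0r cmulBr cmulBl addrA subrK.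
  apply: le_trans (ler_normD _ _) _; rewrite [leRHS]splitr lerD //.
    by apply: le_trans (cmul_norm _ _) _; rewrite [leRHS]mulrC ler_wpM2r.
  by apply: le_trans (cmul_norm _ _) _; rewrite ler_wpM2l.
have D0 : D 0 by split; rewrite ?cstar0 ?cmul0l ?cmul0r ?normr0 ?(ltW i2).
pose Q (e : CC R) k := D k /\ `|k - T k| <= e.
have Qex e : 0 < e -> exists k, Q e k.
  move=> e0; have [n ne] := exp2V_small e0.
  (* The displacement of 0 is at most 1, and each application of [T] halves it. *)
  have it m : D (iter m T 0) /\
      `|iter m T 0 - T (iter m T 0)| <= (2%:R^-1) ^+ m.
    elim: m => [|m [Dm mE]]; split=> //=.
      rewrite sub0r normrN expr0; case: (TD _ D0) => _ _ /le_trans; apply.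
      by rewrite invf_le1 ?ler1n // ltr0n.
      exact: TD.
    apply: le_trans (TL _ _ Dm (TD _ Dm)) _.
    by rewrite exprS ler_pM2l.
  by exists (iter n T 0); split; [case: (it n)|case: (it n) => _ /le_trans; apply].
(* The constant 2 is [1 / (1 - 1/2)], for the contraction factor 1/2 of [T]. *)
have [//|d e x y d0 e0 [Dx xe] [Dy ye]|b bP] :=
    @complete_approx R A Q 2%:R (ltr0n _ 2).
- have : `|x - y| <= d + e + 2%:R^-1 * `|x - y|.
    rewrite [X in `|X| <= _](_ : _ = (x - T x) - (y - T y) + (T x - T y)); last first.
      by rewrite !opprB !addrA (ACl (1*4*(2*5)*(3*6))) /= addNr subrr !addr0.
    rewrite (le_trans (ler_normD _ _)) // lerD ?TL //.
    by rewrite (le_trans (ler_normB _ _)) // lerD.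
  rewrite -lerBlDr => le.
  have <- : 2%:R * (`|x - y| - 2%:R^-1 * `|x - y|) = `|x - y| by field.
  by rewrite ler_pM2l // ltr0n.
(* The tolerance [e / 6] cancels the factors 2 and 3 of [complete_approx]. Closedness of [D] and the
   fixed point equation are then checked by approximation. *)
have near_b e : 0 < e -> exists k, [/\ D k, `|k - T k| <= e & `|b - k| <= e].
  move=> e0; have e1 : 0 < e / 6%:R by rewrite divr_gt0.
  have [n ne] := Qex _ e1; exists n; case: (ne) => Dn Tn; split=> //.
    by apply: le_trans Tn _; rewrite ler_pdivrMr // ler_peMr ?ltW // ltr1n.
  rewrite distrC; apply: le_trans (bP _ _ e1 ne) _.
  by have -> : 2%:R * (e / 6%:R *+ 3) = e by field.
have [bs hb b1] : D b.
  split.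
  - apply/eqP; rewrite -subr_eq0; apply/eqP/(@eps_eq0 _ 2%:R) => // e /near_b [k [[kk _ _] _ bk]].
    have -> : b^† - b = (b - k)^† - (b - k) by rewrite cstarB kk opprB addrA subrK.
    by rewrite (le_trans (ler_normB _ _)) // norm_cstar mulr_natl mulr2n lerD.
  - apply/eqP; rewrite -subr_eq0; apply/eqP/(@eps_eq0 _ 1) => // e /near_b [k [[_ hk _] _ bk]].
    have -> : h ** b - b ** h = h ** (b - k) - (b - k) ** h.
      by rewrite cmulBr cmulBl hk opprB addrA subrK.
    rewrite (le_trans (ler_normB _ _)) // (splitr e) mul1r lerD //.
      by rewrite (le_trans (cmul_norm _ _)) // mulrC ler_pM.
    by rewrite (le_trans (cmul_norm _ _)) // ler_pM.
  - apply: ltP_eps => // e /near_b [k [[_ _ k1] _ bk]].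
    rewrite -(subrK k b) addrC (le_trans (ler_normD _ _)) // lerD //.
have bT : b = T b.
  apply/eqP; rewrite -subr_eq0; apply/eqP/(@eps_eq0 _ 3%:R) => // e /near_b [k [Dk kT bk]].
  have -> : b - T b = (b - k) + ((k - T k) + (T k - T b)) by rewrite subrKA subrKA.
  rewrite (le_trans (ler_normD _ _)) // mulr_natl mulrS mulr2n lerD // (le_trans (ler_normD _ _)) // lerD //.
  rewrite (le_trans (TL _ _ Dk _)) // distrC (le_trans _ bk) // ler_piMl //.
  by rewrite invf_le1 ?ler1n // ltr0n.
exists b; split=> //; apply/eqP; rewrite subr_eq; apply/eqP.
rewrite {1 2}bT /T -scalerDl.
have -> : 2%:R^-1 + 2%:R^-1 = 1 :> CC R by field.
by rewrite scale1r.
Qed.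

Lemma star_hom0 A B (phi : A -> B) : star_hom phi -> phi 0 = 0.
Proof. by case=> L _ _; have := L (-1) 0 0; rewrite scaleN1r oppr0 addr0 scaleN1r addNr. Qed.

Lemma star_homD A B (phi : A -> B) : star_hom phi -> {morph phi : x y / x + y}.
Proof. by case=> L _ _ x y; have := L 1 x y; rewrite !scale1r. Qed.

Lemma star_homZ A B (phi : A -> B) : star_hom phi ->
  forall k, {morph phi : x / k *: x}.
Proof. by move=> h k x; case: (h) => L _ _; have := L k x 0; rewrite (star_hom0 h) !addr0. Qed.

Lemma star_homN A B (phi : A -> B) : star_hom phi -> {morph phi : x / - x}.
Proof. by move=> h x; rewrite -scaleN1r (star_homZ h) scaleN1r. Qed.

Lemma star_homB A B (phi : A -> B) : star_hom phi -> {morph phi : x y / x - y}.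
Proof. by move=> h x y; rewrite (star_homD h) (star_homN h). Qed.

(** Scale [a^† ** a] to an [h] of norm 1/2, so that [half_sqrt] applies. The relation between [h]
    and [k] survives in the image, whence [|phi h| <= 1], that is [|phi a| ^ 2 <= 2 |a| ^ 2]; the 2
    in the statement rounds up the square root of 2. *)
Lemma star_hom_bounded A B (phi : A -> B) (a : A) : star_hom phi ->
  `|phi a| <= 2%:R * `|a|.
Proof.
move=> hphi; have [L M St] := hphi.
have [->|a0] := eqVneq a 0; first by rewrite (star_hom0 hphi) !normr0 mulr0.
have an : 0 < `|a| by rewrite normr_gt0.
pose c : CC R := (`|a| ^+ 2 *+ 2)^-1.
have c0 : 0 < c by rewrite invr_gt0 pmulrn_lgt0 // exprn_gt0.
have cR : c^* = c by rewrite conj_Creal // gtr0_real.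
pose h := c *: (a^† ** a).
have hh : h^† = h by rewrite cstarZ cstarM cstarK cR.
have h1 : `|h| <= 2%:R^-1.
  rewrite normrZ cstar_norm gtr0_norm // /c.
  rewrite -mulr_natr invfM mulrC mulrA divff ?mul1r // expf_eq0 /=.
  by rewrite gt_eqF.
have [k [kk hk E]] := half_sqrt hh h1.
have : `|phi h| <= 1.
  apply: (@norm_le1_unitary _ _ _ (phi k)); rewrite -?St -?M ?hh ?kk ?hk //.
  by rewrite -(star_homD hphi) -(star_homB hphi) E.
rewrite (star_homZ hphi) M St normrZ cstar_norm gtr0_norm //.
rewrite /c mulrC ler_pdivrMr ?pmulrn_lgt0 ?exprn_gt0 // mul1r => le.
rewrite -(@ler_pXn2r _ 2) ?nnegrE ?mulr_ge0 // (le_trans le) //.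
rewrite exprMn -mulr_natl ler_pM2r ?exprn_gt0 //.
by rewrite -natrX ler_nat.
Qed.

Lemma star_hom_closed A B (phi psi : A -> B) : star_hom phi -> star_hom psi ->
  closed [set a | phi a = psi a].
Proof.
move=> hp hq; rewrite closure_id eqEsubset; split; first exact: subset_closure.
move=> a /closure_normP ca /=.
apply/eqP; rewrite -subr_eq0 -normr_le0; apply: ltP_eps => // e e0.
have e1 : 0 < e / 4%:R by rewrite divr_gt0.
have [b [/= E ab]] := ca _ e1.
have -> : phi a - psi a = phi (a - b) - psi (a - b).
  by rewrite (star_homB hp) (star_homB hq) E opprB addrA subrK.
rewrite add0r; apply: le_trans (ler_normB _ _) _.
have -> : e = 2%:R * (e / 4%:R) + 2%:R * (e / 4%:R) by field.
by rewrite lerD // (le_trans (star_hom_bounded _ _)) // ler_pM2l // ltW.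
Qed.

Lemma star_hom_eq A B (X : set A) (phi psi : A -> B) : generates X ->
  star_hom phi -> star_hom psi -> (forall a, X a -> phi a = psi a) ->
  forall a, phi a = psi a.
Proof.
move=> gX hp hq h a; have : smallest (@closed_star_subalgebra R A) X a by rewrite gX.
move=> /(_ [set x | phi x = psi x]); apply; split=> //; have [_ Mp Sp] := hp; have [_ Mq Sq] := hq; split=> /=.
- exact: star_hom_closed.
- by rewrite (star_hom0 hp) (star_hom0 hq).
- by move=> k x y E F; rewrite !(star_homD hp, star_homD hq, star_homZ hp, star_homZ hq) E F.
- by move=> x y E F; rewrite Mp Mq E F.
- by move=> x E; rewrite Sp Sq E.
Qed.

Lemma star_hom_id A : star_hom (@idfun A).
Proof. by split. Qed.

Lemma star_hom_comp A B (C : cstarType R) (phi : A -> B) (psi : B -> C) :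
  star_hom phi -> star_hom psi -> star_hom (psi \o phi).
Proof.
move=> hp hq; have [_ Mp Sp] := hp; have [_ Mq Sq] := hq; split=> /=.
- by move=> k x y; rewrite /= (star_homD hp) (star_homZ hp) (star_homD hq) (star_homZ hq).
- by move=> a b; rewrite Mp Mq.
- by move=> a; rewrite Sp Sq.
Qed.

(** The universal algebra of a semigroup is not unital by definition. This recognises the image of
    the unit of the semigroup as a unit, which [ts_f_Delta] demands. *)
Lemma is_one_generated A (X : set A) (e : A) : generates X ->
  e^† = e -> (forall a, X a -> e ** a = a /\ a ** e = a) -> is_one e.
Proof.
move=> gX ee h a; have : smallest (@closed_star_subalgebra R A) X a by rewrite gX.
move=> /(_ [set x | e ** x = x /\ x ** e = x]); apply; split=> //; split=> /=.
- rewrite closure_id eqEsubset; split; first exact: subset_closure.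
  move=> x /closure_normP cx /=.
  (* Left and right multiplication by [e] are treated at once. *)
  suff main (f : A -> A) : {morph f : u v / u - v} ->
      (forall u, `|f u| <= `|e| * `|u|) ->
      (forall d, 0 < d -> exists y, f y = y /\ `|x - y| < d) -> f x = x.
    split; first apply: (main (fun y => e ** y)); last apply: (main (fun y => y ** e)).
    + by move=> u v; rewrite cmulBr.
    + by move=> u; exact: cmul_norm.
    + by move=> d /cx [y [[? ?] ?]]; exists y.
    + by move=> u v; rewrite cmulBl.
    + by move=> u; rewrite mulrC cmul_norm.
    + by move=> d /cx [y [[? ?] ?]]; exists y.
  move=> fB fle fx; apply/eqP; rewrite -subr_eq0 -normr_le0; apply: ltP_eps => // d d0.
  have e1 : 0 < `|e| + 1 by rewrite ltr_wpDl.
  have [y [fy xy]] := fx _ (divr_gt0 d0 e1).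
  have -> : f x - x = f (x - y) - (x - y) by rewrite fB fy opprB addrA subrK.
  rewrite add0r; apply: le_trans (ler_normB _ _) _.
  have -> : d = (`|e| + 1) * (d / (`|e| + 1)) by rewrite mulrC divfK ?gt_eqF.
  apply: le_trans (_ : (`|e| + 1) * `|x - y| <= _); last by rewrite ler_pM2l // ltW.
  by rewrite mulrDl mul1r lerD.
- by rewrite cmul0l cmul0r.
- by move=> k x y [x1 x2] [y1 y2]; rewrite cmulDl cmulDr cmulZl cmulZr x1 x2 y1 y2.
- by move=> x y [x1 x2] [y1 y2]; rewrite cmulA x1 -cmulA y2.
- move=> x [x1 x2]; split.
    by rewrite -{1}ee -cstarM x2.
  by rewrite -{1}ee -cstarM x1.
Qed.

Lemma cstar_iso_inverse A B (X : set A) (Y : set B) (phi : A -> B) (psi : B -> A) :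
  generates X -> generates Y -> star_hom phi -> star_hom psi ->
  (forall a, X a -> psi (phi a) = a) -> (forall b, Y b -> phi (psi b) = b) ->
  cstar_iso A B.
Proof.
move=> gX gY hp hq E F; exists phi; split=> //; exists psi.
  exact: (star_hom_eq gX (star_hom_comp hp hq) (star_hom_id A)).
exact: (star_hom_eq gY (star_hom_comp hq hp) (star_hom_id B)).
Qed.

End StarHoms.

Lemma sinv0 (S : invSemigroup0Type) : sinv (szero : S) = szero.
Proof. by apply/esym/sinv_uniq; rewrite !mul_szerol. Qed.

(** * Two-sided translates *)

Section TwoSidedFamily.
Local Open Scope group_scope.
Variables (R : realType) (P : lcmMonoidType) (A : cstarType R).
Variables (S : P -> A) (f : set (P * P) -> A).
Hypothesis H : ts_family S f.
Implicit Types p q r x y u v : P.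

Let L q := (S q)^† ** S q.

Lemma ts_right1 a : a ** f (@Delta P) = a.
Proof. by case: (ts_f_Delta H a). Qed.

Lemma ts_left1 a : f (@Delta P) ** a = a.
Proof. by case: (ts_f_Delta H a). Qed.

Lemma ts_initial q : L q = f (upper (@Delta P) q).
Proof. by rewrite -(ts_f_upper H) ?ts_right1 //; exact: JP_Delta. Qed.

Lemma ts_final p : S p ** (S p)^† = f (lower (@Delta P) p).
Proof. by rewrite -(ts_f_lower H) ?ts_right1 //; exact: JP_Delta. Qed.

Let JU q : JP (upper (@Delta P) q). Proof. exact/JP_upper/JP_Delta. Qed.
Let JL q : JP (lower (@Delta P) q). Proof. exact/JP_lower/JP_Delta. Qed.

Lemma upper_DeltaE q : upper (@Delta P) q = [set (b * q * x, x) | b in setT & x in setT].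
Proof.
rewrite eqEsubset; split=> z [b].
  by move=> [x [-> _]]; exists b => //; exists x.
by move=> _ [x _ <-]; exists b, x; split=> //; exists b, (q * x); rewrite mulgA.
Qed.

Lemma lower_DeltaE p : lower (@Delta P) p = [set (b * p * x, p * x) | b in setT & x in setT].
Proof.
rewrite eqEsubset; split=> z [b].
  by move=> [x [-> _]]; exists b => //; exists x.
by move=> _ [x _ <-]; exists b, x; split=> //; exists (b * p), x.
Qed.

(** Elements of [upper Delta x] are the pairs [(b x m, m)]; cancelling [m] turns their intersections
    into intersections of left ideals. *)
Lemma ts_L_lcm x y l : lideal x `&` lideal y = lideal l -> L x ** L y = L l.
Proof.
move=> E; rewrite !ts_initial (ts_f_mul H) //; congr f.
rewrite !upper_DeltaE eqEsubset; split=> z.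
  move=> [[b _ [m _ <-]] [c _ [m' _]]] -[+ mm]; rewrite mm => /lcm_mulIg cb.
  have : (lideal x `&` lideal y) (b * x) by split; [exists b|exists c].
  by rewrite E => -[d _ <-]; exists d => //; exists m.
move=> [b _ [m _ <-]]; have : lideal l (b * l) by exists b.
rewrite -E => -[[c _ cE] [d _ dE]]; split.
  by exists c => //; exists m; rewrite ?cE.
by exists d => //; exists m; rewrite ?dE.
Qed.

Lemma ts_L_disjoint x y : lideal x `&` lideal y = set0 -> L x ** L y = 0%R.
Proof.
move=> E; rewrite !ts_initial (ts_f_mul H) // -[RHS](ts_f_empty H); congr f.
rewrite !upper_DeltaE -subset0 => z [[b _ [m _ <-]] [c _ [m' _]]] -[+ mm].
rewrite mm => /lcm_mulIg cb; suff: set0 (b * x) by []; rewrite -E.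
by split; [exists b|exists c].
Qed.

Lemma ts_R_lcm x y m : rideal x `&` rideal y = rideal m ->
  S x ** (S x)^† ** (S y ** (S y)^†) = S m ** (S m)^†.
Proof.
move=> E; rewrite !ts_final (ts_f_mul H) //; congr f.
rewrite !lower_DeltaE eqEsubset; split=> z.
  move=> [[b _ [n _ <-]] [c _ [n' _]]] -[+ nn]; rewrite -!mulgA nn => /lcm_mulIg cb.
  have : (rideal x `&` rideal y) (x * n) by split; [exists n|exists n'].
  by rewrite E => -[d _ <-]; exists b => //; exists d => //; rewrite mulgA.
move=> [b _ [n _ <-]]; have : rideal m (m * n) by exists n.
rewrite -E => -[[c _ cE] [d _ dE]]; split.
  by exists b => //; exists c; rewrite -?mulgA ?cE.
by exists b => //; exists d; rewrite -?mulgA ?dE.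
Qed.

Lemma ts_R_disjoint x y : rideal x `&` rideal y = set0 ->
  S x ** (S x)^† ** (S y ** (S y)^†) = 0%R.
Proof.
move=> E; rewrite !ts_final (ts_f_mul H) // -[RHS](ts_f_empty H); congr f.
rewrite !lower_DeltaE -subset0 => z [[b _ [n _ <-]] [c _ [n' _]]] -[_ nn].
suff: set0 (x * n) by []; rewrite -E.
by split; [exists n|exists n'].
Qed.

Lemma ts_piso p : S p ** (S p)^† ** S p = S p.
Proof. exact: ts_S_piso H p. Qed.

Lemma ts_piso_star p : (S p)^† ** S p ** (S p)^† = (S p)^†.
Proof. by rewrite -[in RHS](ts_piso p) !cstarM cstarK cmulA. Qed.

Lemma ts_star_mul p q : (S q)^† ** (S p)^† = (S (p * q))^†.
Proof. by rewrite -cstarM (ts_S_mul H). Qed.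

Lemma ts_L_star q : (L q)^† = L q.
Proof. by rewrite /L cstarM cstarK. Qed.

(** Initial and final projections are all of the form [f Y], hence commute, and
    [(S x)^† ** L q ** S x = L (q * x)]. *)
Lemma ts_L_mulS q x : L q ** S x = S x ** L (q * x).
Proof.
have c : L q ** (S x ** (S x)^†) = S x ** (S x)^† ** L q.
  by rewrite ts_initial ts_final !(ts_f_mul H) // setIC.
rewrite -{1}(ts_piso x) cmulA c -!cmulA; congr (_ ** _).
by rewrite /L -(ts_S_mul H) cstarM !cmulA.
Qed.

Lemma ts_star_mulL q x : (S x)^† ** L q = L (q * x) ** (S x)^†.
Proof.
by rewrite -[LHS]cstarK cstarM cstarK ts_L_star ts_L_mulS cstarM ts_L_star.
Qed.

(** Insert the final projections of [S x] and [S y] in the middle: their product is that of the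
    right lcm [x x1 = y y1], and [S x], [S y] cancel up to initial projections, which are then moved
    inward. *)
Lemma ts_star_mulS x y x1 y1 : x * x1 = y * y1 ->
  rideal x `&` rideal y = rideal (x * x1) ->
  (S x)^† ** S y = S x1 ** L (x * x1) ** (S y1)^†.
Proof.
move=> E I.
rewrite -(ts_piso_star x) -(ts_piso y) -cmulA.
have -> : L x ** ((S x)^† ** (S y ** (S y)^† ** S y))
        = (S x)^† ** (S x ** (S x)^† ** (S y ** (S y)^†)) ** S y.
  by rewrite /L !cmulA ts_piso_star.
rewrite (ts_R_lcm I) {2}E -(ts_S_mul H x) -ts_star_mul.
have -> : (S x)^† ** (S x ** S x1 ** ((S y1)^† ** (S y)^†)) ** S y
   = L x ** S x1 ** ((S y1)^† ** L y) by rewrite /L !cmulA.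
rewrite ts_L_mulS ts_star_mulL -E.
have LL : L (x * x1) ** L (x * x1) = L (x * x1) by rewrite /L !cmulA ts_piso_star.
by rewrite -cmulA (cmulA (L _)) LL cmulA.
Qed.

Lemma ts_star_mulS0 x y : rideal x `&` rideal y = set0 -> (S x)^† ** S y = 0%R.
Proof.
move=> I; rewrite -(ts_piso_star x) -(ts_piso y) -cmulA.
have -> : L x ** ((S x)^† ** (S y ** (S y)^† ** S y))
        = (S x)^† ** (S x ** (S x)^† ** (S y ** (S y)^†)) ** S y.
  by rewrite /L !cmulA ts_piso_star.
by rewrite (ts_R_disjoint I) cmul0r cmul0l.
Qed.

(** [S 1] is idempotent with final projection 1. *)
Lemma ts_S1 : S 1 = f (@Delta P).
Proof.
have low1 : lower (@Delta P) 1 = @Delta P.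
  rewrite lower_DeltaE eqEsubset; split=> z.
    by move=> [b _ [x _ <-]]; exists b, x; rewrite !mulg1 mul1g.
  by move=> [b [x ->]]; exists b => //; exists x; rewrite // !mulg1 mul1g.
have E : S 1 ** (S 1)^† = f (@Delta P) by rewrite ts_final low1.
by rewrite -[LHS]ts_right1 -E cmulA (ts_S_mul H) mulg1.
Qed.

Lemma ts_S_invertible u : invertible u ->
  S u ** (S u)^† = f (@Delta P) /\ (S u)^† ** S u = f (@Delta P).
Proof.
move=> [v [uv vu]]; have E : S u ** S v = f (@Delta P) by rewrite (ts_S_mul H) uv ts_S1.
have F : S v ** S u = f (@Delta P) by rewrite (ts_S_mul H) vu ts_S1.
split.
  by rewrite -[LHS]ts_right1 -E cmulA ts_piso E.
by rewrite -[LHS]ts_left1 -F -!cmulA (cmulA (S u)) ts_piso F.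
Qed.

Let val p r r1 := S p ** L (r * r1) ** (S r1)^†.

Definition ts_val (s : SP P) (a : A) : Prop :=
  exists p r r1 p1, [/\ r * r1 = p1 * p, s = bra p (r * r1) r & a = val p r r1].

(** Another representative differs by invertible elements [u] and [v]; [S u] and [S v] are unitary
    and cancel around [L]. *)
Lemma ts_val_uniq s a b : ts_val s a -> ts_val s b -> a = b.
Proof.
move=> [p [r [r1 [p1 [E -> ->]]]]] [a' [c [c1 [a1 [F sE ->]]]]].
have [u [v [hu hv pE qE rE]]] := (bra_eq (admissibleI E) (admissibleI F)).1 sE.
have r1E : r1 = c1 * u.
  apply: (@lcm_mulgI _ r); rewrite qE rE -!mulgA //.
rewrite /val qE pE r1E /L -!(ts_S_mul H) !cstarM.
have [uu _] := ts_S_invertible hu; have [_ vv] := ts_S_invertible hv.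
have -> : S a' ** S u ** ((S u)^† ** ((S c1)^† ** (S c)^† ** (S v)^†) **
            (S v ** (S c ** S c1) ** S u)) ** ((S u)^† ** (S c1)^†)
   = S a' ** ((S u ** (S u)^†) ** ((S c1)^† ** (S c)^† ** ((S v)^† ** S v) **
       (S c ** S c1) ** (S u ** (S u)^†))) ** (S c1)^† by rewrite !cmulA.
by rewrite uu vv ts_left1 !ts_right1.
Qed.

Definition ts_rep (s : SP P) : A := xget 0%R (ts_val s).

Lemma ts_repE p r r1 p1 : r * r1 = p1 * p ->
  ts_rep (bra p (r * r1) r) = S p ** L (r * r1) ** (S r1)^†.
Proof.
move=> E; apply: (@ts_val_uniq (bra p (r * r1) r)); last by exists p, r, r1, p1.
by apply: xgetPex; exists (val p r r1), p, r, r1, p1.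
Qed.

Lemma ts_rep0 : ts_rep None = 0%R.
Proof.
rewrite /ts_rep; case: xgetP => // a _ [p [r [r1 [p1 [E /esym F _]]]]].
by case: (bra_neq0 (admissibleI E) F).
Qed.

(** The inner factor [(S r1)^† ** S a] is resolved by a right lcm, the initial projections are
    pushed to the centre, and there a left lcm multiplies them. An empty intersection on either side
    gives 0 on both sides of the product formula. *)
Lemma ts_rep_isg : isg_rep (ts_rep : SP P -> A).
Proof.
split=> [s t|s|]; last exact: ts_rep0.
- case: (SPP s) => [->|[p [q [r [As sE]]]]].
    by rewrite mul_szerol ts_rep0 cmul0l.
  case: (SPP t) => [->|[a [b [c [Bt tE]]]]].
    by rewrite mul_szeror ts_rep0 cmul0r.
  have [r1 [p1 [qE E]]] := admissibleE As; have [c1 [a1 [bE F]]] := admissibleE Bt.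
  subst q b; rewrite sE tE (ts_repE E) (ts_repE F).
  have rid : rideal (r * a) `&` rideal (r * r1) = set0 ->
      rideal r1 `&` rideal a = set0.
    move=> I0; rewrite -subset0 => z [[x _ <-] [y _ yE]].
    suff: set0 (r * r1 * x) by []; rewrite -I0; split; last by exists x.
    by exists y => //; rewrite -!mulgA yE.
  case: (lcm_rideal (r * a) (r * r1)) => [I0|[k I]].
    rewrite (SP_mul0 As Bt (or_introl I0)) ts_rep0.
    have -> : forall x y z w u v : A, x ** y ** z ** (w ** u ** v) = x ** y ** (z ** w) ** (u ** v).
      by move=> *; rewrite !cmulA.
    by rewrite (ts_star_mulS0 (rid I0)) cmul0r cmul0l.
  have [[x _ xE] [y _ yE]] : (rideal (r * a) `&` rideal (r * r1)) k.
    by rewrite I; exists 1; rewrite ?mulg1.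
  have axy : r1 * y = a * x by apply: (@lcm_mulgI _ r); rewrite !mulgA xE.
  (* The product in [SP] uses the right lcm of [r a] and [r r1]; cancelling [r] gives the one of [a]
     and [r1]. *)
  have I' : rideal r1 `&` rideal a = rideal (r1 * y).
    rewrite eqEsubset; split=> z.
      move=> [[m _ <-] [n _ nE]].
      have : (rideal (r * a) `&` rideal (r * r1)) (r * r1 * m).
        by split; [exists n; rewrite // -!mulgA nE|exists m].
      rewrite I -yE => -[d _ dE]; exists d => //.
      by apply: (@lcm_mulgI _ r); rewrite !mulgA.
    by move=> [d _ <-]; split; [exists (y * d); rewrite // mulgA|rewrite axy; exists (x * d); rewrite // mulgA].
  have -> : forall x y z w u v : A, x ** y ** z ** (w ** u ** v) = x ** y ** (z ** w) ** (u ** v).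
    by move=> *; rewrite !cmulA.
  rewrite (ts_star_mulS axy I').
  have -> : forall x y z w u v t : A, x ** y ** (z ** w ** u) ** (v ** t) =
      x ** (y ** z) ** w ** (u ** v) ** t.
    by move=> *; rewrite !cmulA.
  rewrite ts_L_mulS ts_star_mulL.
  (* A left multiple has a smaller initial projection, so [L (r1 * y)] is absorbed by
     [L (r * r1 * y)]. *)
  have Lsub m n : L (m * n) ** L n = L (m * n).
    by rewrite /L -(ts_S_mul H) -!cmulA (cmulA (S n)) ts_piso.
  have -> : forall x z w u v t s : A, x ** (z ** w) ** u ** (v ** s) ** t =
      x ** z ** (w ** u ** v) ** (s ** t).
    by move=> *; rewrite !cmulA.
  rewrite -(mulgA r r1) Lsub (ts_S_mul H) ts_star_mul.
  have -> : r * (r1 * y) = r * a * x by rewrite axy mulgA.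
  case: (lcm_lideal (r * a) (c * c1)) => [J0|[l J]].
    rewrite (SP_mul0 As Bt (or_intror J0)) ts_rep0 ts_L_disjoint ?cmul0r ?cmul0l //.
    rewrite -subset0 => z [[m _ <-] [n _ nE]].
    suff: set0 (m * (r * a)) by []; rewrite -J0; split; first by exists m.
    by exists n => //; apply: (@lcm_mulIg _ x); rewrite -!mulgA; rewrite -!mulgA in nE.
  have [[d _ dE] [e _ eE]] : (lideal (r * a) `&` lideal (c * c1)) l.
    by rewrite J; exists 1; rewrite ?mul1g.
  have dE' : d * r * a = l by rewrite -mulgA dE.
  rewrite (SP_mulE As Bt I xE yE J dE' eE).
  (* Both remaining projections carry the extra right factor [x]; by cancellation the left lcm [l]
     becomes [l x]. *)
  have J' : lideal (r * a * x) `&` lideal (c * c1 * x) = lideal (d * r * a * x).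
    have <- : l = d * r * a by rewrite -dE mulgA.
    rewrite eqEsubset; split=> z.
      move=> [[m _ <-] [n _ nE]].
      have : (lideal (r * a) `&` lideal (c * c1)) (m * (r * a)).
        split; [by exists m|exists n => //].
        by apply: (@lcm_mulIg _ x); rewrite -!mulgA; rewrite -!mulgA in nE.
      by rewrite J => -[g _ gE]; exists g; rewrite // !mulgA gE !mulgA.
    move=> [g _ <-]; split.
      by exists (g * d) => //; rewrite -dE !mulgA.
    by exists (g * e) => //; rewrite -eE !mulgA.
  rewrite (ts_L_lcm J').
  have K : d * r * a * x = e * c * (c1 * x).
    by rewrite -(mulgA d) dE -eE !mulgA.
  rewrite K (@ts_repE _ _ _ (d * p1)) //.
  rewrite -K -!mulgA (mulgA r a) xE -yE !mulgA -(mulgA d) E !mulgA //.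
- case: (SPP s) => [->|[p [q [r [As ->]]]]].
    rewrite (sinv0 (SP P)).
    by rewrite ts_rep0 cstar0.
  have [r1 [p1 [qE E]]] := admissibleE As; subst q.
  rewrite (SP_invE erefl E) (ts_repE E) {1}E (ts_repE (esym E)).
  by rewrite /L !cstarM !cstarK !cmulA E.
Qed.

End TwoSidedFamily.

(** * The idempotents of the sets in [JP] and the first isomorphism *)

Section TwoSidedIso.
Local Open Scope group_scope.
Variables (R : realType) (P : lcmMonoidType).
Implicit Types (p q r x y z : P) (e g s : SP P) (Y Z : set (P * P)).

Definition SP_gen p : SP P := bra p p p.

Lemma SP_gen_act p z x x' : SP_act (SP_gen p) z x x' <->
  exists b, z = b * p * x /\ x' = p * x.
Proof.
rewrite /SP_gen -{2}[p]mulg1 (@SP_actE _ p p 1 1); last by rewrite mulg1 mul1g.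
split=> [[b [y [-> -> ->]]]|[b [-> ->]]].
  by exists b; rewrite mulg1 mul1g.
by exists b, x; rewrite mulg1 mul1g.
Qed.

Definition SP_restr e Y := forall z x x', SP_act e z x x' <-> x = x' /\ Y (z, x).

Lemma SP_restr_Delta : SP_restr (SP_gen 1) (@Delta P).
Proof.
move=> z x x'; rewrite SP_gen_act; split.
  by move=> [b [-> ->]]; rewrite mul1g mulg1; split=> //; exists b, x.
by move=> [<- [b [y [-> <-]]]]; exists b; rewrite mul1g mulg1.
Qed.

Lemma SP_restr_empty : SP_restr None set0.
Proof. by move=> z x x'; split=> [/SP_act0|[]]. Qed.

Lemma SP_restrI e g Y Z : SP_restr e Y -> SP_restr g Z -> SP_restr (e * g) (Y `&` Z).
Proof.
move=> eY gZ z x x'; rewrite SP_act_mul; split.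
  by move=> [w [/gZ [-> Zx] /eY [<- Yx]]].
by move=> [<- [Yx Zx]]; exists x; split; [apply/gZ|apply/eY].
Qed.

Lemma SP_restr_lower e Y p : SP_restr e Y ->
  SP_restr (SP_gen p * e * sinv (SP_gen p)) (lower Y p).
Proof.
move=> eY z x x'; rewrite SP_act_mul; split.
  move=> [w [/SP_act_inv/SP_gen_act [b [-> ->]] /SP_act_mul [v [/eY [<- Yw]]]]].
  by move=> /SP_gen_act [_ [_ ->]]; split=> //; exists b, w.
move=> [<- [b [y [[-> ->] Yy]]]]; exists y; split.
  by apply/SP_act_inv/SP_gen_act; exists b.
apply/SP_act_mul; exists y; split; first by apply/eY.
by apply/SP_gen_act; exists b.
Qed.

Lemma SP_restr_upper e Y p : SP_restr e Y ->
  SP_restr (sinv (SP_gen p) * e * SP_gen p) (upper Y p).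
Proof.
move=> eY z x x'; rewrite SP_act_mul; split.
  move=> [w [/SP_gen_act [b [-> ->]] /SP_act_mul [v [/eY [<- Yw]]]]].
  by move=> /SP_act_inv/SP_gen_act [_ [_ /lcm_mulgI <-]]; split=> //; exists b, x.
move=> [<- [b [y [[-> ->] Yy]]]]; exists (p * y); split.
  by apply/SP_gen_act; exists b.
apply/SP_act_mul; exists (p * y); split; first by apply/eY.
by apply/SP_act_inv/SP_gen_act; exists b.
Qed.

Lemma SP_restr_uniq e g Y : SP_restr e Y -> SP_restr g Y -> e = g.
Proof. by move=> eY gY; apply: SP_act_inj => z x x'; rewrite eY gY. Qed.

Lemma JP_restr Y : JP Y -> exists e, SP_restr e Y.
Proof.
elim=> [||{}Y Z _ [e eY] _ [g gZ]|{}Y p _ [e eY]|{}Y p _ [e eY]].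
- by exists (SP_gen 1); exact: SP_restr_Delta.
- by exists None; exact: SP_restr_empty.
- by exists (e * g); exact: SP_restrI.
- by eexists; exact: SP_restr_lower eY.
- by eexists; exact: SP_restr_upper eY.
Qed.

(** [JP] is a proposition and allows no recursion into [SP P]; the idempotent is chosen instead, and
    faithfulness of the action makes it unique. *)
Definition SP_idem Y : SP P := xget None [set e | SP_restr e Y].

Lemma SP_idemE e Y : SP_restr e Y -> SP_idem Y = e.
Proof.
move=> eY; apply: SP_restr_uniq (eY).
by apply: (@xgetPex _ None [set e | SP_restr e Y]); exists e.
Qed.

Lemma SP_restr_idem e Y : SP_restr e Y -> e * e = e /\ sinv e = e.
Proof.
move=> eY; have ee : e * e = e.
  by apply: (@SP_restr_uniq _ _ Y) => //; rewrite -[Y]setIid; exact: SP_restrI.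
by split=> //; exact: sinv_idem.
Qed.

Lemma SP_gen_mul p q : SP_gen p * SP_gen q = SP_gen (p * q).
Proof.
apply: SP_act_inj => z x x'; rewrite SP_act_mul SP_gen_act; split.
  move=> [w [/SP_gen_act [b [zE ->]] /SP_gen_act [c [zE' ->]]]].
  by exists c; rewrite zE' !mulgA.
move=> [b [-> ->]]; exists (q * x); split; apply/SP_gen_act.
  by exists (b * p); rewrite !mulgA.
by exists b; rewrite !mulgA.
Qed.

Lemma SP_act_Delta s z x x' : SP_act s z x x' -> Delta (z, x) /\ Delta (z, x').
Proof.
case: (SPP s) => [-> /SP_act0//|[p [q [r [As ->]]]]].
have [r1 [p1 [qE E]]] := admissibleE As; subst q.
move=> /(SP_actE _ _ _ E) [e [y [-> -> ->]]]; split.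
  by exists (e * r), (r1 * y); rewrite !mulgA.
by exists (e * p1), (p * y); rewrite E !mulgA.
Qed.

Lemma SP_mul1 s : SP_gen 1 * s = s /\ s * SP_gen 1 = s.
Proof.
split; apply: SP_act_inj => z x x'; rewrite SP_act_mul; split.
- by move=> [w [sw /SP_restr_Delta [<-]]].
- move=> sx; exists x'; split=> //; apply/SP_restr_Delta; split=> //.
  by have [] := SP_act_Delta sx.
- by move=> [w [/SP_restr_Delta [<-]]].
- move=> sx; exists x; split=> //; apply/SP_restr_Delta; split=> //.
  by have [] := SP_act_Delta sx.
Qed.

Lemma SP_idem_inter Y Z : JP Y -> JP Z -> SP_idem (Y `&` Z) = SP_idem Y * SP_idem Z.
Proof.
move=> /JP_restr [e eY] /JP_restr [g gZ].
by rewrite (SP_idemE eY) (SP_idemE gZ); apply: SP_idemE; exact: SP_restrI.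
Qed.

Lemma SP_idem_lower Y p : JP Y ->
  SP_idem (lower Y p) = SP_gen p * SP_idem Y * sinv (SP_gen p).
Proof.
move=> /JP_restr [e eY]; rewrite (SP_idemE eY).
by apply: SP_idemE; exact: SP_restr_lower.
Qed.

Lemma SP_idem_upper Y p : JP Y ->
  SP_idem (upper Y p) = sinv (SP_gen p) * SP_idem Y * SP_gen p.
Proof.
move=> /JP_restr [e eY]; rewrite (SP_idemE eY).
by apply: SP_idemE; exact: SP_restr_upper.
Qed.

Lemma SP_idem_Delta : SP_idem (@Delta P) = SP_gen 1.
Proof. exact: SP_idemE SP_restr_Delta. Qed.

Lemma SP_idem_empty : SP_idem set0 = None.
Proof. exact: SP_idemE SP_restr_empty. Qed.

(** Generation is used for the unit only; the other relations hold already in the semigroup. *)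
Lemma isg_rep_ts_family (B : cstarType R) (pi : SP P -> B) :
  isg_rep pi -> generates (range pi) ->
  ts_family (fun p => pi (SP_gen p)) (fun Y => pi (SP_idem Y)).
Proof.
move=> [piM piS pi0] gB; split=> [p|Y /JP_restr [e eY]|p q|Y Z JY JZ| | |p Y JY|p Y JY].
- by rewrite /partial_isometry -piS -!piM mul_sinvK.
- have [ee es] := SP_restr_idem eY.
  by rewrite /projection (SP_idemE eY) -piM -piS ee es.
- by rewrite -piM SP_gen_mul.
- by rewrite SP_idem_inter // piM.
- rewrite SP_idem_Delta; apply: is_one_generated gB _ _.
    by rewrite -piS (SP_restr_idem SP_restr_Delta).2.
  by move=> _ [s _ <-]; have [E F] := SP_mul1 s; rewrite -!piM E F.
- by rewrite SP_idem_empty.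
- by rewrite SP_idem_lower // !piM piS.
- by rewrite SP_idem_upper // !piM piS.
Qed.

(** The counterpart of [ts_repE] inside the semigroup. It makes the two canonical maps inverse to
    each other on the image of [SP]. *)
Lemma SP_factor p r r1 p1 : r * r1 = p1 * p ->
  bra p (r * r1) r = SP_gen p * (sinv (SP_gen (r * r1)) * SP_gen (r * r1))
    * sinv (SP_gen r1).
Proof.
move=> E; apply: SP_act_inj => z x x'; rewrite (SP_actE _ _ _ E).
have Lact q y w : SP_act (sinv (SP_gen q) * SP_gen q) z y w <-> y = w /\ exists b, z = b * q * y.
  rewrite SP_act_mul; split.
    move=> [v [/SP_gen_act [b [-> ->]] /SP_act_inv/SP_gen_act [_ [_ /lcm_mulgI ->]]]].
    by split=> //; exists b.
  move=> [<- [b ->]]; exists (q * y); split; first by apply/SP_gen_act; exists b.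
  by apply/SP_act_inv/SP_gen_act; exists b.
rewrite SP_act_mul; split.
  move=> [b [y [zE -> ->]]]; exists y; split.
    by apply/SP_act_inv/SP_gen_act; exists (b * r); rewrite zE !mulgA.
  apply/SP_act_mul; exists y; split; first by apply/Lact; split=> //; exists b.
  by apply/SP_gen_act; exists (b * p1); rewrite zE E !mulgA.
move=> [w [/SP_act_inv/SP_gen_act [_ [_ ->]] /SP_act_mul [v [/Lact [<- [b ->]]]]]].
by move=> /SP_gen_act [_ [_ ->]]; exists b, w.
Qed.

Theorem ts_iso_universal (A B : cstarType R) :
  is_Cstar_ts P A -> is_Cstar_u (SP P : invSemigroup0Type) B -> cstar_iso A B.
Proof.
move=> [S [f [H gA uA]]] [pi [hpi gB uB]].
have [phi [hphi phiS phif]] := uA _ _ _ (isg_rep_ts_family hpi gB).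
have [psi [hpsi psipi]] := uB _ _ (ts_rep_isg H).
have repS p : ts_rep S (SP_gen p) = S p.
  rewrite /SP_gen -{2}[p]mulg1 (@ts_repE _ _ _ _ _ H p p 1 1) ?mulg1 ?mul1g //.
  have S1 : (S 1)^† = f (@Delta P).
    by rewrite (ts_S1 H); case: (ts_f_proj H (JP_Delta P)).
  by rewrite S1 (ts_right1 H) cmulA (ts_piso H).
apply: (cstar_iso_inverse gA gB hphi hpsi) => [a [[p _ <-]|[Y JY <-]]|_ [s _ <-]].
- by rewrite phiS psipi repS.
- rewrite (phif _ JY) psipi; have [repM reps rep0] := ts_rep_isg H.
  (* Both [f] and [SP_idem] follow the construction of [JP], and [S p] is already recovered. *)
  elim: JY => [||{}Y Z JY EY JZ EZ|{}Y p JY EY|{}Y p JY EY].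
  + by rewrite SP_idem_Delta repS (ts_S1 H).
  + by rewrite SP_idem_empty rep0 (ts_f_empty H).
  + by rewrite SP_idem_inter // repM EY EZ (ts_f_mul H).
  + by rewrite SP_idem_lower // !repM reps repS EY (ts_f_lower H).
  + by rewrite SP_idem_upper // !repM reps repS EY (ts_f_upper H).
- rewrite psipi; case: (SPP s) => [->|[p [q [r [As ->]]]]].
    by rewrite ts_rep0 (star_hom0 hphi); case: hpi.
  have [r1 [p1 [qE E]]] := admissibleE As; subst q.
  have [piM piS _] := hpi; have [_ phiM phis] := hphi.
  rewrite (ts_repE H E) !phiM !phis !phiS (SP_factor E).
  by rewrite !piM !piS.
Qed.

End TwoSidedIso.

(** * Filters and germs *)

Section FilterSpace.
Variable S : invSemigroup0Type.
Local Notation filt := (filt S).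
Implicit Types (x y z : filt) (e : idemType S).

(** The topology is pointwise and [bool] discrete, so convergence is eventual agreement at each
    idempotent. *)
Lemma filt_cvg (F : set_system filt) y : Filter F ->
  (forall e, F [set z | contains z e = contains y e]) -> F --> y.
Proof.
move=> FF h A [_ [[B oB <-] By] /filterS]; apply.
have cF : (\val : filt -> {ptws idemType S -> bool}) @ F --> (\val y : {ptws idemType S -> bool}).
  apply/cvg_sup => e C [_ [[D oD <-] Dy] /filterS]; apply.
  apply: (@filterS _ F _ _ _ _ (h e)) => z /= zy.
  by suff: D (contains z e) by []; rewrite zy; exact: Dy.
by apply: cF; exact: open_nbhs_nbhs.
Qed.

Lemma contains_open e (b : bool) : open [set z : filt | contains z e = b].
Proof.
exists [set g : {ptws idemType S -> bool} | g e = b]; last by [].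
have c := @proj_continuous (idemType S) (fun=> bool) e.
rewrite openE => g /= gb; apply: (c g [set b]).
by apply: open_nbhs_nbhs; split; [exact: discrete_open|].
Qed.

Lemma contains_closed e (b : bool) : closed [set z : filt | contains z e = b].
Proof.
rewrite -openC [X in open X](_ : _ = [set z | contains z e = ~~ b]); first exact: contains_open.
rewrite eqEsubset; split=> z /=; first by case: contains b => [[|]|[|]].
by move=> ->; case: b.
Qed.

Definition basic e (l : seq (idemType S)) : set filt :=
  [set z | contains z e && all (fun f => ~~ contains z f) l].

(** The basic sets around [x] generate a filter that converges to [x] by [filt_cvg]. *)
Lemma nbhs_basic x N : nbhs x N -> exists e l, basic e l x /\ basic e l `<=` N.
Proof.
move=> xN; pose D := [set p : idemType S * seq (idemType S) | basic p.1 p.2 x].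
pose F := filter_from D (fun p => basic p.1 p.2).
have FF : Filter F.
  apply: filter_from_filter.
    have [[e xe] _ _ _] := filtW x; exists (e, [::]).
    by rewrite /D /basic /= andbT.
  move=> [e l] [f m]; rewrite /D /basic /= => /andP[xe xl] /andP[xf xm].
  exists (idem_of (idemM (idem_val e) (idem_val f)), l ++ m) => /=.
    by rewrite all_cat xl xm contains_mul.
  move=> z /=; rewrite all_cat => /and3P[zef zl zm].
  rewrite zl zm !andbT; split; apply: contains_le zef _; rewrite /idem_le /=.
    by rewrite (idemC (idem_val e) (idem_val f)) -mulgA idem_val.
  by rewrite -mulgA idem_val.
have /(_ N) [|[e l] /= ? ?] : F --> x; [|exact: xN|by exists e, l].
apply: filt_cvg => f; have [xf|xf] := boolP (contains x f).
  exists (f, [::]); first by rewrite /D /basic /= xf.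
  by move=> z; rewrite /basic /= andbT.
have [[e xe] _ _ _] := filtW x; exists (e, [:: f]).
  by rewrite /D /basic /= (negbTE xf) !andbT; exact: xe.
by move=> z; rewrite /basic /= andbT => /andP[_ /negbTE].
Qed.

Lemma basic_open e l : open (basic e l).
Proof.
rewrite [X in open X](_ : _ = [set z | contains z e = true] `&`
   \big[setI/setT]_(f <- l) [set z | contains z f = false]).
  apply: openI (contains_open e true) _.
  apply: (big_ind open) => [|A B oA oB|f _]; [exact: openT|exact: openI|exact: contains_open].
rewrite eqEsubset -bigcap_seq; split=> z.
  by move=> /andP[ze /allP zl]; split=> // f fl; apply/negbTE/zl.
by move=> [ze zl]; apply/andP; split=> //; apply/allP => f /zl ->.
Qed.

(** An ultrafilter converges to the set of the idempotents that it eventually contains. The fixed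
    [e] keeps this limit nonempty, so that it is again a filter. *)
Lemma contains_compact e : compact [set z : filt | contains z e].
Proof.
rewrite compact_ultra => F UF Fe.
pose y : {ptws idemType S -> bool} := fun f => `[< F [set z | contains z f] >].
have yf : is_filter y.
  split.
  - by exists e; apply/asboolP.
  - exists (idem_of (mul_szerol szero : idem (szero : S))).
    apply/negP => /asboolP /filter_ex [z /= /not_contains0]; exact.
  - move=> f g /asboolP Ff fg; apply/asboolP; apply: filterS Ff => z /= zf.
    exact: contains_le zf fg.
  - move=> f g h /asboolP Ff /asboolP Fg hE; apply/asboolP.
    apply: filterS (filterI Ff Fg) => z [/= zf zg].
    by apply: contains_le (contains_mul zf zg) _; rewrite /idem_le /= -hE idem_val.
pose y' : filt := exist _ y (mem_set yf).
exists y'; split; first by apply/asboolP.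
apply: filt_cvg => f; rewrite /contains /= -/(contains _ _).
have [Ff|] := in_ultra_setVsetC [set z : filt | contains z f] UF.
  by rewrite /y asboolT //; apply: filterS Ff => z.
move=> Ff; rewrite /y asboolF; first by apply: filterS Ff => z /= /negP/negbTE.
by move=> Ff'; have [z []] := filter_ex (filterI Ff Ff').
Qed.

End FilterSpace.

(** * Neighbourhoods of germs *)

Section GermSpace.
Variable S : invSemigroup0Type.
Local Notation filt := (filt S).
Implicit Types (x y z : filt) (e : idemType S) (s t : S) (U : set filt).

Definition source s : set filt := [set x | contains x (dom_idem s)].

Lemma source_open s : open (source s).
Proof. exact: (contains_open (dom_idem s) true). Qed.

Lemma source_compact s : compact (source s).
Proof. exact: contains_compact. Qed.

Lemma Theta_open s U : open U -> U `<=` source s -> open (Theta s U).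
Proof.
move=> oU Us; exists [set Theta s U]; last first.
  by rewrite predeqE => g; split=> [[_ ->] //|?]; exists (Theta s U).
move=> _ ->; exists [fset Theta s U]%fset.
  by move=> V /fset1P ->; apply/mem_set; exists s, U.
rewrite predeqE => g; split=> [h|Tg V]; first by apply: (h (Theta s U)); exact/fset1P.
by move=> /fset1P ->.
Qed.

Lemma Theta_of s U x (sx : contains x (dom_idem s)) :
  Theta s U (germ_of sx) <-> U x.
Proof.
split=> [[y [sy [Uy /germ_of_eq [xy _]]]]|Ux]; first by rewrite xy.
by exists x, sx.
Qed.

(** The sets [Theta] are given as a subbase only. If [[s, x] = [t, x]] is witnessed by [e], then
    [Theta s] and [Theta t] agree over the open set of filters containing [e], so finite
    intersections can be rewritten with the single element [s]. *)
Lemma nbhs_germ s x (sx : contains x (dom_idem s)) (O : set (germ S)) :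
  nbhs (germ_of sx) O ->
  exists U, [/\ open U, U x, U `<=` source s & Theta s U `<=` O].
Proof.
pose D := [set U | [/\ open U, U x & U `<=` source s]].
pose F := filter_from D (Theta s).
have FF : Filter F.
  apply: filter_from_filter.
    by exists (source s); split=> //; exact: source_open.
  move=> U V [oU Ux Us] [oV Vx Vs]; exists (U `&` V).
    by split=> //; [exact: openI|move=> y [/Us]].
  by move=> g [y [sy [[Uy Vy] ->]]]; split; exists y, sy.
suff : F --> germ_of sx by move=> /[apply] -[U [? ? ?] ?]; exists U.
move=> {}O [_ [[D' D'fin <-] [B D'B Bg] BO]].
apply: filterS BO _; apply: (@filterS _ _ _ B); first by move=> g Bg'; exists B.
have [L Lsub LB] := D'fin _ D'B; rewrite -LB.
apply: filter_bigI => V VL.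
have [t [U [oU Ut VE]]] := set_mem (Lsub _ VL).
have : Theta t U (germ_of sx) by rewrite -VE; move: Bg; rewrite -LB => /(_ _ VL).
move=> [y [ty [Uy /germ_of_eq [xy [e [xe E]]]]]].
exists (U `&` [set z | contains z e = true] `&` source s).
  split=> [||z []//].
  - by apply: openI; [apply: openI => //; exact: contains_open|exact: source_open].
  - by split=> //; split=> //; rewrite xy.
move=> g [z [sz [[[Uz ze] _] ->]]]; rewrite VE; exists z, (Ut _ Uz); split=> //.
by apply/germ_of_eq; split=> //; exists e.
Qed.

End GermSpace.

Lemma fmap_ultra (T U : Type) (f : T -> U) (F : set_system T) :
  UltraFilter F -> UltraFilter (f @ F).
Proof.
move=> UF; split; first exact: fmap_proper_filter.
move=> G PG FG; rewrite eqEsubset; split=> // A GA.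
have [//|nA] := in_ultra_setVsetC (f @^-1` A) UF.
by have [x [? []]] := filter_ex (filterI GA (FG (~` A) nA)).
Qed.

(** * Functions transported along one bisection *)

Section Lift.
Variables (R : realType) (S : invSemigroup0Type).
Local Notation filt := (filt S).
Implicit Types (x y z : filt) (e : idemType S) (s t : S) (U : set filt).
Local Notation G := (universal_groupoid S).

Definition germ_lift s (phi : filt -> CC R) : germ S -> CC R :=
  fun g => if `[< Theta s (source s) g >] then phi (germ_dom g) else 0.

Lemma lift_of s phi x (sx : contains x (dom_idem s)) :
  germ_lift s phi (germ_of sx) = phi x.
Proof. by rewrite /germ_lift asboolT ?germ_dom_of //; exact/Theta_of. Qed.

Lemma lift_out s phi g : ~ Theta s (source s) g -> germ_lift s phi g = 0.
Proof. by move=> ng; rewrite /germ_lift asboolF. Qed.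

Lemma nbhs_Theta s U x (sx : contains x (dom_idem s)) :
  nbhs x U -> nbhs (germ_of sx) (Theta s (U `&` source s)).
Proof.
rewrite nbhsE => -[V [oV Vx] VU].
apply: (@filterS _ _ _ (Theta s (V `&` source s))).
  by move=> g [y [sy [[Vy ?] ->]]]; exists y, sy; split=> //; split=> //; exact: VU.
apply: open_nbhs_nbhs; split; last by exists x, sx.
by apply: Theta_open => [|y []//]; apply: openI => //; exact: source_open.
Qed.

(** Only points of the bisection are considered: it need not be closed, and the lift may jump at
    germs outside it. *)
Lemma lift_continuous_at s phi x (sx : contains x (dom_idem s)) :
  {for x, continuous phi} -> {for germ_of sx, continuous (germ_lift s phi)}.
Proof.
move=> cphi N; rewrite /= lift_of => /cphi /= h.
apply: filterS (nbhs_Theta sx h) => g [y [sy [[Ny _] ->]]].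
by rewrite /= lift_of.
Qed.

(** Inside one bisection a germ is determined by its source filter, and distinct filters are
    separated by an idempotent. *)
Lemma Theta_hausdorff s : hausdorff_space (Theta s (source s) : set G).
Proof.
move=> p q pq; apply: val_inj; move: pq.
case: p (valP p) => /= g gV /set_mem [x [sx [_ gE]]]; case: q => h hV.
have /set_mem [y [sy [_ hE]]] := hV; move: gV hV; rewrite gE hE => gV hV pq.
have xy : x = y.
  apply: filtP => e; apply/eqP/negPn/negP => /eqP ne.
  have nb z (sz : contains z (dom_idem s)) (zV : germ_of sz \in Theta s (source s)) :
    nbhs (exist _ (germ_of sz) zV : (Theta s (source s) : set G))
     (set_val @^-1` Theta s ([set w | contains w e = contains z e] `&` source s)).
    rewrite nbhsE; exists (set_val @^-1` Theta s ([set w | contains w e = contains z e] `&` source s)) => //.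
    split; last by exists z, sz.
    exists (Theta s ([set w | contains w e = contains z e] `&` source s)) => //.
    apply: Theta_open => [|? []//].
    by apply: openI; [exact: contains_open|exact: source_open].
  have [[g' g'V] [/= [z [sz [[/= ze _] zE]]]]] := pq _ _ (nb _ sx gV) (nb _ sy hV).
  move=> [z' [sz' [[/= ze' _] zE']]].
  have /germ_of_eq [zz _] : germ_of sz = germ_of sz' by rewrite -zE -zE'.
  by apply: ne; rewrite -ze zz.
move: sy {hE} hV pq; rewrite -xy => sy hV _ /=.
by apply/germ_of_eq; split=> //; exists (dom_idem s).
Qed.

Lemma Theta_compact s : compact (Theta s (source s) : set G).
Proof.
rewrite compact_ultra => F UF FV.
have FD : (@germ_dom S @ F) (source s).
  by apply: (@filterS _ F _ _ _ _ FV) => g [x [sx [_ ->]]] /=; rewrite germ_dom_of.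
have := @source_compact S s; rewrite compact_ultra => /(_ _ (fmap_ultra _ UF) FD) [x [sx Fx]].
exists (germ_of sx); split; first by exists x, sx.
move=> O /nbhs_germ [U [oU Ux Us UO]]; apply: filterS UO _.
have FU : F (@germ_dom S @^-1` U) by apply: Fx; exact: open_nbhs_nbhs.
apply: (@filterS _ F _ _ _ _ (filterI FU FV)) => g [/= Ug [y [sy [_ gE]]]].
by move: Ug; rewrite gE germ_dom_of => Uy; exists y, sy.
Qed.

Lemma Cc_lift s phi : continuous phi -> @Cc R G (germ_lift s phi).
Proof.
move=> cphi; exists 1%N, (fun=> germ_lift s phi); split.
  move=> _; exists (Theta s (source s)); split.
  - by apply: Theta_open => //; exact: source_open.
  - exact: Theta_hausdorff.
  - split.
      by move=> g /set_mem [x [sx [_ ->]]]; exact/lift_continuous_at/cphi.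
    exists (Theta s (source s)); split=> //; first exact: Theta_compact.
    by move=> g; exact: lift_out.
by apply/funext => g; rewrite big_ord1.
Qed.

End Lift.

(** Lists of admissible indices are directed by inclusion; compactness is applied along the filter
    of large lists. *)
Lemma compact_seq_cover (T : topologicalType) (I : eqType) (K : set T)
    (D : I -> Prop) (f : I -> set T) : compact K ->
  (forall i, D i -> open (f i)) -> (forall x, K x -> exists i, D i /\ f i x) ->
  exists r : seq I, (forall i, i \in r -> D i) /\
    forall x, K x -> exists2 i, i \in r & f i x.
Proof.
move=> /compact_near_coveringP cK fo Kf.
pose B (r : seq I) := [set r' : seq I | (forall i, i \in r' -> D i) /\ {subset r <= r'}].
pose F := filter_from [set r : seq I | forall i, i \in r -> D i] B.
have FF : ProperFilter F.
  apply: filter_from_proper; last by move=> r Dr; exists r; split.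
  apply: filter_from_filter; first by exists [::].
  move=> r r' Dr Dr'; exists (r ++ r').
    by move=> i; rewrite mem_cat => /orP[/Dr|/Dr'].
  move=> q [Dq rq]; split; split=> // i ir; apply: rq; rewrite mem_cat ir ?orbT //.
have FD : F [set r : seq I | forall i, i \in r -> D i] by exists [::] => // r [].
have FK : F [set r : seq I | K `<=` [set x | exists2 i, i \in r & f i x]].
  apply: (cK _ F (fun r x => exists2 i, i \in r & f i x)) => x Kx; have [i [Di fx]] := Kf _ Kx.
  exists (f i, B [:: i]).
    split; first by apply: open_nbhs_nbhs; split=> //; exact: fo.
    by exists [:: i] => // j; rewrite inE => /eqP ->.
  by move=> [y r] [/= fy [_ ir]]; exists i => //; apply: ir; rewrite inE.
by have [r [Dr Kr]] := filter_ex (filterI FD FK); exists r; split.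
Qed.

(** * Decomposition of [Cc] into lifts *)

Section CcStructure.
Variables (R : realType) (S : invSemigroup0Type).
Local Notation filt := (filt S).
Implicit Types (x y z : filt) (e : idemType S) (s t : S) (U : set filt).
Local Notation G := (universal_groupoid S).

(** A normal form for the elements of [Cc]. The list remembers the bisections used, whose number
    later bounds the norm. *)
Inductive lift_sum : seq S -> (germ S -> CC R) -> Prop :=
| lift_sum0 : lift_sum [::] (fun=> 0)
| lift_sumS s phi F f : continuous phi -> (forall x, ~ source s x -> phi x = 0) ->
    lift_sum F f -> lift_sum (s :: F) (fun g => germ_lift s phi g + f g).

Lemma lift_sum_cat F E f h : lift_sum F f -> lift_sum E h ->
  lift_sum (F ++ E) (fun g => f g + h g).
Proof.
move=> + hE; elim=> [|s phi F' f' cphi phi0 _ IH] /=.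
  by rewrite [X in lift_sum _ X](_ : _ = h) //; apply/funext => g; rewrite add0r.
rewrite [X in lift_sum _ X](_ : _ = fun g => germ_lift s phi g + (f' g + h g)).
  exact: lift_sumS.
by apply/funext => g; rewrite addrA.
Qed.

Lemma Cc_add (f h : germ S -> CC R) :
  @Cc R G f -> @Cc R G h -> @Cc R G (fun g => f g + h g).
Proof.
move=> [n [F [hF ->]]] [m [E [hE ->]]].
exists (n + m)%N, (fun i : 'I_(n + m) => match fintype.split i with inl j => F j | inr j => E j end).
split; first by move=> i; case: (fintype.split i).
apply/funext => g; rewrite big_split_ord; congr (_ + _); apply: eq_bigr => i _.
  by rewrite (unsplitK (inl i)).
by rewrite (unsplitK (inr i)).
Qed.

Lemma Cc0 : @Cc R G (fun=> 0).
Proof.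
exists 0%N, (fun _ _ => 0); split; first by case.
by apply/funext => g; rewrite big_ord0.
Qed.

Lemma lift_sum_Cc F f : lift_sum F f -> @Cc R G f.
Proof.
elim=> [|s phi {}F {}f cphi _ _ IH]; first exact: Cc0.
by apply: Cc_add => //; exact: Cc_lift.
Qed.

(** The neighbourhoods are taken in the whole groupoid and are disjoint inside [V] only. *)
Lemma hausdorff_separation (V : set G) (g h : germ S) : hausdorff_space V ->
  V g -> V h -> g <> h ->
  exists A B : set G, [/\ nbhs g A, nbhs h B & V `&` A `&` B = set0].
Proof.
move=> hV Vg Vh gh; apply: contrapT => nsep; apply: gh.
suff : exist _ g (mem_set Vg) = exist _ h (mem_set Vh) :> V by move=> [].
apply: hV => A B [_ [[A' oA' <-] A'g] A'A] [_ [[B' oB' <-] B'h] B'B].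
have [k [[Vk A'k] B'k]] : (V `&` A' `&` B') !=set0.
  apply/set0P/negP => /eqP E; apply: nsep; exists A', B'; split=> //.
    by apply: open_nbhs_nbhs; split.
  by apply: open_nbhs_nbhs; split.
by exists (exist _ k (mem_set Vk)); split; [apply: A'A|apply: B'B].
Qed.

(** This is closedness of [Theta s U] relative to [V]. A germ over a point outside [U] is separated
    by its source; one over [U] is separated inside [V] from the germ of [s] over the same point. *)
Lemma Theta_nbhs_out (V : set G) s U x t (tx : contains x (dom_idem t)) :
  open V -> hausdorff_space V -> closed U -> U `<=` source s -> Theta s U `<=` V ->
  V (germ_of tx) -> ~ Theta s U (germ_of tx) ->
  nbhs (germ_of tx) (~` Theta s U).
Proof.
move=> oV hV cU Us UV Vg ng; have [Ux|nUx] := pselect (U x); last first.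
  have nU : nbhs x (~` U) by apply: open_nbhs_nbhs; split=> //; exact: closed_openC.
  apply: filterS (nbhs_Theta tx nU) => _ [y [ty [[nUy _] ->]]] [z [sz [Uz]]].
  by move=> /germ_of_eq [yz _]; apply: nUy; rewrite yz.
have Vs : V (germ_of (Us _ Ux)) by apply: UV; exists x, (Us _ Ux).
have ne : germ_of (Us _ Ux) <> germ_of tx.
  by move=> E; apply: ng; rewrite -E; exists x, (Us _ Ux).
have [A [B [gA gB AB]]] := hausdorff_separation hV Vs Vg ne.
have [U1 [oU1 U1x U1s U1A]] := nbhs_germ gA.
have U1n : nbhs x U1 by exact: open_nbhs_nbhs.
apply: filterS (filterI gB (nbhs_Theta tx U1n)) => g [Bg [y [ty [[U1y _] gE]]]] sg.
have Vg' := UV _ sg; move: sg => [z [sz [Uz gE']]].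
suff : set0 g by [].
rewrite -AB; split=> //; split=> //; apply: U1A; exists y.
have yz : y = z by move: gE'; rewrite gE => /germ_of_eq [].
by exists (U1s _ U1y); split=> //; rewrite gE'; apply: germ_of_congr.
Qed.

Definition good_piece (V : set G) (p : S * set filt) : Prop :=
  [/\ open p.2, closed p.2, p.2 `<=` source p.1 & Theta p.1 p.2 `<=` V].

(** Each piece is open and closed relative to [V], so cutting [f] down to it gives a lift and leaves
    a remainder that is still continuous on [V] and vanishes outside the other pieces. *)
Lemma lift_sum_pieces (V : set G) (r : seq (S * set filt)) (f : germ S -> CC R) :
  open V -> hausdorff_space V -> (forall p, p \in r -> good_piece V p) ->
  (forall g, V g -> {for g, continuous f}) ->
  (forall g, (forall p, p \in r -> ~ Theta p.1 p.2 g) -> f g = 0) ->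
  lift_sum (map fst r) f.
Proof.
move=> oV hV; elim: r f => [|[s U] r IH] f gr cf f0.
  rewrite [f](_ : _ = fun=> 0); first exact: lift_sum0.
  by apply/funext => g; exact: f0.
have [/= oU cU Us UV] : good_piece V (s, U) by apply: gr; rewrite mem_head.
pose phi x := if pselect (U x) is left Ux then f (germ_of (Us _ Ux)) else 0.
have phiU x (sx : contains x (dom_idem s)) : U x -> phi x = f (germ_of sx).
  move=> Ux; rewrite /phi; case: pselect => // Ux'.
  by congr f; exact: germ_of_congr.
have phi0 x : ~ U x -> phi x = 0 by rewrite /phi; case: pselect.
have cphi : continuous phi.
  move=> x; have [Ux|nUx] := pselect (U x); last first.
    move=> N /=; rewrite phi0 // => N0.
    have nU : nbhs x (~` U) by apply: open_nbhs_nbhs; split=> //; exact: closed_openC.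
    apply: filterS nU => y nUy /=; rewrite phi0 //; exact: nbhs_singleton.
  move=> N /=; rewrite (phiU _ (Us _ Ux)) // => /(cf _ (UV _ _)) /=.
  move=> /(_ _)/nbhs_germ [|U1 [oU1 U1x U1s U1N]]; first by exists x, (Us _ Ux).
  have U1U : nbhs x (U1 `&` U) by apply: open_nbhs_nbhs; split=> //; exact: openI.
  apply: filterS U1U => y [U1y Uy] /=; rewrite (phiU _ (Us _ Uy)) //.
  by apply: U1N; exists y, (Us _ Uy).
pose h g := f g - germ_lift s phi g.
have -> : f = fun g => germ_lift s phi g + h g by apply/funext => g; rewrite /h addrC subrK.
have liftU g : Theta s U g -> germ_lift s phi g = f g.
  by move=> [x [sx [Ux ->]]]; rewrite lift_of -phiU.
have liftN g : ~ Theta s U g -> germ_lift s phi g = 0.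
  move=> nUg; have [[x [sx [_ gE]]]|/lift_out //] := pselect (Theta s (source s) g).
  by rewrite gE lift_of phi0 // => Ux; apply: nUg; rewrite gE; exists x, sx.
apply: lift_sumS => //; first by move=> x nsx; apply: phi0 => /Us.
apply: IH => [p pr|g Vg|g ng].
- by apply: gr; rewrite in_cons pr orbT.
- apply: cvgB; [exact: (@nbhs_filter G g)|exact: (cf g Vg)|].
  have [[x [sx [Ux ->]]]|nUg] := pselect (Theta s U g).
    exact/lift_continuous_at/cphi.
  move=> N /=; rewrite liftN // => N0.
  have [t [x [tx gE]]] := germP g; rewrite gE in Vg nUg *.
  apply: filterS (Theta_nbhs_out oV hV cU Us UV Vg nUg) => g' ng' /=.
  by rewrite liftN //; exact: nbhs_singleton.
- rewrite /h; have [Ug|nUg] := pselect (Theta s U g); first by rewrite liftU // subrr.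
  rewrite liftN // subr0; apply: f0 => p; rewrite in_cons => /orP[/eqP ->//|]; exact: ng.
Qed.

Lemma basic_closed e (l : seq (idemType S)) : closed (basic e l).
Proof.
rewrite [X in closed X](_ : _ = [set z | contains z e = true] `&`
   \big[setI/setT]_(f <- l) [set z | contains z f = false]).
  apply: closedI; first exact: contains_closed.
  apply: (big_ind closed) => [|A B cA cB|f _]; [exact: closedT|exact: closedI|exact: contains_closed].
rewrite eqEsubset -bigcap_seq; split=> z.
  by move=> /andP[ze /allP zl]; split=> // f fl; apply/negbTE/zl.
by move=> [ze zl]; apply/andP; split=> //; apply/allP => f /zl ->.
Qed.

(** Finitely many sets [Theta s (basic e l)] inside [V] cover the compact support. *)
Lemma Cc_lift_sum (f : germ S -> CC R) : @Cc R G f -> exists F, lift_sum F f.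
Proof.
suff main (V : set G) h : open V -> hausdorff_space V -> cc_on V h ->
    exists F, lift_sum F h.
  move=> [n [F [hF ->]]]; elim: n F hF => [|n IH] F hF.
    exists [::]; rewrite [X in lift_sum _ X](_ : _ = fun=> 0); first exact: lift_sum0.
    by apply/funext => g; rewrite big_ord0.
  have [V [oV hV cV]] := hF ord0; have [F1 h1] := main _ _ oV hV cV.
  have [F2 h2] := IH (fun i => F (fintype.lift ord0 i)) (fun i => hF _).
  exists (F1 ++ F2); rewrite [X in lift_sum _ X](_ : _ = fun g => F ord0 g +
     \sum_(i < n) F (fintype.lift ord0 i) g); first exact: lift_sum_cat.
  by apply/funext => g; rewrite big_ord_recl.
move=> oV hV [cf [K [cK KV h0]]].
pose I := (S * idemType S * seq (idemType S))%type.
pose D (p : I) := basic p.1.2 p.2 `<=` source p.1.1 /\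
   Theta p.1.1 (basic p.1.2 p.2) `<=` V.
have [p [ps _]|g Kg|r [rD rK]] := compact_seq_cover
  (f := fun p : I => Theta p.1.1 (basic p.1.2 p.2)) (D := D) cK.
- by apply: Theta_open => //; exact: basic_open.
- have [s [x [sx gE]]] := germP g.
  have : nbhs (germ_of sx) V.
    by rewrite -gE; apply: open_nbhs_nbhs; split=> //; exact: KV.
  move=> /nbhs_germ [U [oU Ux Us UV]].
  have : nbhs x U by exact: open_nbhs_nbhs.
  move=> /nbhs_basic [e [l [xel elU]]]; exists (s, e, l).
    split; last by rewrite /= gE; exact/Theta_of.
    split=> /= [y /elU/Us//|_ [y [sy [yel ->]]]].
    by apply: UV; exists y, sy; split=> //; exact: elU.
exists (map fst [seq (p.1.1, basic p.1.2 p.2) | p <- r]).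
apply: (lift_sum_pieces oV hV) => [_ /mapP [p pD ->]|g Vg|g ng].
- have [ps pV] := rD _ pD.
  by split=> //; [exact: basic_open|exact: basic_closed].
- by apply: cf; exact: mem_set.
- apply: h0 => /rK [p pD Tg]; apply: (ng (p.1.1, basic p.1.2 p.2)) => //.
  by apply/mapP; exists p.
Qed.

End CcStructure.

(** * Functions on the groupoid of germs *)

Section Convolution.
Variables (R : realType) (S : invSemigroup0Type).
Local Notation filt := (filt S).
Implicit Types (x y z : filt) (e : idemType S) (s t : S) (g h b : germ S).
Local Notation G := (universal_groupoid S).
Local Notation conv := (@Defs.conv R G).
Local Notation finvol := (@Defs.finvol R G).
Local Notation lift := (@germ_lift R S).

Lemma idem_mulK (p q : S) : idem p -> idem q -> (p * q * p = p * q)%g.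
Proof. by move=> ip iq; rewrite -mulgA -(idemC ip iq) mulgA ip. Qed.

Lemma lift_ext s (phi psi : filt -> CC R) :
  (forall x, source s x -> phi x = psi x) -> lift s phi = lift s psi.
Proof.
move=> E; apply/funext => g; have [[x [sx [_ ->]]]|n] := pselect (Theta s (source s) g).
  by rewrite !lift_of E.
by rewrite !lift_out.
Qed.

Lemma conv_seq (u v : germ S -> CC R) g (r : seq (germ S)) : uniq r ->
  (forall b, b \in r -> germ_cod b = germ_cod g) ->
  (forall b, germ_cod b = germ_cod g -> b \notin r -> u b = 0) ->
  conv u v g = \sum_(b <- r) u b * v (germ_mul (germ_inv b) g).
Proof.
move=> ur rg r0; rewrite /Defs.conv; rewrite (@fsbigE _ _ _ _ _ r) //.
  rewrite big_seq_cond [RHS]big_seq; apply: eq_bigl => b.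
  case br : (b \in r) => //=; rewrite mem_set //; exact: rg.
by move=> b bg bnr /=; rewrite r0 ?mul0r.
Qed.

Lemma germ_mulK g b : germ_cod b = germ_cod g ->
  germ_mul b (germ_mul (germ_inv b) g) = g.
Proof.
by move=> E; have := @germ_mulKl _ (germ_inv b) g; rewrite germ_invK germ_dom_inv; exact.
Qed.

(** [alpha s] is inverted by [alpha (sinv s)], so a bisection meets each range fibre at most
    once. *)
Lemma Theta_cod_inj s b b' : Theta s (source s) b -> Theta s (source s) b' ->
  germ_cod b = germ_cod b' -> b = b'.
Proof.
move=> [x [sx [_ ->]]] [y [sy [_ ->]]]; rewrite !germ_cod_of => E.
have xy : x = y by rewrite -(alpha_sinv sx) E alpha_sinv.
exact: germ_of_congr.
Qed.

Lemma source_mul s t x : source (s * t)%g x -> source t x /\ source s (alpha t x).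
Proof.
move=> stx; have tx : source t x.
  apply: contains_le stx _; rewrite /idem_le /= sinvM.
  by rewrite -!mulgA (mulgA t) mul_sinvK.
split=> //; apply/(contains_alpha _ tx); exists (dom_idem (s * t)%g); split=> //.
rewrite /idem_le /= sinvM.
have -> : (t * (sinv t * sinv s * (s * t)) * sinv t
  = (t * sinv t) * (sinv s * s) * (t * sinv t))%g by rewrite !mulgA.
by rewrite (idem_mulK (idem_cod t) (idem_dom s)) -[LHS]mulgA idem_dom.
Qed.

Lemma Theta_mul s t g : Theta (s * t)%g (source (s * t)%g) g ->
  exists x (tx : contains x (dom_idem t)) (sx : contains (alpha t x) (dom_idem s)),
  g = germ_mul (germ_of sx) (germ_of tx).
Proof.
move=> [x [stx [_ ->]]]; have [tx sx] := source_mul stx.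
by exists x, tx, sx; rewrite germ_mul_of; exact: germ_of_congr.
Qed.

Lemma mul_Theta s t b h : Theta s (source s) b -> Theta t (source t) h ->
  germ_dom b = germ_cod h -> Theta (s * t)%g (source (s * t)%g) (germ_mul b h).
Proof.
move=> [y [sy [_ ->]]] [x [tx [_ ->]]]; rewrite germ_dom_of germ_cod_of => E.
move: sy; rewrite E => sy; rewrite germ_mul_of.
by exists x, (alpha_comp_dom tx sy); split=> //; exact: alpha_comp_dom.
Qed.

(** The fibre of [g] has at most one arrow in [Theta s], and the complementary factor lies in
    [Theta t] only if [g] lies in [Theta (s * t)]. *)
Lemma conv_lift s t (phi psi : filt -> CC R) :
  conv (lift s phi) (lift t psi) = lift (s * t)%g (fun x => phi (alpha t x) * psi x).
Proof.
apply/funext => g.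
have [stg|nstg] := pselect (Theta (s * t)%g (source (s * t)%g) g).
  have [x [tx [sx gE]]] := Theta_mul stg.
  have dc : germ_dom (germ_of sx) = germ_cod (germ_of tx).
    by rewrite germ_dom_of germ_cod_of.
  rewrite (@conv_seq _ _ _ [:: germ_of sx]) //; first last.
  - move=> b bg; rewrite inE => /eqP ne; apply: lift_out => sb; apply: ne.
    apply: Theta_cod_inj sb _ _; first by exists (alpha t x), sx.
    by rewrite bg gE germ_cod_mul.
  - by move=> b; rewrite inE => /eqP ->; rewrite gE germ_cod_mul.
  rewrite big_seq1 gE germ_mulKl // !lift_of germ_mul_of lift_of //.
rewrite lift_out //; apply: fsbig1 => b /= bg.
have [sb|nsb] := pselect (Theta s (source s) b); last by rewrite lift_out ?mul0r.
rewrite [X in _ * X]lift_out ?mulr0 // => th; apply: nstg.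
rewrite -(germ_mulK bg); apply: mul_Theta => //.
by rewrite germ_cod_mul ?germ_cod_inv // germ_dom_inv.
Qed.

Lemma finvol_lift s (phi : filt -> CC R) :
  finvol (lift s phi) = lift (sinv s) (fun x => (phi (alpha (sinv s) x))^*).
Proof.
apply/funext => g; rewrite /Defs.finvol /=.
have inv_in u h : Theta u (source u) h -> Theta (sinv u) (source (sinv u)) (germ_inv h).
  move=> [x [ux [_ ->]]]; rewrite germ_inv_of.
  by exists (alpha u x), (dom_alpha_sinv ux); split=> //; exact: dom_alpha_sinv.
have [[x [sx [_ ->]]]|nsg] := pselect (Theta (sinv s) (source (sinv s)) g).
  rewrite lift_of germ_inv_of; have := dom_alpha_sinv sx.
  move: (dom_alpha_sinv sx); rewrite sinvK => sx' _.
  by rewrite lift_of.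
rewrite !lift_out ?conjC0 // => /inv_in.
by rewrite germ_invK.
Qed.

Definition germ_ind s : germ S -> CC R := lift s (fun=> 1).

Lemma conv_ind s t : conv (germ_ind s) (germ_ind t) = germ_ind (s * t)%g.
Proof. by rewrite /germ_ind conv_lift; apply: lift_ext => x _; rewrite mulr1. Qed.

Lemma finvol_ind s : finvol (germ_ind s) = germ_ind (sinv s).
Proof. by rewrite /germ_ind finvol_lift; apply: lift_ext => x _; rewrite conjC1. Qed.

Lemma ind0 : germ_ind szero = fun=> 0.
Proof.
apply/funext => g; apply: lift_out => -[x [sx _]].
by apply: (not_contains0 sx); rewrite /= mul_szeror.
Qed.

(** [s * e] and [s] have the same germ at every filter containing [e]. *)
Lemma lift_restrict s e (phi : filt -> CC R) :
  lift (s * \val e)%g phi = lift s (fun x => (contains x e)%:R * phi x).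
Proof.
have domE : sinv (s * \val e)%g = (\val e * sinv s)%g.
  by rewrite sinvM (sinv_idem (idem_val e)).
have seE : \val (dom_idem (s * \val e)%g) = (\val e * (sinv s * s))%g.
  by rewrite /= domE -(idem_mulK (idem_val e) (idem_dom s)) !mulgA.
have src x : source (s * \val e)%g x -> source s x /\ contains x e.
  move=> h; split; apply: contains_le h _; rewrite /idem_le seE /=.
    by rewrite -[LHS]mulgA idem_dom.
  by rewrite idem_mulK; [|exact: idem_val|exact: idem_dom].
apply/funext => g.
have [[x [sex [_ ->]]]|ng] := pselect (Theta (s * \val e)%g (source (s * \val e)%g) g).
  have [sx ex] := src _ sex.
  have E : germ_of sex = germ_of sx.
    by apply/germ_of_eq; split=> //; exists e; rewrite -mulgA idem_val.
  by rewrite lift_of E lift_of ex mul1r.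
rewrite lift_out //.
have [[x [sx [_ gE]]]|nsg] := pselect (Theta s (source s) g); last by rewrite lift_out.
rewrite gE lift_of; have [ex|] := boolP (contains x e); last by rewrite mul0r.
case: ng; rewrite gE.
have sex : contains x (dom_idem (s * \val e)%g).
  apply: contains_le (contains_mul sx ex) _; rewrite /idem_le seE /=.
  rewrite (idemC (idem_dom s) (idem_val e)).
  exact: (idemM (idem_val e) (idem_dom s)).
exists x, sex; split=> //; apply/germ_of_eq; split=> //.
by exists e; rewrite -mulgA idem_val.
Qed.

End Convolution.

(** * Uniform approximation by combinations of indicators *)

Section Approximation.
Variables (R : realType) (S : invSemigroup0Type).
Local Notation filt := (filt S).
Implicit Types (x y z : filt) (e : idemType S) (s t : S) (g h b : germ S).
Implicit Types (w : seq (CC R * S)) (u v : seq (CC R * idemType S)) (F : seq S).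
Local Notation lift := (@germ_lift R S).
Local Notation ind := (@germ_ind R S).

Definition germ_comb w : germ S -> CC R := fun g => \sum_(p <- w) p.1 * ind p.2 g.

Definition simple_fun u : filt -> CC R :=
  fun x => \sum_(p <- u) p.1 * (contains x p.2)%:R.

Lemma simple_cat u v x : simple_fun (u ++ v) x = simple_fun u x + simple_fun v x.
Proof. exact: big_cat. Qed.

Lemma simple_scale (c : CC R) u x :
  simple_fun [seq (c * p.1, p.2) | p <- u] x = c * simple_fun u x.
Proof. by rewrite /simple_fun big_map mulr_sumr; apply: eq_bigr => p _; rewrite mulrA. Qed.

Lemma simple_mul u v : exists r, forall x,
  simple_fun r x = simple_fun u x * simple_fun v x.
Proof.
exists [seq (p.1 * q.1, idem_of (idemM (idem_val p.2) (idem_val q.2))) | p <- u, q <- v].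
move=> x; rewrite /simple_fun big_allpairs_dep /= mulr_suml; apply: eq_bigr => p _.
rewrite mulr_sumr; apply: eq_bigr => q _; rewrite mulrACA -natrM mulnb; congr (_ * (_ : bool)%:R).
apply/idP/andP => [xpq|[xp xq]]; last exact: contains_mul.
split; apply: contains_le xpq _; rewrite /idem_le /= -mulgA ?idem_val //.
by rewrite (idemC (idem_val q.2) (idem_val p.2)) mulgA idem_val.
Qed.

(** Each excluded idempotent multiplies the indicator by 1 minus its own. *)
Lemma simple_basic e (l : seq (idemType S)) : exists u, forall x,
  simple_fun u x = `[< basic e l x >]%:R.
Proof.
elim: l => [|f l [u uE]].
  exists [:: (1, e)] => x; rewrite /simple_fun big_seq1 mul1r /basic /= andbT.
  by rewrite asboolb.
have [v vE] := simple_mul u [:: (1, f)].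
exists (u ++ [seq (-1 * p.1, p.2) | p <- v]) => x.
rewrite simple_cat simple_scale vE !uE {1}/simple_fun big_seq1 mul1r mulN1r /basic /=.
rewrite !asboolb; case: (contains x e); case: (contains x f); case: all;
  by rewrite /= ?(mulr1, mulr0, mul0r, subrr, subr0).
Qed.

Lemma simple_continuous u : continuous (simple_fun u).
Proof.
elim: u => [|[c e] u IH] x.
  rewrite [simple_fun _](_ : _ = fun=> 0); first exact: (@cst_continuous filt (CC R)).
  by apply/funext => y; rewrite /simple_fun big_nil.
rewrite [simple_fun _](_ : _ = fun y => c * (contains y e)%:R + simple_fun u y).
  apply: cvgD; [exact: (@nbhs_filter _ x)| |exact: (IH x)].
  move=> N /= cN.
  have : nbhs x [set y | contains y e = contains x e].
    by apply: open_nbhs_nbhs; split=> //; exact: contains_open.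
  by apply: filterS => y /= ->; exact: nbhs_singleton.
by apply/funext => y; rewrite /simple_fun big_cons.
Qed.

(** A finite cover by basic sets on which [phi] is nearly constant; overlaps are resolved by
    overwriting the values of the earlier approximant. *)
Lemma simple_approx (phi : filt -> CC R) s (eps : CC R) : continuous phi -> 0 < eps ->
  exists u, forall x, source s x -> `|phi x - simple_fun u x| <= eps.
Proof.
move=> cphi e0.
pose D (p : idemType S * seq (idemType S)) :=
  exists c : CC R, forall y, basic p.1 p.2 y -> `|phi y - c| <= eps.
have [[e l] _|x sx|r [rD rK]] := compact_seq_cover (D := D)
   (f := fun p => basic p.1 p.2) (@source_compact S s).
- exact: basic_open.
- have /cphi := @nbhsx_ballx (CC R) (CC R) (phi x) eps e0.
  rewrite nbhs_simpl => /nbhs_basic [e [l [xel elN]]]; exists (e, l); split=> //.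
  exists (phi x) => y /elN; rewrite /= -ball_normE /= distrC; exact: ltW.
suff [u uE] : exists u, forall x, (exists2 p, p \in r & basic p.1 p.2 x) ->
    `|phi x - simple_fun u x| <= eps.
  by exists u => x /rK; exact: uE.
elim: r rD {rK} => [|[e l] r IH] rD; first by exists [::] => x [].
have [|u uE] := IH; first by move=> p pr; apply: rD; rewrite in_cons pr orbT.
have [c cE] : D (e, l) by apply: rD; rewrite mem_head.
have [v vE] := simple_basic e l.
(* The new approximant is [u + (c - u)] times the indicator of the piece: [c] on the piece and [u]
   elsewhere. *)
have [q qE] := simple_mul ((c, e) :: [seq (-1 * p.1, p.2) | p <- u]) v.
exists (u ++ q) => x xr; rewrite simple_cat qE vE.
have [xel|nxel] := asboolP (basic e l x).
  rewrite mulr1 {2}/simple_fun big_cons /= -/(simple_fun _ x) simple_scale.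
  have -> : contains x e by case/andP: xel.
  by rewrite mulr1 mulN1r addrCA subrr addr0; exact: cE.
rewrite mulr0 addr0; apply: uE; case: xr => p; rewrite in_cons => /orP[/eqP -> //|pr px].
by exists p.
Qed.

Lemma liftD s (phi psi : filt -> CC R) g :
  lift s (fun x => phi x + psi x) g = lift s phi g + lift s psi g.
Proof. by rewrite /germ_lift; case: asboolP; rewrite ?addr0. Qed.

Lemma liftZ s (c : CC R) (phi : filt -> CC R) g :
  lift s (fun x => c * phi x) g = c * lift s phi g.
Proof. by rewrite /germ_lift; case: asboolP; rewrite ?mulr0. Qed.

Lemma lift_simple s u :
  lift s (simple_fun u) = germ_comb [seq (p.1, (s * \val p.2)%g) | p <- u].
Proof.
apply/funext => g; rewrite /germ_comb big_map; elim: u => [|[c e] u IH].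
  rewrite big_nil (@lift_ext _ _ _ _ (fun=> 0)) => [|x _]; last by rewrite /simple_fun big_nil.
  by rewrite /germ_lift; case: asboolP.
rewrite big_cons -IH (@lift_ext _ _ _ _ (fun x => c * (contains x e)%:R + simple_fun u x)).
  rewrite liftD liftZ /germ_ind lift_restrict; congr (_ * _ + _).
  by congr (_ g); apply: lift_ext => x _; rewrite mulr1.
by move=> x _; rewrite /simple_fun big_cons.
Qed.

(** Lying below an element of [F] in the natural partial order. *)
Definition below F s := exists2 t, t \in F & s = (t * (sinv s * s))%g.

Definition comb_over F w := forall p, p \in w -> below F p.2.

Lemma below_mul_idem t e : below [:: t] (t * \val e)%g.
Proof.
exists t; rewrite ?mem_head // sinvM (sinv_idem (idem_val e)).
have -> : (t * (\val e * sinv t * (t * \val e))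
   = t * (\val e * (sinv t * t) * \val e))%g by rewrite !mulgA.
rewrite (idem_mulK (idem_val e) (idem_dom t)) (idemC (idem_val e) (idem_dom t)).
by rewrite !mulgA mul_sinvK.
Qed.

Lemma comb_over_sub F E w : {subset F <= E} -> comb_over F w -> comb_over E w.
Proof. by move=> FE wF p /wF [t tF E']; exists t => //; exact: FE. Qed.

Lemma comb_over_cat F w w' : comb_over F w -> comb_over F w' -> comb_over F (w ++ w').
Proof. by move=> wF wF' p; rewrite mem_cat => /orP[/wF|/wF']. Qed.

Lemma germ_comb_cat w w' g : germ_comb (w ++ w') g = germ_comb w g + germ_comb w' g.
Proof. exact: big_cat. Qed.

(** The point is that [F] does not change with [eps]. *)
Lemma lift_sum_approx F (f : germ S -> CC R) (eps : CC R) : lift_sum F f -> 0 < eps ->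
  exists w, comb_over F w /\ forall g, `|f g - germ_comb w g| <= eps.
Proof.
move=> fF; elim: fF eps => [|s phi {}F {}f cphi _ _ IH] eps e0.
  by exists [::]; split=> // g; rewrite /germ_comb big_nil subrr normr0 ltW.
have e2 : 0 < eps / 2%:R by rewrite divr_gt0.
have [w [wF wE]] := IH _ e2.
have [u uE] := simple_approx s cphi e2.
exists ([seq (p.1, (s * \val p.2)%g) | p <- u] ++ w); split.
  apply: comb_over_cat.
    move=> _ /mapP [p _ ->] /=; have [t ts E] := below_mul_idem s p.2.
    by exists t => //; move: ts; rewrite !inE => ->.
  by apply: comb_over_sub wF => t tF; rewrite in_cons tF orbT.
move=> g; rewrite germ_comb_cat -lift_simple opprD addrACA (splitr eps).
rewrite (le_trans (ler_normD _ _)) // lerD //.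
have [[x [sx [_ ->]]]|ng] := pselect (Theta s (source s) g).
  by rewrite !lift_of; exact: uE.
by rewrite !lift_out // subrr normr0 ltW.
Qed.

End Approximation.

(** * Extension of representations *)

Section PrincipalFilter.
Variable S : invSemigroup0Type.

Definition principal_fun (e : S) : {ptws idemType S -> bool} := fun f => (e * \val f)%g == e.

Lemma principal_is_filter (e : S) : idem e -> e <> szero -> is_filter (principal_fun e).
Proof.
move=> ie e0; split.
- by exists (idem_of ie); apply/eqP.
- exists (idem_of (mul_szerol szero : idem (szero : S))).
  by apply/eqP; rewrite /= mul_szeror => /esym.
- by move=> f g /eqP ef fg; apply/eqP; rewrite -ef -mulgA fg.
- by move=> f g h /eqP ef /eqP eg hE; apply/eqP; rewrite hE mulgA ef eg.
Qed.

Definition principal (e : S) (ie : idem e) (e0 : e <> szero) : filt S :=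
  exist _ (principal_fun e) (mem_set (principal_is_filter ie e0)).

Lemma contains_principal (e : S) (ie : idem e) (e0 : e <> szero) f :
  contains (principal ie e0) f = ((e * \val f)%g == e).
Proof. by []. Qed.

End PrincipalFilter.

(** * Partitions of the unit generated by finitely many idempotents *)

Section Atoms.
Variables (R : realType) (S : invSemigroup0Type) (one : S) (B : cstarType R) (pi : S -> B).
Hypothesis mul1 : forall s, (one * s = s /\ s * one = s)%g.
Hypothesis hpi : isg_rep pi.
Implicit Types (e f s t : S) (L N F : seq S) (a : S * seq S).

Let piM s t : pi (s * t)%g = pi s ** pi t. Proof. by case: hpi. Qed.
Let piS s : pi (sinv s) = (pi s)^†. Proof. by case: hpi. Qed.

(* Pairs [(e, N)] standing for the product of [e] and of the complements of the
   elements of [N]. *)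
Fixpoint atoms L : seq (S * seq S) :=
  if L is f :: L' then [seq ((a.1 * f)%g, a.2) | a <- atoms L'] ++
    [seq (a.1, f :: a.2) | a <- atoms L']
  else [:: (one, [::])].

(** Multiplication by [1 - pi f] is written out because [B] need not have a unit. *)
Definition atom_proj a : B := foldr (fun f b => b - b ** pi f) (pi a.1) a.2.

Lemma atomsP L a : {in L, forall f, idem f} -> a \in atoms L ->
  [/\ idem a.1, {in a.2, forall f, idem f} &
      {in L, forall f, (a.1 * f)%g = a.1 \/ f \in a.2}].
Proof.
elim: L a => [|f L IH] a iL; first by rewrite inE => /eqP -> /=; split=> //; exact: (mul1 one).1.
have iL' : {in L, forall g, idem g} by move=> g gL; apply: iL; rewrite in_cons gL orbT.
have if_ : idem f by apply: iL; rewrite mem_head.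
rewrite mem_cat => /orP[] /mapP [b /(IH _ iL') [ib iN bL] ->] /=; split.
- exact: idemM.
- exact: iN.
- move=> g; rewrite in_cons => /orP[/eqP ->|gL].
    by left; rewrite -mulgA if_.
  have [E|] := bL g gL; last by right.
  left; rewrite -mulgA (idemC if_ (iL' _ gL)) mulgA E //.
- exact: ib.
- by move=> g; rewrite in_cons => /orP[/eqP -> //|]; exact: iN.
- move=> g; rewrite !in_cons => /orP[/eqP ->|gL]; first by right; rewrite eqxx.
  by have [E|E] := bL g gL; [left|right; rewrite E orbT].
Qed.

Lemma pi_idemC e f : idem e -> idem f -> pi e ** pi f = pi f ** pi e.
Proof. by move=> ie jf; rewrite -!piM (idemC ie jf). Qed.

Lemma atom_projM e f N : idem f -> {in N, forall g, idem g} ->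
  atom_proj ((e * f)%g, N) = atom_proj (e, N) ** pi f.
Proof.
move=> jf; elim: N => [|g N IH] iN /=; first by rewrite /atom_proj /= piM.
have iN' : {in N, forall h, idem h} by move=> h hN; apply: iN; rewrite in_cons hN orbT.
have ig : idem g by apply: iN; rewrite mem_head.
rewrite /atom_proj /= -!/(atom_proj (_, N)) (IH iN') cmulBl.
by rewrite -!cmulA (pi_idemC jf ig).
Qed.

Lemma atom_proj_comm e f N : idem e -> idem f -> {in N, forall g, idem g} ->
  atom_proj (e, N) ** pi f = pi f ** atom_proj (e, N).
Proof.
move=> ie jf; elim: N => [|g N IH] iN /=; first by rewrite /atom_proj /= pi_idemC.
have iN' : {in N, forall h, idem h} by move=> h hN; apply: iN; rewrite in_cons hN orbT.
have ig : idem g by apply: iN; rewrite mem_head.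
rewrite /atom_proj /= -!/(atom_proj (_, N)) cmulBl cmulBr -(IH iN').
by rewrite -cmulA (pi_idemC ig jf) !cmulA (IH iN').
Qed.

Lemma atom_proj_le e f N : idem f -> {in N, forall g, idem g} -> (e * f)%g = e ->
  atom_proj (e, N) ** pi f = atom_proj (e, N).
Proof. by move=> jf iN ef; rewrite -atom_projM // ef. Qed.

Lemma atom_proj_out e f N : idem f -> {in N, forall g, idem g} -> f \in N ->
  atom_proj (e, N) ** pi f = 0.
Proof.
move=> jf; elim: N => [//|g N IH] iN.
have iN' : {in N, forall h, idem h} by move=> h hN; apply: iN; rewrite in_cons hN orbT.
have ig : idem g by apply: iN; rewrite mem_head.
rewrite /atom_proj /= -!/(atom_proj (_, N)) in_cons => /orP[/eqP ->|fN].
  by rewrite cmulBl -cmulA -piM ig subrr.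
by rewrite cmulBl -cmulA (pi_idemC ig jf) cmulA (IH iN' fN) cmul0l subrr.
Qed.

Definition atom_comb L (d : S * seq S -> CC R) : B := \sum_(a <- atoms L) d a *: atom_proj a.

Lemma atom_comb_cons f L d : {in f :: L, forall g, idem g} ->
  let x := atom_comb L (fun a => d ((a.1 * f)%g, a.2)) in
  let y := atom_comb L (fun a => d (a.1, f :: a.2)) in
  atom_comb (f :: L) d = x ** pi f + (y - y ** pi f).
Proof.
move=> iL; have iL' : {in L, forall g, idem g} by move=> g gL; apply: iL; rewrite in_cons gL orbT.
have if_ : idem f by apply: iL; rewrite mem_head.
rewrite /= /atom_comb big_cat !big_map; congr (_ + _).
  rewrite cmul_suml big_seq [RHS]big_seq; apply: eq_bigr => -[e N] aL /=.
  by have [_ iN _] := atomsP iL' aL; rewrite atom_projM // cmulZl.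
rewrite cmul_suml -sumrB; apply: eq_bigr => -[e N] _ /=.
by rewrite /atom_proj /= scalerBr cmulZl.
Qed.

Lemma atom_comb_comm L d f : {in L, forall g, idem g} -> idem f ->
  atom_comb L d ** pi f = pi f ** atom_comb L d.
Proof.
move=> iL jf; rewrite /atom_comb cmul_suml cmul_sumr big_seq [RHS]big_seq.
apply: eq_bigr => -[e N] aL; have [ie iN _] := atomsP iL aL.
by rewrite cmulZl cmulZr atom_proj_comm.
Qed.

(** This expresses orthogonality of the atoms without comparing entries of the list, which may
    repeat. *)
Lemma atom_combM L d d' : {in L, forall g, idem g} ->
  atom_comb L d ** atom_comb L d' = atom_comb L (fun a => d a * d' a).
Proof.
elim: L d d' => [|f L IH] d d' iL.
  rewrite /atom_comb /= !big_seq1 cmulZl cmulZr scalerA /atom_proj /= -piM.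
  by rewrite (mul1 one).1.
rewrite !atom_comb_cons //.
have iL' : {in L, forall g, idem g} by move=> g gL; apply: iL; rewrite in_cons gL orbT.
have jf : idem f by apply: iL; rewrite mem_head.
rewrite -!IH //; set x := atom_comb _ _; set x' := atom_comb _ _; set y := atom_comb _ _.
set y' := atom_comb _ _.
have ff (z : B) : z ** pi f ** pi f = z ** pi f by rewrite -cmulA -piM jf.
have cx : pi f ** y = y ** pi f by rewrite atom_comb_comm.
have cy : pi f ** y' = y' ** pi f by rewrite atom_comb_comm.
rewrite !(cmulDl, cmulDr, cmulBl, cmulBr) !cmulA.
rewrite -!(cmulA _ (pi f) y) -!(cmulA _ (pi f) y') cx cy !cmulA !ff.
by rewrite !subrr !addr0 addrAC subrr add0r.
Qed.

Lemma atom_comb_star L d : {in L, forall g, idem g} ->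
  (atom_comb L d)^† = atom_comb L (fun a => (d a)^*).
Proof.
have si f : idem f -> (pi f)^† = pi f by move=> jf; rewrite -piS sinv_idem.
elim: L d => [|f L IH] d iL.
  rewrite /atom_comb /= !big_seq1 cstarZ /atom_proj /= si //; exact: (mul1 one).1.
rewrite !atom_comb_cons //.
have iL' : {in L, forall g, idem g} by move=> g gL; apply: iL; rewrite in_cons gL orbT.
have jf : idem f by apply: iL; rewrite mem_head.
by rewrite cstarD cstarB !cstarM !IH // si // -!atom_comb_comm.
Qed.

Lemma atom_comb1 L : {in L, forall g, idem g} -> atom_comb L (fun=> 1) = pi one.
Proof.
elim: L => [|f L IH] iL; first by rewrite /atom_comb big_seq1 scale1r.
rewrite atom_comb_cons // IH; last by move=> g gL; apply: iL; rewrite in_cons gL orbT.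
by rewrite addrC subrK.
Qed.

(** Functional calculus is coefficientwise here: with [h = |d| ^ 2 / M ^ 2 <= 1], the coefficients
    [k = 1 - sqrt (1 - h ^ 2)] satisfy the relation of [norm_le1_unitary]. *)
Lemma atom_comb_norm L d (M : CC R) : {in L, forall g, idem g} -> 0 < M ->
  (forall a, a \in atoms L -> `|d a| <= M) -> `|atom_comb L d| <= M.
Proof.
move=> iL M0 dM.
pose h a : CC R := (M ^+ 2)^-1 * `|d a| ^+ 2.
pose k a : CC R := 1 - sqrtC (1 - h a ^+ 2).
have M2 : 0 < M ^+ 2 by rewrite exprn_gt0.
have h0 a : 0 <= h a by rewrite mulr_ge0 ?invr_ge0 ?exprn_ge0 // ltW.
have hr a : (h a)^* = h a by rewrite conj_Creal // ger0_real.
have h1 a : a \in atoms L -> h a <= 1.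
  move=> /dM le; rewrite /h mulrC ler_pdivrMr // mul1r.
  by rewrite ler_pXn2r ?nnegrE // ltW.
have eqd (d1 d2 : S * seq S -> CC R) : {in atoms L, d1 =1 d2} -> atom_comb L d1 = atom_comb L d2.
  by move=> E; rewrite /atom_comb big_seq [RHS]big_seq; apply: eq_bigr => a /E ->.
have : `|atom_comb L h| <= 1.
  apply: (@norm_le1_unitary _ _ _ (atom_comb L k)).
  - by rewrite atom_comb_star //; apply: eqd => a _; exact: hr.
  - rewrite atom_comb_star //; apply: eqd => a aL; rewrite /k rmorphB rmorph1.
    congr (_ - _); apply: conj_Creal; rewrite ger0_real // sqrtC_ge0 subr_ge0.
    by rewrite exprn_ile1 // h1.
  - by rewrite !atom_combM //; apply: eqd => a _; rewrite mulrC.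
  - have kk : atom_comb L (fun a => k a + k a - k a * k a) =
        atom_comb L k + atom_comb L k - atom_comb L k ** atom_comb L k.
      rewrite atom_combM // /atom_comb -big_split -sumrB; apply: eq_bigr => a _ /=.
      by rewrite scalerBl scalerDl.
    rewrite -kk atom_combM //; apply: eqd => a _.
    have := sqrtCK (1 - h a ^+ 2); rewrite /k; set q := sqrtC _ => E.
    have -> : 1 - q + (1 - q) - (1 - q) * (1 - q) = 1 - q ^+ 2 by ring.
    by rewrite E subKr expr2.
have -> : `|atom_comb L h| = (M ^+ 2)^-1 * `|atom_comb L d| ^+ 2.
  rewrite -cstar_norm atom_comb_star // atom_combM //.
  rewrite -[X in X * _]gtr0_norm ?invr_gt0 // -normrZ; congr `|_|.
  rewrite /atom_comb scaler_sumr; apply: eq_bigr => a _; rewrite scalerA /h.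
  by rewrite normCK [d a * _]mulrC.
rewrite mulrC ler_pdivrMr // mul1r.
by rewrite ler_pXn2r ?nnegrE // ltW.
Qed.

End Atoms.

(** * The bound by values at principal filters *)

Section RepBound.
Variables (R : realType) (S : invSemigroup0Type) (one : S) (B : cstarType R) (pi : S -> B).
Hypothesis mul1 : forall s, (one * s = s /\ s * one = s)%g.
Hypothesis hpi : isg_rep pi.
Implicit Types (e f s t : S) (L N F : seq S) (a : S * seq S) (w : seq (CC R * S)).

Let piM s t : pi (s * t)%g = pi s ** pi t. Proof. by case: hpi. Qed.
Let piS s : pi (sinv s) = (pi s)^†. Proof. by case: hpi. Qed.
Let pi0 : pi szero = 0. Proof. by case: hpi. Qed.
Local Notation atoms := (atoms one).
Local Notation atom_proj := (atom_proj pi).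
Local Notation acomb := (atom_comb one pi).

Definition rep_comb w : B := \sum_(p <- w) p.1 *: pi p.2.

Lemma rep_norm_le1 s : `|pi s| <= 1.
Proof.
have proj (p : B) : p ** p = p -> p^† = p -> `|p| <= 1.
  move=> pp ps; have [->|p0] := eqVneq p 0; first by rewrite normr0.
  have p1 : 0 < `|p| by rewrite normr_gt0.
  by rewrite -(ler_pM2r p1) mul1r -expr2 -cstar_norm ps pp.
rewrite -(@ler_pXn2r _ 2) ?nnegrE // expr1n -cstar_norm -piS -piM; apply: proj.
  by rewrite -piM idem_dom.
by rewrite -piS sinv_idem //; exact: idem_dom.
Qed.

Lemma atom_projK e N : idem e -> {in N, forall f, idem f} ->
  atom_proj (e, N) = pi e ** atom_proj (e, N).
Proof.
move=> ie iN; rewrite -(atom_proj_comm hpi ie ie iN).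
by rewrite (atom_proj_le hpi ie iN ie).
Qed.

(** The principal filter has the least element [e], so equality of germs over it is tested on [e]
    itself. *)
Lemma germ_comb_principal w e v (ie : idem e) (e0 : e <> szero)
    (vd : contains (principal ie e0) (dom_idem v)) : (v * e)%g = v ->
  germ_comb w (germ_of vd) =
  \sum_(p <- w | ((e * (sinv p.2 * p.2))%g == e) && ((p.2 * e)%g == v)) p.1.
Proof.
move=> ve; rewrite /germ_comb [RHS]big_mkcond; apply: eq_bigr => -[c s] _ /=.
case: ifPn => [/andP[es /eqP sv]|ns].
  have -> : germ_of vd = germ_of (es : contains (principal ie e0) (dom_idem s)).
    apply/germ_of_eq; split=> //; exists (idem_of ie); split.
      by rewrite contains_principal /= ie.
    by rewrite /= ve sv.
  by rewrite /germ_ind lift_of mulr1.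
rewrite /germ_ind lift_out ?mulr0 // => -[x [sx [_ /germ_of_eq [xE [f [fx E]]]]]].
move/negP: ns; apply; apply/andP; split.
  by move: sx; rewrite -xE.
move: fx; rewrite contains_principal => /eqP ef.
have -> : (s * e = s * (\val f * e))%g by rewrite -(idemC ie (idem_val f)) ef.
by rewrite mulgA -E -mulgA -(idemC ie (idem_val f)) ef ve.
Qed.

(* On the atom of [(e, N)] the operator is a combination of the [pi (t e)], [t] in
   [F], whose coefficients are values of the function at germs over the principal
   filter of [e]; a repeated [t e] is attributed to the first such [t]. *)
Lemma rep_comb_bound F w (eps : CC R) : comb_over F w -> 0 < eps ->
  (forall g, `|germ_comb w g| <= eps) -> `|rep_comb w| <= (size F)%:R * eps.
Proof.
move=> wF eps0 weps.
pose L := [seq (sinv p.2 * p.2)%g | p <- w].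
have iL : {in L, forall f, idem f} by move=> f /mapP [p _ ->]; exact: idem_dom.
pose idx e s := index (s * e)%g [seq (t * e)%g | t <- F].
(* Such atoms have projection 0. In particular [e = 0], where there is no principal filter, is set
   aside. *)
pose bad a := (a.1 == szero) || has (fun f => (a.1 * f)%g == a.1) a.2.
pose sel a (i : nat) (p : CC R * S) := ((a.1 * (sinv p.2 * p.2))%g == a.1) && (idx a.1 p.2 == i).
pose d (i : nat) a : CC R := if bad a then 0 else \sum_(p <- w | sel a i p) p.1.
have badP a : a \in atoms L -> bad a -> atom_proj a = 0.
  case: a => e N aL; have [/= ie iN _] := atomsP mul1 iL aL.
  rewrite atom_projK // => /orP[/eqP /= ->|/hasP [f fN /eqP /= ef]].
    by rewrite pi0 cmul0l.
  by rewrite -(atom_projK ie iN) -(atom_proj_le hpi (iN f fN) iN ef) (atom_proj_out hpi) //; exact: iN.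
have belowE e p : p \in w -> idem e -> (e * (sinv p.2 * p.2))%g = e ->
    exists2 t, t \in F & (p.2 * e = t * e)%g.
  move=> pw ie ep; have [t tF E] := wF p pw; exists t => //.
  by rewrite E -mulgA (idemC (idem_dom _) ie) ep.
have dle i a : a \in atoms L -> `|d i a| <= eps.
  move=> aL; have [ie iN _] := atomsP mul1 iL aL.
  rewrite /d; case: ifPn => [_|]; first by rewrite normr0 ltW.
  rewrite negb_or => /andP[/eqP e0 _].
  have [/hasP [p pw /andP[/eqP ep /eqP ip]]|no] := boolP (has (sel a i) w); last first.
    rewrite big_seq_cond big1 ?normr0 ?ltW // => p /andP[pw ps].
    by move/hasPn: no => /(_ p pw); rewrite ps.
  have vd : contains (principal ie e0) (dom_idem (p.2 * a.1)%g).
    rewrite contains_principal /= sinvM (sinv_idem ie).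
    have -> : (a.1 * sinv p.2 * (p.2 * a.1) = a.1 * (sinv p.2 * p.2) * a.1)%g by rewrite !mulgA.
    by rewrite ep !ie.
  have := weps (germ_of vd).
  rewrite (germ_comb_principal w) -?mulgA ?ie //; congr (`|_| <= _).
  rewrite big_seq_cond [RHS]big_seq_cond; apply: eq_bigl => q.
  have [qw|//] := boolP (q \in w); rewrite /sel /=; have [eq|//] := eqVneq.
  have mem (s : CC R * S) : s \in w -> (a.1 * (sinv s.2 * s.2))%g = a.1 ->
      (s.2 * a.1)%g \in [seq (t * a.1)%g | t <- F].
    by move=> sw es; have [t tF ->] := belowE _ _ sw ie es; apply/mapP; exists t.
  (* Equal first indices mean equal products with [a.1], so the selected terms are those seen by the
     germ of [p.2 * a.1]. *)
  rewrite -ip /idx; apply/eqP/eqP => [->//|E].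
  by rewrite -(nth_index szero (mem q qw eq)) E nth_index // mem.
have atomE a : a \in atoms L ->
    rep_comb w ** atom_proj a = \sum_(i < size F) d i a *: (pi (nth szero F i) ** atom_proj a).
  move=> aL; have [ba|nba] := boolP (bad a).
    rewrite badP // cmul0r big1 // => i _; by rewrite cmul0r scaler0.
  case: a aL nba => e N aL nba; have [/= ie iN eL] := atomsP mul1 iL aL.
  have pse s : pi s ** atom_proj (e, N) = pi (s * e)%g ** atom_proj (e, N).
    by rewrite piM -cmulA -atom_projK.
  rewrite /rep_comb cmul_suml (eq_bigr (fun i : 'I_(size F) =>
     \sum_(p <- w) (if sel (e, N) i p then p.1 *: (pi (nth szero F i) ** atom_proj (e, N)) else 0))).
    rewrite exchange_big /= big_seq [RHS]big_seq; apply: eq_bigr => p pw.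
    rewrite cmulZl /sel /=; have [ep|nep] := eqVneq; last first.
      rewrite big1 //=.
      (* An atom not below the domain of [p.2] excludes this domain, so [pi p.2] annihilates it. *)
      have [/= E|pN] := eL (sinv p.2 * p.2)%g (map_f _ pw); first by rewrite E eqxx in nep.
      rewrite -[p.2]mul_sinvK -mulgA piM -cmulA.
      have jp := @idem_dom _ p.2.
      by rewrite -(atom_proj_comm hpi ie jp iN) (atom_proj_out hpi e jp iN pN) cmul0r scaler0.
    have mem : (p.2 * e)%g \in [seq (t * e)%g | t <- F].
      by have [t tF ->] := belowE _ _ pw ie ep; apply/mapP; exists t.
    have ltF : (idx e p.2 < size F)%N by rewrite -(size_map (fun t => (t * e)%g)) index_mem.
    rewrite (bigD1 (Ordinal ltF)) //= eqxx big1 ?addr0; last first.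
      by move=> i; rewrite eq_sym -val_eqE /= => /negbTE ->.
    congr (_ *: _); rewrite pse [RHS]pse; congr (pi _ ** _).
    by rewrite -[LHS](nth_index szero mem) (nth_map szero).
  move=> i _; rewrite -big_mkcond /= /d (negbTE nba) scaler_suml //.
(* Summing over the atoms, which add up to [pi one], leaves one contraction times one diagonal
   combination for each element of [F]. *)
have -> : rep_comb w = \sum_(i < size F) pi (nth szero F i) ** acomb L (d i).
  have -> : rep_comb w = rep_comb w ** acomb L (fun=> 1).
    rewrite (atom_comb1 mul1 hpi iL) /rep_comb cmul_suml; apply: eq_bigr => p _.
    by rewrite cmulZl -piM (mul1 _).2.
  rewrite /atom_comb cmul_sumr big_seq.
  rewrite (eq_bigr (fun a => \sum_(i < size F) d i a *: (pi (nth szero F i) ** atom_proj a))).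
    rewrite -big_seq exchange_big /=; apply: eq_bigr => i _; rewrite cmul_sumr.
    by apply: eq_bigr => a _; rewrite cmulZr.
  by move=> a aL; rewrite scale1r atomE.
rewrite (le_trans (ler_norm_sum _ _ _)) //.
rewrite (le_trans (ler_sum _ (_ : forall i : 'I_(size F), true -> _ <= eps))) //.
  move=> i _; rewrite (le_trans (cmul_norm _ _)) //.
  rewrite -[leRHS]mul1r ler_pM ?rep_norm_le1 //.
  by apply: (atom_comb_norm mul1 hpi iL eps0) => a; exact: dle.
by rewrite sumr_const card_ord mulr_natl.
Qed.

End RepBound.

(** * The natural partial order under inverse and product *)

Section NaturalOrder.
Local Open Scope group_scope.
Variable S : invSemigroup0Type.
Implicit Types s t q : S.

Lemma restriction_dom s t : s = t * (sinv s * s) ->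
  (sinv s * s) * (sinv t * t) = sinv s * s.
Proof.
move=> E; have iq := idem_dom s; set q := sinv s * s in E iq *.
have h : sinv (t * q) * (t * q) = q * (sinv t * t).
  by rewrite sinvM (sinv_idem iq) -(idem_mulK iq (idem_dom t)) !mulgA.
by rewrite -h -E.
Qed.

Lemma restriction_sinv s t : s = t * (sinv s * s) -> sinv s = sinv t * (s * sinv s).
Proof.
move=> E; have iq := idem_dom s; have sq := mul_sinvK s; rewrite -mulgA in sq.
move: (sinv s * s) E iq sq => q E iq sq.
have sE : sinv s = q * sinv t by rewrite {1}E sinvM (sinv_idem iq).
have -> : s * sinv s = t * q * sinv t by rewrite sE mulgA sq {1}E.
by rewrite sE !mulgA (idemC (idem_dom t) iq) -[RHS]mulgA sinv_mulK.
Qed.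

Lemma restriction_mul t t' q q' : idem q ->
  (t * q) * (t' * q') = (t * t') * ((sinv t' * q * t') * q').
Proof.
move=> iq; have -> : t * t' * (sinv t' * q * t' * q') = t * (t' * sinv t' * q) * t' * q'.
  by rewrite !mulgA.
rewrite (idemC (idem_cod t') iq).
have -> : t * (q * (t' * sinv t')) * t' * q' = t * q * (t' * sinv t' * t') * q'.
  by rewrite !mulgA.
by rewrite mul_sinvK !mulgA.
Qed.

End NaturalOrder.

(** * Finite fibres of unions of bisections *)

Section ConvolutionBounds.
Variables (R : realType) (S : invSemigroup0Type).
Implicit Types (s t : S) (g h b : germ S) (w : seq (CC R * S)) (F : seq S) (e : S).
Local Notation G := (universal_groupoid S).
Local Notation conv := (@Defs.conv R G).
Local Notation finvol := (@Defs.finvol R G).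
Local Notation ind := (@germ_ind R S).

Definition in_bisections F g := exists2 t, t \in F & Theta t (source t) g.

(** Each bisection contributes at most one arrow, by [Theta_cod_inj]. *)
Lemma bisections_fiber F g : exists r : seq (germ S),
  [/\ uniq r, (size r <= size F)%N, forall b, b \in r -> germ_cod b = germ_cod g &
      forall b, germ_cod b = germ_cod g -> in_bisections F b -> b \in r].
Proof.
elim: F => [|t F [r [ur sr rg rF]]]; first by exists [::]; split=> // b _ [].
have [[b0 [tb0 b0g]]|no] := pselect (exists b, Theta t (source t) b /\ germ_cod b = germ_cod g);
  last first.
  exists r; split=> //; first exact: leq_trans sr _.
  move=> b bg [t']; rewrite in_cons => /orP[/eqP ->|t'F] tb; last by apply: rF => //; exists t'.
  by case: no; exists b.
have inr b : germ_cod b = germ_cod g -> in_bisections (t :: F) b -> b = b0 \/ b \in r.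
  move=> bg [t']; rewrite in_cons => /orP[/eqP ->|t'F] tb.
    by left; apply: Theta_cod_inj tb tb0 _; rewrite bg b0g.
  by right; apply: rF => //; exists t'.
have [b0r|nb0r] := boolP (b0 \in r).
  exists r; split=> //; first exact: leq_trans sr _.
  by move=> b bg /(inr b bg) [->|].
exists (b0 :: r); split=> //=; first by rewrite nb0r.
  by move=> b; rewrite in_cons => /orP[/eqP ->|/rg].
by move=> b bg /(inr b bg) [->|br]; rewrite in_cons ?eqxx // br orbT.
Qed.

(** One list serves all functions carried by [F], so two convolutions can be compared term by
    term. *)
Lemma conv_fiber F g : exists r : seq (germ S), (size r <= size F)%N /\
  forall u v : germ S -> CC R, (forall b, ~ in_bisections F b -> u b = 0) ->
    conv u v g = \sum_(b <- r) u b * v (germ_mul (germ_inv b) g).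
Proof.
have [r [ur sr rg rF]] := bisections_fiber F g; exists r; split=> // u v u0.
apply: conv_seq => // b bg nb; apply: u0 => bF.
by move/negP: nb; apply; exact: rF.
Qed.

Lemma germ_ind_out s g : ~ Theta s (source s) g -> ind s g = 0.
Proof. exact: lift_out. Qed.

Lemma germ_ind_norm s g : `|ind s g| <= 1.
Proof. by rewrite /germ_ind /germ_lift; case: ifP; rewrite ?normr1 ?normr0. Qed.

Lemma below_Theta F s g : below F s -> Theta s (source s) g -> in_bisections F g.
Proof.
move=> [t tF E] [x [sx [_ ->]]]; exists t => //.
have tx : source t x.
  by apply: contains_le sx _; exact: restriction_dom.
exists x, tx; split=> //; apply/germ_of_eq; split=> //.
by exists (dom_idem s); split; [exact: sx|rewrite /= -E mulgA mul_sinvK].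
Qed.

Lemma germ_comb_out F w g : comb_over F w -> ~ in_bisections F g -> germ_comb w g = 0.
Proof.
move=> wF ng; rewrite /germ_comb big_seq big1 // => p pw; rewrite germ_ind_out ?mulr0 //.
by move=> /(below_Theta (wF p pw)).
Qed.

Lemma below_idem F t e : t \in F -> idem e -> below F (t * e)%g.
Proof.
move=> tF ie; have [t' + E] := below_mul_idem t (idem_of ie).
by rewrite inE => /eqP tE; exists t => //; rewrite {1}E tE.
Qed.

Lemma comb_over_self w : comb_over (map snd w) w.
Proof. by move=> p pw; exists p.2; [exact: map_f|rewrite mulgA mul_sinvK]. Qed.

Lemma germ_comb_bounded w : exists2 M : CC R, 0 < M & forall g, `|germ_comb w g| <= M.
Proof.
exists (1 + \sum_(p <- w) `|p.1|); first by rewrite ltr_pwDl // sumr_ge0 // => p _.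
move=> g; rewrite /germ_comb (le_trans (ler_norm_sum _ _ _)) // ler_wpDl //.
apply: ler_sum => p _; rewrite normrM -[leRHS]mulr1 ler_wpM2l //.
exact: germ_ind_norm.
Qed.

Definition comb_mul w w' := [seq (p.1 * q.1, (p.2 * q.2)%g) | p <- w, q <- w'].

Definition comb_star w := [seq (p.1^*, sinv p.2) | p : CC R * S <- w].

Definition comb_scale (k : CC R) w := [seq (k * p.1, p.2) | p <- w].

Lemma conv_germ_comb w w' : conv (germ_comb w) (germ_comb w') = germ_comb (comb_mul w w').
Proof.
apply/funext => g; have [r [_ rE]] := conv_fiber (map snd w) g.
rewrite rE => [|b]; last exact/germ_comb_out/comb_over_self.
rewrite /germ_comb /comb_mul big_allpairs_dep /=.
rewrite (eq_bigr (fun b => \sum_(p <- w) \sum_(q <- w')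
   p.1 * q.1 * (ind p.2 b * ind q.2 (germ_mul (germ_inv b) g)))) => [|b _]; last first.
  rewrite mulr_suml; apply: eq_bigr => p _; rewrite mulr_sumr; apply: eq_bigr => q _.
  by rewrite mulrACA.
rewrite exchange_big /= big_seq [RHS]big_seq; apply: eq_bigr => p pw.
rewrite exchange_big /=; apply: eq_bigr => q _; rewrite -mulr_sumr -conv_ind rE //.
move=> b nb; apply: germ_ind_out => pb; apply: nb; exists p.2 => //; exact: map_f.
Qed.

Lemma finvol_germ_comb w : finvol (germ_comb w) = germ_comb (comb_star w).
Proof.
apply/funext => g; rewrite /Defs.finvol /germ_comb big_map rmorph_sum; apply: eq_bigr => p _.
by rewrite rmorphM -finvol_ind.
Qed.

Lemma germ_comb_scale k w g : germ_comb (comb_scale k w) g = k * germ_comb w g.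
Proof. by rewrite /germ_comb big_map mulr_sumr; apply: eq_bigr => p _; rewrite mulrA. Qed.

Lemma comb_over_scale F k w : comb_over F w -> comb_over F (comb_scale k w).
Proof. by move=> wF _ /mapP [p /wF ? ->]. Qed.

Lemma comb_over_star F w : comb_over F w -> comb_over (map sinv F) (comb_star w).
Proof.
move=> wF _ /mapP [p /wF [t tF E] ->] /=; set s := p.2 in E *.
rewrite (restriction_sinv E).
by apply: below_idem; [exact: map_f|exact: idem_cod].
Qed.

Lemma comb_over_mul F E w w' : comb_over F w -> comb_over E w' ->
  comb_over [seq (s * t)%g | s <- F, t <- E] (comb_mul w w').
Proof.
move=> wF wE _ /allpairsP [[p q] /= [/wF [t tF E1] /wE [t' tE E2] ->]] /=.
set s := p.2 in E1 *; set s' := q.2 in E2 *.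
rewrite E1 E2 restriction_mul; last exact: idem_dom.
apply: below_idem; first by apply/allpairsP; exists (t, t').
apply: idemM; last exact: idem_dom.
by have := idem_conj (sinv t') (idem_dom s); rewrite sinvK.
Qed.

End ConvolutionBounds.

(** * Extension of a representation to [Cc] *)

Section RepExtension.
Variables (R : realType) (S : invSemigroup0Type) (one : S) (B : cstarType R) (pi : S -> B).
Hypothesis mul1 : forall s, (one * s = s /\ s * one = s)%g.
Hypothesis hpi : isg_rep pi.
Implicit Types (s t : S) (g b : germ S) (w : seq (CC R * S)) (F : seq S).
Implicit Types (f h : germ S -> CC R) (x y : B).
Local Notation G := (universal_groupoid S).
Local Notation conv := (@Defs.conv R G).
Local Notation finvol := (@Defs.finvol R G).
Local Notation rcomb := (rep_comb pi).

Let piM s t : pi (s * t)%g = pi s ** pi t. Proof. by case: hpi. Qed.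
Let piS s : pi (sinv s) = (pi s)^†. Proof. by case: hpi. Qed.

Lemma rep_comb_cat w w' : rcomb (w ++ w') = rcomb w + rcomb w'.
Proof. exact: big_cat. Qed.

Lemma rep_comb_scale k w : rcomb (comb_scale k w) = k *: rcomb w.
Proof.
rewrite /rep_comb big_map scaler_sumr; apply: eq_bigr => p _.
by rewrite scalerA.
Qed.

Lemma rep_comb_star w : rcomb (comb_star w) = (rcomb w)^†.
Proof.
rewrite /rep_comb big_map cstar_sum; apply: eq_bigr => p _.
by rewrite cstarZ piS.
Qed.

Lemma rep_comb_mul w w' : rcomb (comb_mul w w') = rcomb w ** rcomb w'.
Proof.
rewrite /rep_comb big_allpairs_dep cmul_suml; apply: eq_bigr => p _.
rewrite cmul_sumr; apply: eq_bigr => q _ /=.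
by rewrite cmulZl cmulZr scalerA piM.
Qed.

(* [x] is the value at [f] of the extension of [pi] by continuity with respect
   to uniform convergence on finite unions of bisections. *)
Definition rep_limit f x := exists F, forall eps, 0 < eps -> exists w,
  [/\ comb_over F w, forall g, `|f g - germ_comb w g| <= eps & `|x - rcomb w| <= eps].

Lemma rep_comb_close F w w' (d e : CC R) f : comb_over F w -> comb_over F w' ->
  0 < d -> 0 < e -> (forall g, `|f g - germ_comb w g| <= d) ->
  (forall g, `|f g - germ_comb w' g| <= e) ->
  `|rcomb w - rcomb w'| <= (size F)%:R * (d + e).
Proof.
move=> wF wF' d0 e0 fw fw'.
have -> : rcomb w - rcomb w' = rcomb (w ++ comb_scale (-1) w').
  by rewrite rep_comb_cat rep_comb_scale scaleN1r.
apply: (rep_comb_bound mul1 hpi); last first.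
- move=> g; rewrite germ_comb_cat germ_comb_scale mulN1r.
  rewrite -(subrKA (f g)) (le_trans (ler_normD _ _)) // lerD //.
  by rewrite distrC.
- by rewrite addr_gt0.
- by apply: comb_over_cat => //; exact: comb_over_scale.
Qed.

Lemma rep_limit_uniq f x y : rep_limit f x -> rep_limit f y -> x = y.
Proof.
move=> [F Fx] [E Ey]; apply/eqP; rewrite -subr_eq0; apply/eqP.
apply: (@eps_eq0 _ B (2%:R + (size (F ++ E))%:R *+ 2)) => [|e e0].
  by rewrite ltr_pwDl // mulrn_wge0.
have [w [wF fw xw]] := Fx _ e0; have [w' [wE fw' yw']] := Ey _ e0.
have wF' : comb_over (F ++ E) w by apply: comb_over_sub wF => t tF; rewrite mem_cat tF.
have wE' : comb_over (F ++ E) w' by apply: comb_over_sub wE => t tF; rewrite mem_cat tF orbT.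
have -> : x - y = (x - rcomb w) + (rcomb w - rcomb w') - (y - rcomb w').
  by rewrite subrKA opprB subrKA.
rewrite (le_trans (ler_normB _ _)) // (le_trans (lerD (ler_normD _ _) (lexx _))) //.
have -> : (2%:R + (size (F ++ E))%:R *+ 2) * e = e + (size (F ++ E))%:R * (e + e) + e by ring.
by rewrite !lerD // (rep_comb_close wF' wE' e0 e0 fw fw').
Qed.

Lemma rep_limit_exists F f : lift_sum F f -> exists x, rep_limit f x.
Proof.
(* The added 1 keeps the constant positive when [F] is empty. *)
move=> fF; pose M : CC R := (size F)%:R + 1.
have M0 : 0 < M by rewrite ltr_wpDl.
pose Q (e : CC R) x := exists w, [/\ comb_over F w, forall g, `|f g - germ_comb w g| <= e & x = rcomb w].
have [e e0|d e x y d0 e0 [w [wF fw ->]] [w' [wF' fw' ->]]|x xP] := @complete_approx R B Q M M0.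
- by have [w [wF fw]] := lift_sum_approx fF e0; exists (rcomb w), w.
- rewrite (le_trans (rep_comb_close wF wF' d0 e0 fw fw')) //.
  by rewrite ler_wpM2r ?(addr_ge0 (ltW d0) (ltW e0)) // /M lerDl.
exists x, F => e e0.
have M1 : 1 <= M by rewrite lerDr.
have e1 : 0 < e / (M * 3%:R) by rewrite divr_gt0 // mulr_gt0.
have [w [wF fw]] := lift_sum_approx fF e1; exists w; split=> //.
  move=> g; rewrite (le_trans (fw g)) // ler_pdivrMr ?mulr_gt0 // ler_peMr ?(ltW e0) //.
  by rewrite mulr_ege1 // ler1n.
have Qw : Q (e / (M * 3%:R)) (rcomb w) by exists w.
rewrite distrC; apply: le_trans (xP _ _ e1 Qw) _.
by have -> : M * (e / (M * 3%:R) *+ 3) = e by field; rewrite gt_eqF.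
Qed.

Lemma rep_limit_comb w : rep_limit (germ_comb w) (rcomb w).
Proof.
exists (map snd w) => e e0; exists w; split; first exact: comb_over_self.
  by move=> g; rewrite subrr normr0 ltW.
by rewrite subrr normr0 ltW.
Qed.

Lemma rep_limit_linear k f h x y : rep_limit f x -> rep_limit h y ->
  rep_limit (fun g => k * f g + h g) (k *: x + y).
Proof.
move=> [F Fx] [E Ey]; exists (F ++ E) => e e0.
have K0 : 0 < `|k| + 1 by rewrite ltr_wpDl.
have e1 : 0 < e / (`|k| + 1) by rewrite divr_gt0.
have eE : e = `|k| * (e / (`|k| + 1)) + e / (`|k| + 1) by field; rewrite gt_eqF.
have [w [wF fw xw]] := Fx _ e1; have [w' [wE hw yw]] := Ey _ e1.
exists (comb_scale k w ++ w'); split.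
- apply: comb_over_cat.
    by apply/comb_over_scale/(comb_over_sub _ wF) => t tF; rewrite mem_cat tF.
  by apply: comb_over_sub wE => t tF; rewrite mem_cat tF orbT.
- move=> g; rewrite germ_comb_cat germ_comb_scale opprD addrACA -mulrBr.
  rewrite (le_trans (ler_normD _ _)) // [leRHS]eE lerD // normrM ler_wpM2l //.
- rewrite rep_comb_cat rep_comb_scale opprD addrACA -scalerBr.
  by rewrite (le_trans (ler_normD _ _)) // [leRHS]eE lerD // normrZ ler_wpM2l.
Qed.

Lemma rep_limit_star f x : rep_limit f x -> rep_limit (finvol f) (x^†).
Proof.
move=> [F Fx]; exists (map sinv F) => e e0; have [w [wF fw xw]] := Fx _ e0.
exists (comb_star w); split; first exact: comb_over_star.
  by move=> g; rewrite -finvol_germ_comb /Defs.finvol -rmorphB norm_conjC.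
by rewrite rep_comb_star -cstarB norm_cstar.
Qed.

Lemma rep_limit_bounded f x : rep_limit f x ->
  exists2 M : CC R, 0 < M & forall g, `|f g| <= M.
Proof.
move=> [F Fx]; have [w [_ fw _]] := Fx 1 ltr01; have [M M0 wM] := germ_comb_bounded w.
exists (1 + M); first by rewrite addr_gt0.
by move=> g; rewrite -(subrK (germ_comb w g) (f g)) (le_trans (ler_normD _ _)) // lerD.
Qed.

Lemma rep_limit_mul f h x y : rep_limit f x -> rep_limit h y ->
  rep_limit (conv f h) (x ** y).
Proof.
move=> fx hy; have [Mf Mf0 fM] := rep_limit_bounded fx; have [Mh Mh0 hM] := rep_limit_bounded hy.
move: fx hy => [F Fx] [E Ey]; exists [seq (s * t)%g | s <- F, t <- E] => e e0.
(* The first summand bounds the error of the convolution, with at most [size F] terms in a fibre;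
   the second bounds that of the product in [B]. *)
pose K : CC R := (size F)%:R * (Mh + (Mf + 1)) + (`|y| + (`|x| + 1)).
have K0 : 0 < K.
  have M1 : 0 < Mh + (Mf + 1) by rewrite !addr_gt0.
  have x1 : 0 < `|y| + (`|x| + 1) by rewrite ltr_wpDl // ltr_wpDl.
  by rewrite /K ltr_wpDl // mulr_ge0 // ltW.
(* This gives both [K * d <= e] and [d <= 1]; the latter bounds the approximants by [Mf + 1] and
   [|x| + 1]. *)
pose d := e / (K + e).
have Ke0 : 0 < K + e by rewrite addr_gt0.
have d0 : 0 < d by rewrite divr_gt0.
have d1 : d <= 1 by rewrite ler_pdivrMr // mul1r lerDr ltW.
have Kd : K * d <= e by rewrite /d mulrCA ler_piMr ?(ltW e0) // ler_pdivrMr // mul1r lerDl ltW.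
have [w [wF fw xw]] := Fx _ d0; have [w' [wE hw yw]] := Ey _ d0.
have Kd1 : (size F)%:R * (Mh + (Mf + 1)) * d <= e.
  by apply: le_trans Kd; rewrite ler_wpM2r ?(ltW d0) // lerDl !addr_ge0.
have Kd2 : (`|y| + (`|x| + 1)) * d <= e.
  apply: le_trans Kd; rewrite ler_wpM2r ?(ltW d0) // lerDr mulr_ge0 //.
  by rewrite !addr_ge0 // ltW.
exists (comb_mul w w'); split; first exact: comb_over_mul.
(* As a uniform limit of combinations over [F], [f] also vanishes off these bisections. *)
- have f0 b : ~ in_bisections F b -> f b = 0.
    move=> nb; apply: (@eps_eq0 _ (CC R) 1) => // eps eps0; rewrite mul1r.
    have [w1 [w1F fw1 _]] := Fx _ eps0.
    by have := fw1 b; rewrite (germ_comb_out w1F nb) subr0.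
  move=> g; rewrite -conv_germ_comb.
  have [r [sr rE]] := conv_fiber R F g.
  rewrite !rE //; last by move=> b; exact: germ_comb_out.
  rewrite -sumrB (le_trans (ler_norm_sum _ _ _)) //.
  rewrite (le_trans (ler_sum _ (_ : forall b, true -> _ <= (Mh + (Mf + 1)) * d))) //.
    move=> b _; set b' := germ_mul _ _.
    have -> : f b * h b' - germ_comb w b * germ_comb w' b' =
       (f b - germ_comb w b) * h b' + germ_comb w b * (h b' - germ_comb w' b').
      by ring.
    rewrite (le_trans (ler_normD _ _)) // [leRHS]mulrDl lerD // normrM.
      by rewrite mulrC ler_pM.
    rewrite ler_pM // -(subrK (f b) (germ_comb w b)) addrC (le_trans (ler_normD _ _)) // lerD //.
    by rewrite distrC (le_trans (fw b)).
  rewrite (le_trans _ Kd1) // big_const_seq iter_addr_0 count_predT -[leLHS]mulr_natl -mulrA ler_wpM2r //.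
    by rewrite mulr_ge0 ?(ltW d0) // !addr_ge0 // ltW.
  by rewrite ler_nat.
- rewrite rep_comb_mul (le_trans _ Kd2) //.
  have -> : x ** y - rcomb w ** rcomb w' =
     (x - rcomb w) ** y + rcomb w ** (y - rcomb w').
    by rewrite cmulBl cmulBr addrA subrK.
  rewrite (le_trans (ler_normD _ _)) // [leRHS]mulrDl lerD //.
    by rewrite (le_trans (cmul_norm _ _)) // mulrC ler_wpM2l.
  rewrite (le_trans (cmul_norm _ _)) // ler_pM //.
  rewrite -(subrK x (rcomb w)) addrC (le_trans (ler_normD _ _)) // lerD //.
  by rewrite distrC (le_trans xw).
Qed.

Definition rep_ext f : B := xget 0 [set x | rep_limit f x].

Lemma rep_extE f x : rep_limit f x -> rep_ext f = x.
Proof.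
move=> fx; apply: rep_limit_uniq (fx).
by apply: (@xgetPex _ 0 [set y | rep_limit f y]); exists x.
Qed.

Lemma rep_ext_comb w : rep_ext (germ_comb w) = rcomb w.
Proof. exact/rep_extE/rep_limit_comb. Qed.

Lemma rep_ext_Cc : @Cc_rep R G B rep_ext.
Proof.
have ex f : @Cc R G f -> exists x, rep_limit f x.
  by move=> /Cc_lift_sum [F]; exact: rep_limit_exists.
split=> [k f h /ex [x fx] /ex [y hy]|f h /ex [x fx] /ex [y hy]|f /ex [x fx]].
- by rewrite (rep_extE fx) (rep_extE hy); apply: rep_extE; exact: rep_limit_linear.
- by rewrite (rep_extE fx) (rep_extE hy); apply: rep_extE; exact: rep_limit_mul.
- by rewrite (rep_extE fx); apply: rep_extE; exact: rep_limit_star.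
Qed.

End RepExtension.

(** * Automatic continuity of representations of [Cc] *)

Section LiftNorm.
Variables (R : realType) (S : invSemigroup0Type) (C : cstarType R).
Variable iota : (germ S -> CC R) -> C.
Local Notation filt := (filt S).
Local Notation G := (universal_groupoid S).
Local Notation conv := (@Defs.conv R G).
Local Notation finvol := (@Defs.finvol R G).
Local Notation lift := (@germ_lift R S).
Local Notation ind := (@germ_ind R S).
Hypothesis hi : @Cc_rep R G C iota.
Implicit Types (s t : S) (x y z : filt) (e : idemType S) (phi psi : filt -> CC R).

(** Membership in [alpha t z] becomes membership of one fixed idempotent in [z], whence [alpha t] is
    continuous. *)
Lemma contains_alphaE t z e : source t z ->
  contains (alpha t z) e =
  contains z (idem_of (idem_conj (sinv t) (idem_val e))).
Proof.
move=> tz; apply/idP/idP.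
  move=> /(contains_alpha _ tz) [f [zf fe]]; apply: contains_le (contains_mul tz zf) _.
  rewrite /idem_le /= sinvK in fe *.
  have -> : (sinv t * t * \val f * (sinv t * \val e * t)
     = sinv t * (t * \val f * sinv t * \val e) * t)%g by rewrite !mulgA.
  rewrite fe.
  have -> : (sinv t * (t * \val f * sinv t) * t = (sinv t * t) * (\val f * (sinv t * t)))%g.
    by rewrite !mulgA.
  by rewrite (idemC (idem_val f) (idem_dom t)) mulgA idem_dom.
move=> zf; apply/(contains_alpha _ tz); eexists; split; first exact: zf.
rewrite /idem_le /= sinvK.
have -> : (t * (sinv t * \val e * t) * sinv t = (t * sinv t) * (\val e * (t * sinv t)))%g.
  by rewrite !mulgA.
rewrite (idemC (idem_val e) (idem_cod t)) mulgA idem_cod.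
by rewrite -[LHS]mulgA idem_val.
Qed.

Lemma alpha_continuous t x : source t x -> alpha t @ x --> alpha t x.
Proof.
move=> tx; apply: filt_cvg => [|e]; first exact: (@fmap_filter _ _ _ _ (@nbhs_filter _ x)).
have h : nbhs x ([set z | contains z (idem_of (idem_conj (sinv t) (idem_val e))) =
   contains x (idem_of (idem_conj (sinv t) (idem_val e)))] `&` source t).
  apply: open_nbhs_nbhs; split=> //.
  by apply: openI; [exact: contains_open|exact: source_open].
by apply: filterS h => z [/= zE tz]; rewrite !contains_alphaE.
Qed.

Lemma Cc_finvol_lift s phi : continuous phi -> @Cc R G (finvol (lift s phi)).
Proof.
move=> cphi; rewrite finvol_lift.
(* [alpha (sinv s)] is meaningless outside the source of [sinv s]; as this set is open and closed,
   extension by 0 stays continuous. *)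
pose psi x := if contains x (dom_idem (sinv s)) then (phi (alpha (sinv s) x))^* else 0.
rewrite (@lift_ext _ _ _ _ psi); last by move=> x sx; rewrite /psi (sx : is_true _).
apply: Cc_lift => x; have near_s : nbhs x [set z | contains z (dom_idem (sinv s)) = contains x (dom_idem (sinv s))].
  by apply: open_nbhs_nbhs; split=> //; exact: contains_open.
have [sx|nsx] := boolP (contains x (dom_idem (sinv s))); last first.
  move=> N /=; rewrite /psi (negbTE nsx) => N0; apply: filterS near_s => z /= ->.
  by rewrite (negbTE nsx); exact: nbhs_singleton.
move=> N; rewrite /= {1}/psi sx => /nbhs_ballP [eps eps0 epsN].
have hb := @nbhsx_ballx (CC R) (CC R) (phi (alpha (sinv s) x)) _ eps0.
move: hb; set N1 := ball _ _ => hb.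
have := cphi (alpha (sinv s) x) N1 hb; rewrite nbhs_simpl => hb1.
have := @alpha_continuous (sinv s) x sx _ hb1; rewrite nbhs_simpl => hc.
apply: filterS (filterI near_s hc) => z [/= zs zb]; apply: epsN.
rewrite /psi zs sx; move: zb; rewrite /N1 -!ball_normE /=.
by rewrite -rmorphB norm_conjC.
Qed.

(** For [a, b >= 0] one has [|sqrt a - sqrt b| ^ 2 <= |a - b|], so the radius [eps ^ 2] for [h]
    gives [eps] for its root. *)
Lemma sqrtC_continuous (h : filt -> CC R) : continuous h -> (forall x, 0 <= h x) ->
  continuous (fun x => sqrtC (h x)).
Proof.
move=> ch h0 x N; rewrite /= => /nbhs_ballP [eps eps0 epsN].
have e2 : 0 < eps ^+ 2 by rewrite exprn_gt0.
have /ch := @nbhsx_ballx (CC R) (CC R) (h x) _ e2.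
rewrite nbhs_simpl => hx; apply: (@filterS _ _ (@nbhs_filter _ x) _ _ _ hx) => z zb; apply: epsN.
move: zb; rewrite -!ball_normE /= => zb.
have sub (a b : CC R) : 0 <= a -> 0 <= b -> b <= a -> `|sqrtC a - sqrtC b| ^+ 2 <= `|a - b|.
  move=> a0 b0 ba; have sab : sqrtC b <= sqrtC a by rewrite ler_sqrtC.
  rewrite !ger0_norm ?subr_ge0 // -{2}(sqrtCK a) -{2}(sqrtCK b) subr_sqr expr2.
  rewrite ler_wpM2l ?subr_ge0 // lerD2l (@le_trans _ _ 0) ?oppr_le0 ?sqrtC_ge0 //.
have le2 : `|sqrtC (h x) - sqrtC (h z)| ^+ 2 <= `|h x - h z|.
  have [le|le] := orP (real_leVge (ger0_real (h0 x)) (ger0_real (h0 z))).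
    by rewrite distrC [leRHS]distrC; exact: sub.
  exact: sub.
have : `|sqrtC (h x) - sqrtC (h z)| ^+ 2 < eps ^+ 2 by exact: le_lt_trans le2 zb.
by rewrite ltr_pXn2r ?nnegrE // ltW.
Qed.

Let iotaD k f h : @Cc R G f -> @Cc R G h -> iota (fun g => k * f g + h g) = k *: iota f + iota h.
Proof. by case: hi => L _ _; exact: L. Qed.

Let iotaM f h : @Cc R G f -> @Cc R G h -> iota (conv f h) = iota f ** iota h.
Proof. by case: hi => _ M _; exact: M. Qed.

Let iotaS f : @Cc R G f -> iota (finvol f) = (iota f)^†.
Proof. by case: hi => _ _ St; exact: St. Qed.

Lemma iota0 : iota (fun=> 0) = 0.
Proof.
have := iotaD (-1) (@Cc0 R S) (@Cc0 R S); rewrite scaleN1r addNr.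
by rewrite [X in iota X](_ : _ = fun=> 0) //; apply/funext => g; rewrite mulr0 addr0.
Qed.

Lemma iota_lift_linear s k phi psi : continuous phi -> continuous psi ->
  iota (lift s (fun x => k * phi x + psi x)) = k *: iota (lift s phi) + iota (lift s psi).
Proof.
move=> cphi cpsi; rewrite -iotaD; [|exact: Cc_lift|exact: Cc_lift].
by congr iota; apply/funext => g; rewrite liftD liftZ.
Qed.

Lemma continuous_const (k : CC R) : continuous ((fun=> k) : filt -> CC R).
Proof. exact: (@cst_continuous filt (CC R)). Qed.

Lemma continuous_mul phi psi : continuous phi -> continuous psi ->
  continuous (fun x => phi x * psi x).
Proof. by move=> cphi cpsi x; apply: cvgM; [exact: (@nbhs_filter _ x)|exact: cphi|exact: cpsi]. Qed.

Lemma continuous_lincomb k phi psi : continuous phi -> continuous psi ->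
  continuous (fun x => k * phi x + psi x).
Proof.
move=> cphi cpsi x; have c1 := @continuous_mul _ _ (@continuous_const k) cphi.
exact: (@cvgD _ _ _ _ (@nbhs_filter _ x) _ _ _ _ (c1 x) (cpsi x)).
Qed.

Lemma continuous_norm phi : continuous phi -> continuous (fun x => `|phi x|).
Proof. move=> cphi x; exact: (@cvg_norm _ _ _ _ (@nbhs_filter _ x) _ _ (cphi x)). Qed.

Lemma dom_idem_dom s : dom_idem (sinv s * s)%g = dom_idem s.
Proof.
apply: val_inj; rewrite /= (sinv_idem (idem_dom s)); exact: idem_dom.
Qed.

Lemma source_dom s : source (sinv s * s)%g = source s.
Proof. by rewrite /source dom_idem_dom. Qed.

Lemma alpha_dom s x : source s x -> alpha (sinv s * s)%g x = x.
Proof. by move=> sx; exact: (@alpha_idem _ (dom_idem s)). Qed.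

Lemma conv_lift_dom s phi psi :
  conv (lift (sinv s * s)%g phi) (lift (sinv s * s)%g psi) =
  lift (sinv s * s)%g (fun x => phi x * psi x).
Proof.
rewrite conv_lift idem_dom; apply: lift_ext => x.
by rewrite source_dom => sx; rewrite alpha_dom.
Qed.

Lemma finvol_lift_dom s phi :
  finvol (lift (sinv s * s)%g phi) = lift (sinv s * s)%g (fun x => (phi x)^*).
Proof.
rewrite finvol_lift (sinv_idem (idem_dom s)); apply: lift_ext => x.
by rewrite source_dom => sx; rewrite alpha_dom.
Qed.

(** On the units over [source s] convolution is pointwise and the constant 1 is compactly supported,
    so [k = 1 - sqrt (1 - h ^ 2)] can be formed pointwise within [Cc]. *)
Lemma iota_lift_real_norm s (h : filt -> CC R) : continuous h ->
  (forall x, 0 <= h x) -> (forall x, h x <= 1) ->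
  `|iota (lift (sinv s * s)%g h)| <= 1.
Proof.
move=> ch h0 h1.
pose r x := sqrtC (1 - h x * h x).
have r0 x : 0 <= 1 - h x * h x by rewrite subr_ge0 mulr_ile1.
have cr : continuous r.
  have cq := @continuous_lincomb (-1) _ _ (continuous_mul ch ch) (@continuous_const 1).
  have E : (fun x => -1 * (h x * h x) + 1) = (fun x => 1 - h x * h x).
    by apply/funext => x; rewrite mulN1r addrC.
  by rewrite E in cq; exact: (sqrtC_continuous cq r0).
pose k x := -1 * r x + 1.
have ck : continuous k := @continuous_lincomb (-1) _ _ cr (@continuous_const 1).
have C1 f : continuous f -> @Cc R G (lift (sinv s * s)%g f) by exact: Cc_lift.
have real f : continuous f -> (forall x, (f x)^* = f x) ->
    (iota (lift (sinv s * s)%g f))^† = iota (lift (sinv s * s)%g f).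
  move=> cf fr; rewrite -iotaS; last exact: C1.
  by rewrite finvol_lift_dom; congr iota; apply: lift_ext.
apply: (@norm_le1_unitary _ _ _ (iota (lift (sinv s * s)%g k))).
- by apply: real => // x; rewrite conj_Creal // ger0_real.
- apply: real => // x; rewrite conj_Creal // /k mulN1r rpredD // ?rpredN ger0_real //.
  by rewrite sqrtC_ge0.
- rewrite -!iotaM; [|exact: C1..]; rewrite !conv_lift_dom; congr iota.
  by apply: lift_ext => x _; rewrite mulrC.
- rewrite -!iotaM; [|exact: C1..]; rewrite !conv_lift_dom.
  have ckk := continuous_mul ck ck.
  have E1 := @iota_lift_linear (sinv s * s)%g 1 _ _ ck ck.
  have ckk1 := @continuous_lincomb 1 _ _ ck ck.
  have E2 := @iota_lift_linear (sinv s * s)%g (-1) _ _ ckk ckk1.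
  rewrite scale1r in E1; rewrite addrC -scaleN1r -E1 -E2.
  congr iota; apply: lift_ext => x _.
  have := sqrtCK (1 - h x * h x); rewrite -/(r x) /k => E.
  have -> : -1 * ((-1 * r x + 1) * (-1 * r x + 1)) + (1 * (-1 * r x + 1) + (-1 * r x + 1))
     = 1 - r x ^+ 2 by ring.
  by rewrite E subKr.
Qed.

(** By the C*-identity: the involution of the lift, convolved with the lift, is [|phi| ^ 2] on the
    units over [source s]. *)
Lemma iota_lift_norm s phi (d : CC R) : continuous phi -> 0 < d ->
  (forall x, `|phi x| <= d) -> `|iota (lift s phi)| <= d.
Proof.
move=> cphi d0 phid.
have d2 : 0 < d ^+ 2 by rewrite exprn_gt0.
pose h x := (d ^+ 2)^-1 * (`|phi x| * `|phi x|).
have cn := continuous_mul (continuous_norm cphi) (continuous_norm cphi).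
have ch : continuous h := continuous_mul (@continuous_const _) cn.
have h0 x : 0 <= h x by rewrite mulr_ge0 ?invr_ge0 ?mulr_ge0 // ltW.
have h1 x : h x <= 1.
  by rewrite /h mulrC ler_pdivrMr // mul1r expr2 ler_pM.
have := iota_lift_real_norm s ch h0 h1.
have -> : iota (lift (sinv s * s)%g h) = (d ^+ 2)^-1 *: ((iota (lift s phi))^† ** iota (lift s phi)).
  have Cs := Cc_lift s cphi.
  rewrite -iotaS // -iotaM //; last exact: Cc_finvol_lift.
  have -> : conv (finvol (lift s phi)) (lift s phi) =
      lift (sinv s * s)%g (fun x => `|phi x| * `|phi x|).
    rewrite finvol_lift conv_lift; apply: lift_ext => x; rewrite source_dom => sx.
    by rewrite /= alpha_sinv // mulrC -normCK expr2.
  have El := @iota_lift_linear (sinv s * s)%g (d ^+ 2)^-1 _ _ cn (@continuous_const 0).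
  have E0 : lift (sinv s * s)%g (fun=> 0) = fun=> 0.
    by apply/funext => g; rewrite /germ_lift; case: ifP.
  rewrite E0 iota0 addr0 in El; rewrite -El; congr iota.
  by apply: lift_ext => x _; rewrite addr0.
rewrite normrZ cstar_norm gtr0_norm ?invr_gt0 // mulrC ler_pdivrMr // mul1r.
by rewrite ler_pXn2r ?nnegrE // ltW.
Qed.

Lemma germ_comb_Cc w : @Cc R G (germ_comb w).
Proof.
elim: w => [|[c s] w IH].
  rewrite [germ_comb _](_ : _ = fun=> 0); first exact: Cc0.
  by apply/funext => g; rewrite /germ_comb big_nil.
rewrite [germ_comb _](_ : _ = fun g => lift s (fun=> c * 1) g + germ_comb w g).
  by apply: Cc_add => //; apply: Cc_lift; exact: continuous_const.
by apply/funext => g; rewrite {1}/germ_comb big_cons liftZ.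
Qed.

(** [iota] is a purely algebraic representation; its continuity on each bisection comes from
    [iota_lift_norm]. *)
Lemma iota_approx f (e : CC R) : @Cc R G f -> 0 < e ->
  exists w, `|iota f - iota (germ_comb w)| <= e.
Proof.
move=> /Cc_lift_sum [F fF]; elim: fF e => [|s phi {}F {}f cphi _ fF IH] e e0.
  exists [::]; rewrite [germ_comb _](_ : _ = fun=> 0) ?subrr ?normr0 ?ltW //.
  by apply/funext => g; rewrite /germ_comb big_nil.
have e2 : 0 < e / 2%:R by rewrite divr_gt0.
have [w wE] := IH _ e2; have [u uE] := simple_approx s cphi e2.
exists ([seq (p.1, (s * \val p.2)%g) | p <- u] ++ w).
have Cf := lift_sum_Cc fF; have Cs := Cc_lift s cphi; have Cw := germ_comb_Cc w.
have cu := @simple_continuous R S u; have Cu := Cc_lift s cu.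
have add (f1 f2 : germ S -> CC R) : @Cc R G f1 -> @Cc R G f2 ->
    iota (fun g => f1 g + f2 g) = iota f1 + iota f2.
  move=> C1 C2; rewrite -[iota f1]scale1r -iotaD //; congr iota.
  by apply/funext => g; rewrite mul1r.
rewrite [germ_comb _](_ : _ = fun g => lift s (simple_fun u) g + germ_comb w g); last first.
  by apply/funext => g; rewrite germ_comb_cat lift_simple.
rewrite !add // opprD addrACA (splitr e) (le_trans (ler_normD _ _)) // lerD //.
(* The approximation holds on [source s] only, whereas [iota_lift_norm] asks for a bound everywhere;
   [chi] cuts off the rest. *)
pose chi := simple_fun [:: (1 : CC R, dom_idem s)].
pose psi x := chi x * (-1 * simple_fun u x + phi x).
have -> : iota (lift s phi) - iota (lift s (simple_fun u)) = iota (lift s psi).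
  have El := @iota_lift_linear s (-1) _ _ cu cphi.
  rewrite addrC -scaleN1r -El; congr iota; apply: lift_ext => x sx.
  by rewrite /psi /chi /simple_fun big_seq1 /= (sx : is_true _) mulr1 mul1r.
have cpsi : continuous psi.
  exact: (continuous_mul (@simple_continuous R S _) (@continuous_lincomb (-1) _ _ cu cphi)).
apply: (iota_lift_norm s cpsi e2).
move=> x; rewrite /psi /chi {1}/simple_fun big_seq1 /= mul1r.
have [sx|nsx] := boolP (contains x (dom_idem s)); last by rewrite mul0r normr0 ltW.
by rewrite mul1r mulN1r addrC uE.
Qed.

End LiftNorm.

(** * The isomorphisms *)

Section GroupoidIso.
Variables (R : realType) (S : invSemigroup0Type) (one : S) (B C : cstarType R).
Hypothesis mul1 : forall s : S, (one * s = s /\ s * one = s)%g.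
Variables (pi : S -> B) (iota : (germ S -> CC R) -> C).
Hypothesis hpi : isg_rep pi.
Hypothesis gB : generates (range pi).
Hypothesis hi : @Cc_rep R (universal_groupoid S) C iota.
Local Notation G := (universal_groupoid S).
Implicit Types (s t : S) (w : seq (CC R * S)).

Lemma iota_rep : isg_rep (fun s => iota (germ_ind R s)).
Proof.
have Ci s : @Cc R G (germ_ind R s) by apply: Cc_lift; exact: continuous_const.
have [_ M St] := hi; split=> [s t|s|].
- by rewrite -M // conv_ind.
- by rewrite -St // finvol_ind.
- by rewrite ind0 (iota0 hi).
Qed.

Lemma rep_comb_dense b (e : CC R) : 0 < e -> exists w, `|b - rep_comb pi w| < e.
Proof.
suff E : closure (range (rep_comb pi)) = setT.
  move=> e0; have : closure (range (rep_comb pi)) b by rewrite E.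
  by move=> /closure_normP /(_ _ e0) [_ [[w _ <-] h]]; exists w.
clear b e; rewrite -subTset => x _; have : smallest (@closed_star_subalgebra R B) (range pi) x by rewrite gB.
move=> /(_ (closure (range (rep_comb pi)))); apply; split; last first.
  move=> _ [s _ <-]; apply: subset_closure; exists [:: (1, s)] => //.
  by rewrite /rep_comb big_seq1 scale1r.
have half (e : CC R) : 0 < e -> 0 < e / 2%:R by move=> e0; rewrite divr_gt0.
split.
- exact: closed_closure.
- by apply: subset_closure; exists [::] => //; rewrite /rep_comb big_nil.
- move=> k a a' /closure_normP ca /closure_normP ca'; apply/closure_normP => e e0.
  have K0 : 0 < `|k| + 1 by rewrite ltr_wpDl.
  have [_ [[w _ <-] aw]] := ca _ (divr_gt0 (half _ e0) K0).
  have [_ [[w' _ <-] aw']] := ca' _ (half _ e0).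
  exists (rep_comb pi (comb_scale k w ++ w')); split; first by eexists.
  rewrite rep_comb_cat rep_comb_scale opprD addrACA -scalerBr.
  rewrite (le_lt_trans (ler_normD _ _)) // (splitr e) ler_ltD // normrZ.
  have -> : e / 2%:R = (`|k| + 1) * (e / 2%:R / (`|k| + 1)) by field; rewrite gt_eqF.
  by rewrite ler_pM ?(ltW aw) // lerDl.
- move=> a a' /closure_normP ca /closure_normP ca'; apply/closure_normP => e e0.
  have K0 : 0 < `|a'| + 1 by rewrite ltr_wpDl.
  have [_ [[w _ <-] aw]] := ca _ (divr_gt0 (half _ e0) K0).
  have L0 : 0 < `|rep_comb pi w| + 1 by rewrite ltr_wpDl.
  have [_ [[w' _ <-] aw']] := ca' _ (divr_gt0 (half _ e0) L0).
  exists (rep_comb pi (comb_mul w w')); split; first by eexists.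
  rewrite (rep_comb_mul hpi).
  have -> : a ** a' - rep_comb pi w ** rep_comb pi w' =
     (a - rep_comb pi w) ** a' + rep_comb pi w ** (a' - rep_comb pi w').
    by rewrite cmulBl cmulBr addrA subrK.
  have small (y K : CC R) : 0 < K + 1 -> y < e / 2%:R / (K + 1) -> 0 <= y ->
      y * K < e / 2%:R.
    move=> K1 yl y0; apply: le_lt_trans (_ : y * (K + 1) < _).
      by rewrite ler_wpM2l // lerDl.
    by rewrite -ltr_pdivlMr.
  rewrite (le_lt_trans (ler_normD _ _)) // (splitr e) ltrD //.
    by rewrite (le_lt_trans (cmul_norm _ _)) // small.
  by rewrite (le_lt_trans (cmul_norm _ _)) // mulrC small.
- move=> a /closure_normP ca; apply/closure_normP => e e0.
  have [_ [[w _ <-] aw]] := ca _ e0.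
  exists (rep_comb pi (comb_star w)); split; first by eexists.
  by rewrite (rep_comb_star hpi) -cstarB norm_cstar.
Qed.

Variable phi : B -> C.
Hypothesis hphi : star_hom phi.
Hypothesis phiE : forall s, phi (pi s) = iota (germ_ind R s).
Hypothesis iota_max : forall (A : cstarType R) (rho : (germ S -> CC R) -> A),
  @Cc_rep R G A rho -> forall f, @Cc R G f -> `|rho f| <= `|iota f|.
Hypothesis iota_dense : closure (iota @` @Cc R G) = setT.

Lemma phi_rep_comb w : phi (rep_comb pi w) = iota (germ_comb w).
Proof.
elim: w => [|[c s] w IH].
  rewrite /rep_comb big_nil (star_hom0 hphi) -(iota0 hi); congr iota.
  by apply/funext => g; rewrite /germ_comb big_nil.
rewrite /rep_comb big_cons (star_homD hphi) (star_homZ hphi) -/(rep_comb pi w) IH phiE.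
have [L _ _] := hi; rewrite -L; last exact: germ_comb_Cc.
  by congr iota; apply/funext => g; rewrite /germ_comb big_cons.
by apply: Cc_lift; exact: continuous_const.
Qed.

(** On combinations this is maximality of the norm of [iota], applied to the extension of [pi];
    density does the rest. *)
Lemma phi_bounded_below b : `|b| <= `|phi b|.
Proof.
apply: ltP_eps => // e e0; have e3 : 0 < e / 3%:R by rewrite divr_gt0.
have [w bw] := rep_comb_dense b e3.
have le : `|rep_comb pi w| <= `|phi (rep_comb pi w)|.
  rewrite phi_rep_comb -(rep_ext_comb mul1 hpi).
  by apply: iota_max; [exact: (rep_ext_Cc mul1 hpi)|exact: germ_comb_Cc].
(* Replacing [b] by a combination costs [e / 3], and at most twice that after [phi]. *)
have E : e = 2%:R * (e / 3%:R) + e / 3%:R by field.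
rewrite -(subrK (rep_comb pi w) b) (le_trans (ler_normD _ _)) // addrC.
have -> : phi (b - rep_comb pi w + rep_comb pi w) = phi b by rewrite subrK.
rewrite E addrA lerD ?(ltW bw) // (le_trans le) //.
have -> : phi (rep_comb pi w) = phi b - phi (b - rep_comb pi w).
  by rewrite (star_homB hphi) subKr.
rewrite (le_trans (ler_normB _ _)) // lerD // (le_trans (star_hom_bounded _ hphi)) //.
by rewrite ler_pM2l ?ltr0n // ltW.
Qed.

(** The lower bound gives injectivity and makes approximate preimages converge; these exist because
    images of combinations are dense by [iota_approx]. *)
Lemma phi_bijective : bijective phi.
Proof.
have inj b b' : phi b = phi b' -> b = b'.
  move=> E; apply/eqP; rewrite -subr_eq0 -normr_le0 (le_trans (phi_bounded_below _)) //.
  by rewrite (star_homB hphi) E subrr normr0.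
have surj c : exists b, phi b = c.
  pose Q (e : CC R) b := `|phi b - c| <= e.
  have ex e : 0 < e -> exists b, Q e b.
    move=> e0; have e2 : 0 < e / 2%:R by rewrite divr_gt0.
    have /closure_normP/(_ _ e2) [_ [[f Cf <-] cf]] : closure (iota @` @Cc R G) c.
      by rewrite iota_dense.
    have [w fw] := iota_approx hi Cf e2; exists (rep_comb pi w).
    rewrite /Q phi_rep_comb distrC -(subrKA (iota f)) (le_trans (ler_normD _ _)) //.
    by rewrite (splitr e) lerD // ltW.
  have [//|d e b b' d0 e0 bd be|b bP] := @complete_approx R B Q 1 ltr01.
    rewrite mul1r (le_trans (phi_bounded_below _)) // (star_homB hphi).
    rewrite -(subrKA c) (le_trans (ler_normD _ _)) // lerD //.
    by rewrite distrC.
  (* 7 is 1 + 2 * 3: the error of [phi b'], plus the factor of [star_hom_bounded] times that of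
     [complete_approx]. *)
  exists b; apply/eqP; rewrite -subr_eq0; apply/eqP/(@eps_eq0 _ C 7%:R) => // e e0.
  have [b' Qb'] := ex _ e0.
  have -> : phi b - c = (phi b' - c) - phi (b' - b).
    by rewrite (star_homB hphi) opprB [RHS]addrC subrKA.
  rewrite (le_trans (ler_normB _ _)) // (_ : 7%:R * e = e + 2%:R * (1 * (e *+ 3))); last by ring.
  rewrite lerD // (le_trans (star_hom_bounded _ hphi)) // ler_pM2l ?ltr0n //.
  exact: bP.
have [psi psiK] := choice surj.
by exists psi => [b|//]; apply: inj.
Qed.

End GroupoidIso.

Lemma universal_groupoid_iso (R : realType) (S : invSemigroup0Type) (one : S)
    (B C : cstarType R) : (forall s : S, (one * s = s /\ s * one = s)%g) ->
  is_Cstar_u S B -> is_Cstar_groupoid (universal_groupoid S) C -> cstar_iso B C.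
Proof.
move=> mul1 [pi [hpi gB uB]] [iota [hi dense max]].
have [phi [hphi phiE]] := uB _ _ (iota_rep hi).
exists phi; split=> //.
exact: (phi_bijective mul1 hpi gB hi hphi phiE max dense).
Qed.

Theorem theorem3p3 (R : realType) (P : lcmMonoidType) (A B C : cstarType R) :
  is_Cstar_ts P A ->
  is_Cstar_u (SP P : invSemigroup0Type) B ->
  is_Cstar_groupoid (universal_groupoid (SP P)) C ->
  cstar_iso A B /\ cstar_iso B C.
Proof.
move=> hA hB hC; split; first exact: ts_iso_universal hA hB.
exact: (universal_groupoid_iso (@SP_mul1 P)) hB hC.
Qed.
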